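(* Let $1<p<\infty$ and let $X$ be a separable Banach space not containing a copy of $\ell_1$. Then $X$ has property $(m_p)$ if and only if, given any $\varepsilon>0$, there is a subspace $X_0$ of $C_p$ such that $d(X,X_0)<1+\varepsilon$.
   Context: A separable Banach space $X$ has property $(m_p)$ if $\limsup_n\|x+x_n\|=\left(\|x\|^p+\limsup_n\|x_n\|^p\right)^{1/p}$ whenever $x\in X$ and $x_n\to0$ weakly in $X$. $d(X,Y)=\inf\|T\|\,\|T^{-1}\|$, over all surjective isomorphisms $T:X\to Y$, is the Banach–Mazur distance. Fix a sequence $(E_n)$ of finite-dimensional Banach spaces that is dense in the class of all finite-dimensional Banach spaces in the sense of Banach–Mazur distance (for every finite-dimensional $F$ and $\varepsilon>0$ there is $n$ with $d(E_n,F)<1+\varepsilon$). $C_p=\ell_p(E_n)$ is the $\ell_p$-direct sum of the $E_n$. (Different choices of $(E_n)$ give spaces at Banach–Mazur distance $1$.) ''Not containing a copy of $\ell_1$'' means having no closed subspace isomorphic to $\ell_1$. *)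

(* Defs.v *)
From HB Require Import structures.
From mathcomp Require Import all_boot all_order all_algebra.
From mathcomp Require Import all_classical all_reals all_analysis.

Set Implicit Arguments.
Unset Strict Implicit.
Unset Printing Implicit Defensive.

Import Order.TTheory GRing.Theory Num.Theory.
Import numFieldNormedType.Exports.

Local Open Scope classical_set_scope.
Local Open Scope ring_scope.

Section lp_enorm.
Context {R : realType}.

Definition lp_enorm (p : R) (E : nat -> normedModType R) (x : forall n, E n) :
    \bar R :=
  ((\sum_(0 <= n <oo) (`|x n| `^ p)%:E) `^ p^-1)%E.

Variables (p : R) (p1 : 1 <= p) (E : nat -> normedModType R).
Implicit Types x y : forall n, E n.

Let p_gt0 : 0 < p. Proof. exact: lt_le_trans p1. Qed.

Lemma lp_enormE x :
  lp_enorm p x = 'N[@counting nat R]_p%:E[EFin \o (fun n => `|x n|%R)]%E.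
Proof.
rewrite Lnorm_counting//; congr (_ `^ _)%E.
by apply: eq_eseriesr => n _ /=; rewrite normr_id.
Qed.

Lemma lp_enorm_ge0 x : (0 <= lp_enorm p x)%E.
Proof. exact: poweR_ge0. Qed.

Lemma lp_enorm0 : lp_enorm p (fun n => 0 : E n) = 0%E.
Proof.
rewrite lp_enormE (_ : _ \o _ = cst 0%E) ?Lnorm0 ?gt_eqF ?lte_fin//.
by apply/funext => n /=; rewrite normr0.
Qed.

Lemma le_lp_enorm (x : forall n, E n) (f : nat -> R) :
  (forall n, `|x n| <= f n) ->
  (lp_enorm p x <= 'N[@counting nat R]_p%:E[EFin \o f])%E.
Proof.
move=> xf; rewrite Lnorm_counting//.
have f0 n : 0 <= f n by exact: le_trans (xf n).
rewrite /lp_enorm gt0_ler_poweR//.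
- by rewrite invr_ge0 ltW.
- by rewrite in_itv/= leey andbT; apply: nneseries_ge0 => n _ _; rewrite lee_fin powR_ge0.
- by rewrite in_itv/= leey andbT; apply: nneseries_ge0 => n _ _; rewrite lee_fin powR_ge0.
apply: lee_nneseries => [n _ _|n _]; first by rewrite lee_fin powR_ge0.
by rewrite /= lee_fin ger0_norm// ge0_ler_powR ?nnegrE// ltW.
Qed.

Lemma lp_enormD x y :
  (lp_enorm p (fun n => x n + y n)%R <= lp_enorm p x + lp_enorm p y)%E.
Proof.
rewrite (lp_enormE x) (lp_enormE y).
apply: le_trans (minkowski_EFin _ _ _ p1) => //.
by apply: le_lp_enorm => n; exact: ler_normD.
Qed.

Lemma lp_enormZ (a : R) x :
  lp_enorm p (fun n => a *: x n)%R = (`|a|%:E * lp_enorm p x)%E.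
Proof.
rewrite /lp_enorm.
under eq_eseriesr do rewrite normrZ powRM// EFinM.
rewrite nneseriesZl; last by move=> n _; rewrite lee_fin powR_ge0.
rewrite poweRM ?lee_fin ?powR_ge0//; last first.
  by apply: nneseries_ge0 => n _ _; rewrite lee_fin powR_ge0.
by rewrite poweR_EFin -powRrM mulfV ?gt_eqF// powRr1.
Qed.

Lemma lp_enorm_eq0 x : lp_enorm p x = 0%E -> forall n, x n = 0.
Proof.
move=> /poweR_eq0_eq0 H n.
have F0 k : (0 <= (`|x k| `^ p)%:E)%E by rewrite lee_fin powR_ge0.
have /H S0 : (0 <= \sum_(0 <= k <oo) (`|x k| `^ p)%:E)%E.
  by apply: nneseries_ge0 => k _ _; exact: F0.
have : ((`|x n| `^ p)%:E <= 0)%E.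
  rewrite -S0; apply: (@le_trans _ _ (\sum_(0 <= k < n.+1) (`|x k| `^ p)%:E)%E).
    by rewrite big_nat_recr//= leeDr// sume_ge0.
  by apply: nneseries_lim_ge.
rewrite lee_fin => le0; apply/eqP; rewrite -normr_eq0; apply/eqP.
have : `|x n| `^ p = 0 by apply: le_anti; rewrite le0 powR_ge0.
exact: powR_eq0_eq0.
Qed.

End lp_enorm.

Record lp_sum (R : realType) (p : R) (p1 : 1 <= p) (E : nat -> normedModType R)
  : Type := LpSum {
  lp_seq :> forall n, E n ;
  lp_seq_fin : (lp_enorm p lp_seq < +oo)%E }.

Section lp_sum_normedModType.
Context (R : realType) (p : R) (p1 : 1 <= p) (E : nat -> normedModType R).
Notation T := (lp_sum p1 E).
Implicit Types x y z : T.

HB.instance Definition _ := gen_eqMixin T.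
HB.instance Definition _ := gen_choiceMixin T.

Lemma lp_sumP x y : (forall n, x n = y n) -> x = y.
Proof.
case: x y => [x xfin] [y yfin] /= xy.
have {xy} yx : y = x by apply: functional_extensionality_dep.
by subst y; congr LpSum; exact: Prop_irrelevance.
Qed.

Lemma lp_zero_fin : (lp_enorm p (fun n => 0%R : E n) < +oo)%E.
Proof. by rewrite lp_enorm0. Qed.

Lemma lp_add_fin x y : (lp_enorm p (fun n => x n + y n)%R < +oo)%E.
Proof.
apply: le_lt_trans (lp_enormD p1 _ _) _.
by rewrite lte_add_pinfty// lp_seq_fin.
Qed.

Lemma lp_scale_fin a x : (lp_enorm p (fun n => a *: x n)%R < +oo)%E.
Proof.
rewrite lp_enormZ// lte_mul_pinfty ?lee_fin//; exact: lp_seq_fin.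
Qed.

Lemma lp_opp_fin x : (lp_enorm p (fun n => - x n)%R < +oo)%E.
Proof.
rewrite (_ : (fun n => _) = (fun n => (-1) *: x n)%R); first exact: lp_scale_fin.
by apply: functional_extensionality_dep => n; rewrite scaleN1r.
Qed.

Definition lp_zero : T := LpSum p1 lp_zero_fin.
Definition lp_add x y : T := LpSum p1 (lp_add_fin x y).
Definition lp_opp x : T := LpSum p1 (lp_opp_fin x).
Definition lp_scale a x : T := LpSum p1 (lp_scale_fin a x).

Let lp_addA : associative lp_add.
Proof. by move=> x y z; apply: lp_sumP => n /=; rewrite addrA. Qed.
Let lp_addC : commutative lp_add.
Proof. by move=> x y; apply: lp_sumP => n /=; rewrite addrC. Qed.
Let lp_add0 : left_id lp_zero lp_add.
Proof. by move=> x; apply: lp_sumP => n /=; rewrite add0r. Qed.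
Let lp_addN : left_inverse lp_zero lp_opp lp_add.
Proof. by move=> x; apply: lp_sumP => n /=; rewrite addNr. Qed.

HB.instance Definition _ :=
  GRing.isZmodule.Build T lp_addA lp_addC lp_add0 lp_addN.

Let lp_scaleA a b x : lp_scale a (lp_scale b x) = lp_scale (a * b) x.
Proof. by apply: lp_sumP => n /=; rewrite scalerA. Qed.
Let lp_scale1 : left_id 1 lp_scale.
Proof. by move=> x; apply: lp_sumP => n /=; rewrite scale1r. Qed.
Let lp_scaleDr : right_distributive lp_scale +%R.
Proof. by move=> a x y; apply: lp_sumP => n /=; rewrite scalerDr. Qed.
Let lp_scaleDl x : {morph lp_scale^~ x : a b / a + b}.
Proof. by move=> a b; apply: lp_sumP => n /=; rewrite scalerDl. Qed.

HB.instance Definition _ := GRing.Zmodule_isLmodule.Build R T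
  lp_scaleA lp_scale1 lp_scaleDr lp_scaleDl.

Definition lp_norm x : R := fine (lp_enorm p x).

Lemma lp_normE x : (lp_norm x)%:E = lp_enorm p x.
Proof. by rewrite fineK// ge0_fin_numE ?lp_enorm_ge0// lp_seq_fin. Qed.

Let lp_normD x y : lp_norm (x + y) <= lp_norm x + lp_norm y.
Proof. by rewrite -lee_fin EFinD !lp_normE; exact: lp_enormD. Qed.
Let lp_normZ a x : lp_norm (a *: x) = `|a| * lp_norm x.
Proof. by apply: EFin_inj; rewrite EFinM !lp_normE; exact: lp_enormZ. Qed.
Let lp_norm_eq0 x : lp_norm x = 0 -> x = 0.
Proof.
move=> x0; apply: lp_sumP => n; rewrite (@lp_enorm_eq0 R p E x)//.
by rewrite -lp_normE x0.
Qed.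

HB.instance Definition _ :=
  Lmodule_isNormed.Build R T lp_normD lp_normZ lp_norm_eq0.

End lp_sum_normedModType.

Definition subnormed (R : realType) (V : normedModType R) (S : submodClosed V)
  : Type := {x : V | x \in S}.

Section subnormed_normedModType.
Context (R : realType) (V : normedModType R) (S : submodClosed V).
Notation T := (subnormed S).

HB.instance Definition _ := [isSub of T for @sval V (fun x => x \in S)].
HB.instance Definition _ := [Choice of T by <:].
HB.instance Definition _ := [SubChoice_isSubLmodule of T by <:].

Definition subnormed_norm (x : T) : R := `|\val x|.

Let subnormed_normD x y : subnormed_norm (x + y) <= subnormed_norm x + subnormed_norm y.
Proof. exact: ler_normD. Qed.
Let subnormed_normZ a x : subnormed_norm (a *: x) = `|a| * subnormed_norm x.
Proof. exact: normrZ. Qed.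
Let subnormed_norm_eq0 x : subnormed_norm x = 0 -> x = 0.
Proof. by move=> /normr0_eq0 x0; apply: val_inj. Qed.

HB.instance Definition _ :=
  Lmodule_isNormed.Build R T subnormed_normD subnormed_normZ subnormed_norm_eq0.

End subnormed_normedModType.

Section banach.
Context {R : realType}.
Implicit Types X Y V : normedModType R.

Definition op_norm X Y (T : X -> Y) : \bar R :=
  ereal_sup [set `|T x|%:E | x in [set x : X | `|x| <= 1]].

(* [S] is the inverse of the surjective isomorphism [T]. *)
Definition isomorphism X Y (T : {linear X -> Y}) (S : {linear Y -> X}) : Prop :=
  [/\ continuous T, continuous S, cancel T S & cancel S T].

Definition isomorphic X Y : Prop :=
  exists (T : {linear X -> Y}) (S : {linear Y -> X}), isomorphism T S.

(* [+oo] when [X] and [Y] are not isomorphic. *)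
Definition bm_dist X Y : \bar R :=
  ereal_inf [set d | exists (T : {linear X -> Y}) (S : {linear Y -> X}),
                       isomorphism T S /\ d = (op_norm T * op_norm S)%E].

Definition separable_space (T : topologicalType) : Prop :=
  exists2 D : set T, countable D & dense D.

Definition finite_dim V : Prop :=
  exists (n : nat) (b : 'I_n -> V),
    forall v, exists c : 'I_n -> R, v = \sum_(i < n) c i *: b i.

Definition l1 : normedModType R := lp_sum (lexx (1 : R)) (fun=> R^o).

Definition contains_l1 X : Prop :=
  exists Z : submodClosed X, closed [set x | x \in Z] /\ isomorphic l1 (subnormed Z).

Definition weakly_null X (u : nat -> X) : Prop :=
  forall f : {linear X -> R^o}, continuous f -> f (u n) @[n --> \oo] --> (0 : R^o).

(* Weakly null sequences in a Banach space are bounded, so both limits superior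
   are finite there; [\bar R] only avoids the junk value of a real limsup. *)
Definition property_m X (p : R) : Prop :=
  forall (x : X) (u : nat -> X), weakly_null u ->
    limn_esup (fun n => `|x + u n|%:E) =
    (((`|x| `^ p)%:E + limn_esup (fun n => (`|u n| `^ p)%:E)) `^ p^-1)%E.

Definition bm_dense (E : nat -> completeNormedModType R) : Prop :=
  forall F : completeNormedModType R, finite_dim F ->
    forall e : R, 0 < e -> exists n, (bm_dist (E n) F < (1 + e)%:E)%E.

Definition C_ (p : R) (p1 : 1 < p) (E : nat -> completeNormedModType R) :
  normedModType R := lp_sum (ltW p1) (fun n => E n).

End banach.

(* Main.v *)
(* Property (m_p) says that |x + u_n|^p - |u_n|^p tends to |x|^p along bounded
   weakly null sequences.

   Since X does not contain l_1, bounded sequences have weakly Cauchy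
   subsequences (Rosenthal). Under (m_p) these converge weakly: iterated limits
   of norms of alternating sums grow so slowly, because p > 1, that averages of
   the sequence are norm Cauchy. Hence X* is separable, and weak limits along an
   ultrafilter exist in X and X*. By (m_p) and its dual form, a functional
   splits, up to epsilon, into a part seen by finitely many functionals that are
   small on the first vectors of a dense sequence and a part that is small on
   many more of them, with l_p additivity of the norms. So |x|^p is close to the
   sum of the p-th powers of the suprema of |g x| over finite blocks of
   functionals; cutting the blocks costs little on average over K shifted
   choices of the cuts. Juxtaposing the K choices embeds X into an l_p-sum of
   spaces l_infinity^M with strictly increasing M, and density of (E_n) replaces
   the latter by distinct summands of C_p.

   Conversely, the coordinates in C_p of a weakly null sequence are norm null
   because E_n has finite dimension; truncation then yields the limit form of
   (m_p), which survives passing to X with distortion 1 + e, e -> 0. *)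
Require Import Defs.
From HB Require Import structures.
From mathcomp Require Import all_boot all_order all_algebra.
From mathcomp Require Import all_classical all_reals all_analysis.
From mathcomp Require Import ring lra.

Set Implicit Arguments.
Unset Strict Implicit.
Unset Printing Implicit Defensive.

Import Order.TTheory GRing.Theory Num.Theory.
Import numFieldNormedType.Exports.

Local Open Scope classical_set_scope.
Local Open Scope ring_scope.

Section functionals.
Context {R : realType} {X : normedModType R}.
Implicit Types (f g : X -> R) (x y : X).

Definition lfun f := forall a x y, f (a *: x + y) = a * f x + f y.

Definition dball (C : R) f := lfun f /\ forall x, `|f x| <= C * `|x|.

Lemma lfun0 f : lfun f -> f 0 = 0.
Proof. by move=> /(_ (-1) 0 0); rewrite scaler0 add0r; lra. Qed.

Lemma lfunD f x y : lfun f -> f (x + y) = f x + f y.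
Proof. by move=> /(_ 1 x y); rewrite scale1r mul1r. Qed.

Lemma lfunZ f a x : lfun f -> f (a *: x) = a * f x.
Proof. by move=> lf; rewrite -[a *: x]addr0 lf lfun0// addr0. Qed.

Lemma lfunN f x : lfun f -> f (- x) = - f x.
Proof. by move=> lf; rewrite -scaleN1r lfunZ// mulN1r. Qed.

Lemma lfunB f x y : lfun f -> f (x - y) = f x - f y.
Proof. by move=> lf; rewrite lfunD// lfunN. Qed.

Lemma lfun_sum f I (r : seq I) (P : pred I) (F : I -> X) : lfun f ->
  f (\sum_(i <- r | P i) F i) = \sum_(i <- r | P i) f (F i).
Proof.
move=> lf; elim/big_rec2: _ => [|i y1 y2 _ <-]; first exact: lfun0.
by rewrite lfunD.
Qed.

Lemma dball_zero C : 0 <= C -> dball C (fun=> 0).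
Proof. by move=> C0; split=> [a x y|x]; rewrite ?mulr0 ?addr0 ?normr0 ?mulr_ge0. Qed.

Lemma dballD C D f g : dball C f -> dball D g -> dball (C + D) (fun x => f x + g x).
Proof.
move=> [lf Cf] [lg Dg]; split=> [a x y|x]; first by rewrite lf lg; lra.
by rewrite mulrDl (le_trans (ler_normD _ _))// lerD.
Qed.

Lemma dballZ C a f : dball C f -> dball (`|a| * C) (fun x => a * f x).
Proof.
move=> [lf Cf]; split=> [b x y|x]; first by rewrite lf; lra.
by rewrite normrM -mulrA ler_wpM2l.
Qed.

Lemma dballB C D f g : dball C f -> dball D g -> dball (C + D) (fun x => f x - g x).
Proof.
move=> df /(dballZ (-1)) dg.
have -> : (fun x => f x - g x) = (fun x => f x + (-1) * g x).
  by apply/funext => x; rewrite mulN1r.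
by apply: dballD => //; rewrite normrN1 mul1r in dg.
Qed.

Lemma dball_le C D f : C <= D -> dball C f -> dball D f.
Proof.
by move=> CD [lf Cf]; split => // x; rewrite (le_trans (Cf x))// ler_wpM2r.
Qed.

Lemma dball_leB C f x y : dball C f -> `|f x - f y| <= C * `|x - y|.
Proof. by move=> [lf Cf]; rewrite -lfunB. Qed.

Lemma dball_le1 f x : dball 1 f -> `|x| <= 1 -> `|f x| <= 1.
Proof. by move=> [_ Cf] x1; rewrite (le_trans (Cf x))// mul1r. Qed.

Lemma dball_inv C f : 0 < C -> dball C f -> dball 1 (fun x => C^-1 * f x).
Proof.
move=> C0 /(dballZ C^-1); rewrite ger0_norm ?invr_ge0 ?ltW// mulVf//.
by rewrite gt_eqF.
Qed.

(** * The Hahn-Banach theorem *)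

Definition subspace (V : set X) :=
  V 0 /\ forall a x y, V x -> V y -> V (a *: x + y).

Section hahn_banach.
Variables (V : set X) (g : X -> R) (C : R).
Hypotheses (V_sub : subspace V)
  (g_lin : forall a x y, V x -> V y -> g (a *: x + y) = a * g x + g y)
  (g_bnd : forall x, V x -> `|g x| <= C * `|x|) (C0 : 0 <= C).

(* Graphs of linear extensions of [g] that are dominated by [C |.|]. *)
Let ext (G : set (X * R)) :=
  [/\ forall x, V x -> G (x, g x),
      forall a x y r s, G (x, r) -> G (y, s) -> G (a *: x + y, a * r + s)
    & forall x r, G (x, r) -> r <= C * `|x| ].

Let ext_fun G x r s : ext G -> G (x, r) -> G (x, s) -> r = s.
Proof.
move=> [_ lG bG] Gr Gs.
have := bG _ _ (lG (-1) _ _ _ _ Gr Gs); have := bG _ _ (lG (-1) _ _ _ _ Gs Gr).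
by rewrite scaleN1r addNr normr0 mulr0; lra.
Qed.

Let ext_step G x0 : ext G -> exists c, ext
  [set z | exists y s a, [/\ G (y, s), z.1 = a *: x0 + y & z.2 = a * c + s]].
Proof.
move=> [VG lG bG]; have G0 : G (0, 0).
  have := VG _ V_sub.1; have := g_lin 0 V_sub.1 V_sub.1.
  by rewrite scaler0 addr0 mul0r add0r; have := g_lin 1 V_sub.1 V_sub.1;
    rewrite scaler0 addr0 mul1r => ? _; have -> : g 0 = 0 by lra.
pose S := [set r | exists y s, G (y, s) /\ r = s - C * `|y - x0|].
have ubS y s : G (y, s) -> ubound S (C * `|y + x0| - s).
  move=> Gy _ [z [t [Gz ->]]]; have := bG _ _ (lG 1 _ _ _ _ Gy Gz).
  rewrite scale1r mul1r => h.
  have : C * `|y + z| <= C * (`|y + x0| + `|z - x0|).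
    rewrite ler_wpM2l// -[y + z]addr0 -(subrr x0) addrACA.
    exact: ler_normD.
  by rewrite mulrDr; lra.
have Sn0 : S !=set0 by exists (0 - C * `|0 - x0|); exists 0, 0.
have hS : has_sup S by split => //; exists (C * `|0 + x0| - 0); exact: ubS.
exists (sup S); have up y s : G (y, s) -> sup S <= C * `|y + x0| - s.
  by move=> Gy; apply: ge_sup => //; exact: ubS.
have lo y s : G (y, s) -> s - C * `|y - x0| <= sup S.
  by move=> Gy; apply: ub_le_sup; [case: hS|exists y, s].
have GZ a y s : G (y, s) -> G (a *: y, a * s).
  by move=> Gy; have := lG a _ _ _ _ Gy G0; rewrite !addr0.
split=> [x Vx|a x y r s|x r] /=.
- by exists x, (g x), 0; rewrite scale0r mul0r !add0r; split => //; exact: VG.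
- move=> [x' [r' [b [Gx -> ->]]]] [y' [s' [c [Gy -> ->]]]].
  exists (a *: x' + y'), (a * r' + s'), (a * b + c); split; first exact: lG.
    by rewrite scalerDr scalerDl scalerA addrACA.
  by rewrite mulrDr mulrDl; lra.
move=> [y [s [a [Gy -> ->]]]].
have [a0|a0|->] := ltrgtP a 0; last first.
- by rewrite mul0r scale0r !add0r; exact: bG.
- have := up _ _ (GZ a^-1 _ _ Gy).
  rewrite -(ler_pM2l a0) mulrBr [a * (_ * s)]mulrA mulfV ?gt_eqF// mul1r => h.
  suff : a * (C * `|a^-1 *: y + x0|) = C * `|a *: x0 + y| by lra.
  rewrite mulrCA; congr (_ * _); rewrite -[X in X * _ = _](gtr0_norm a0) -normrZ.
  by rewrite scalerDr scalerA mulfV ?gt_eqF// scale1r addrC.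
have := lo _ _ (GZ (- a^-1) _ _ Gy); have na : 0 < - a by rewrite oppr_gt0.
rewrite -(ler_pM2l na) mulrBr [- a * (_ * s)]mulrA mulrNN mulfV ?lt_eqF// mul1r.
suff : - a * (C * `|- a^-1 *: y - x0|) = C * `|a *: x0 + y| by lra.
rewrite mulrCA; congr (_ * _); rewrite -[X in X * _ = _](gtr0_norm na) -normrZ.
rewrite scalerDr scalerA mulrNN mulfV ?lt_eqF// scale1r scalerN scaleNr opprK.
by rewrite addrC.
Qed.

Lemma hahn_banach : exists f, dball C f /\ forall x, V x -> f x = g x.
Proof.
pose P (G : set (X * R)) := G = set0 \/ ext G.
have [G [PG maxG]] : exists G, P G /\ forall B, G `<` B -> ~ P B.
  apply: Zorn_bigcup => F FP totF.
  have [[G0 FG0 eG0]|noG] := pselect (exists2 G, F G & ext G); last first.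
    left; apply/seteqP; split => // x [B FB Bx].
    have [B0|eB] := FP _ FB; first by rewrite B0 in Bx.
    by case: noG; exists B.
  right; split.
  - by move=> x Vx; exists G0 => //; case: eG0 => + _ _; exact.
  - move=> a x y r s [A FA Ax] [B FB By].
    have [AB|BA] := totF _ _ FA FB.
      exists B => //; have [B0|[_ + _]] := FP _ FB; first by rewrite B0 in By.
      by apply => //; exact: AB.
    exists A => //; have [A0|[_ + _]] := FP _ FA; first by rewrite A0 in Ax.
    by apply => //; exact: BA.
  - move=> x r [A FA Ax]; have [A0|[_ _]] := FP _ FA; first by rewrite A0 in Ax.
    exact.
have eG : ext G.
  case: PG => // G0; pose B := [set z : X * R | V z.1 /\ z.2 = g z.1].
  exfalso; apply: (maxG B); last first.
    right; split => [x Vx|a x y r s [/= Vx ->] [/= Vy ->]|x r [/= Vx ->]] //.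
      by split => /=; [exact: V_sub.2|rewrite g_lin].
    by rewrite (le_trans (ler_norm _))// g_bnd.
  by rewrite G0; apply: properxx || (split=> // /(_ (0, g 0)); apply; split => //=; exact: V_sub.1).
have totG x0 : exists r, G (x0, r).
  have [c ec] := ext_step x0 eG; set B := mkset _ in ec.
  have GB : G `<=` B by move=> [x r] Gx; exists x, r, 0; rewrite scale0r mul0r !add0r.
  have BG : B `<=` G.
    by apply: contrapT => nBG; apply: (maxG B); [split|right].
  exists c; apply: BG; exists 0, 0, 1.
  rewrite scale1r mul1r !addr0; split => //.
  have [VG _ _] := eG; have := VG _ V_sub.1; congr (G (_, _)).
  by have := g_lin 1 V_sub.1 V_sub.1; rewrite scaler0 addr0 mul1r; lra.
have [f Gf] := choice totG; have [VG lG bG] := eG.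
have lf : lfun f by move=> a x y; apply: (ext_fun eG (Gf _)); exact: lG.
exists f; split; last by move=> x Vx; apply: (ext_fun eG (Gf x)); exact: VG.
split => // x; rewrite ler_norml; apply/andP; split; last exact: bG.
by have := bG _ _ (Gf (- x)); rewrite lfunN// normrN; lra.
Qed.

End hahn_banach.

Lemma norming x : exists f, dball 1 f /\ f x = `|x|.
Proof.
have [->|x0] := eqVneq x 0.
  by exists (fun=> 0); rewrite normr0; split => //; exact: dball_zero.
pose V := [set y | exists a, y = a *: x].
have nx : `|x| != 0 by rewrite normr_eq0.
have aP a b : a *: x = b *: x -> a = b.
  by move=> /eqP; rewrite -subr_eq0 -scalerBl scaler_eq0 (negPf x0) orbF subr_eq0 => /eqP.
have [g gP] : exists g : X -> R, forall a, g (a *: x) = a * `|x|.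
  have h y : exists r, forall a, y = a *: x -> r = a * `|x|.
    have [[a ->]|ny] := pselect (V y); first by exists (a * `|x|) => b /aP ->.
    by exists 0 => a ya; case: ny; exists a.
  by have [g gP] := choice h; exists g => a; exact: gP.
have [||||f [df fg]] := @hahn_banach V g 1.
- by split => [|a _ _ [b ->] [c ->]]; [exists 0; rewrite scale0r|
    exists (a * b + c); rewrite scalerDl scalerA].
- by move=> a _ _ [b ->] [c ->]; rewrite scalerA -scalerDl !gP; lra.
- by move=> _ [a ->]; rewrite gP normrM normr_id normrZ mul1r.
- exact: ler01.
exists f; split => //; have -> : f x = g (1 *: x).
  by rewrite fg ?scale1r//; exists 1; rewrite scale1r.
by rewrite gP mul1r.
Qed.

End functionals.

(** * Powers, ultrafilter limits and dual norms *)

Section dual_norm.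
Context {R : realType} {X : normedModType R}.
Implicit Types (f g : X -> R) (x y : X).

Definition dn f : R := sup [set `|f x| | x in [set x : X | `|x| <= 1]].

Lemma dn_has_sup C f : dball C f -> 0 <= C ->
  has_sup [set `|f x| | x in [set x : X | `|x| <= 1]].
Proof.
move=> [_ Cf] C0; split; first by exists `|f 0|; exists 0 => //=; rewrite normr0.
exists C => _ [x /= x1 <-]; rewrite (le_trans (Cf x))// -[leRHS]mulr1.
exact: ler_wpM2l.
Qed.

Lemma dn_le C f : dball C f -> 0 <= C -> dn f <= C.
Proof.
move=> df C0; have [S0 _] := dn_has_sup df C0; apply: ge_sup => // _ [x /= x1 <-].
case: df => _ /(_ x) /le_trans; apply; rewrite -[leRHS]mulr1; exact: ler_wpM2l.
Qed.

Lemma dn_ge C f x : dball C f -> 0 <= C -> `|x| <= 1 -> `|f x| <= dn f.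
Proof.
move=> df C0 x1; have [_ bS] := dn_has_sup df C0.
by apply: ub_le_sup => //; exists x.
Qed.

Lemma dn_ge0 C f : dball C f -> 0 <= C -> 0 <= dn f.
Proof. by move=> df C0; rewrite (le_trans _ (dn_ge df C0 (x := 0) _))// normr0. Qed.

Lemma dn_dball C f : dball C f -> 0 <= C -> dball (dn f) f.
Proof.
move=> df C0; split; first by case: df.
move=> x; have lf := df.1; have [->|x0] := eqVneq x 0.
  by rewrite lfun0// !normr0 mulr0.
have nx : 0 < `|x| by rewrite normr_gt0.
rewrite -ler_pdivrMr// -[X in _ / X]gtr0_norm// -normrV ?unitfE ?gt_eqF//.
rewrite -normrM mulrC -lfunZ//; apply: (dn_ge df C0).
by rewrite normrZ normrV ?unitfE ?gt_eqF// normr_id mulVf// gt_eqF.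
Qed.

Lemma dn_ex C f e : dball C f -> 0 <= C -> 0 < e ->
  exists x, `|x| <= 1 /\ dn f - e < f x.
Proof.
move=> df C0 e0; have [_ [x /= x1 <-] fx] := sup_adherent e0 (dn_has_sup df C0).
have [fx0|fx0] := leP 0 (f x).
  by exists x; split => //; rewrite ger0_norm in fx.
by exists (- x); rewrite normrN (lfunN _ df.1); split => //; rewrite ltr0_norm in fx.
Qed.

End dual_norm.

Section powers.
Context {R : realType}.
Implicit Types (a b p : R).

Lemma powR_root p a : 0 < p -> 0 <= a -> (a `^ p) `^ p^-1 = a.
Proof. by move=> p0 a0; rewrite -powRrM mulfV ?gt_eqF// powRr1. Qed.

Lemma powR_rootV p a : 0 < p -> 0 <= a -> (a `^ p^-1) `^ p = a.
Proof. by move=> p0 a0; rewrite -powRrM mulVf ?gt_eqF// powRr1. Qed.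

Lemma powR_le p a b : 0 <= p -> 0 <= a -> a <= b -> a `^ p <= b `^ p.
Proof. by move=> p0 a0 ab; rewrite ge0_ler_powR// nnegrE (le_trans a0). Qed.

Lemma powR_leE p a b : 0 < p -> 0 <= a -> 0 <= b -> (a `^ p <= b `^ p) = (a <= b).
Proof.
move=> p0 a0 b0; apply/idP/idP; last exact/powR_le/a0/ltW.
move=> /(@powR_le p^-1 _ _); rewrite !powR_root//; apply; last exact: powR_ge0.
by rewrite invr_ge0 ltW.
Qed.

Lemma powR_le1 p a : 0 < p -> 0 <= a -> (a `^ p <= 1) = (a <= 1).
Proof. by move=> p0 a0; have := powR_leE p0 a0 ler01; rewrite powR1. Qed.

Lemma powR_lt p a b : 0 < p -> 0 <= a -> a < b -> a `^ p < b `^ p.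
Proof. by move=> p0 a0 ab; rewrite gt0_ltr_powR// nnegrE// (le_trans a0)// ltW. Qed.

Lemma cvg_powR p T (F : set_system T) (f : T -> R) l : ProperFilter F -> 0 < p ->
  (forall t, 0 <= f t) -> f @ F --> l -> f t `^ p @[t --> F] --> l `^ p.
Proof.
move=> FF p0 f0 fl; have l0 : 0 <= l.
  by apply: cvgr_to_ge fl _; exact: nearW.
have lp0 := powR_ge0 l p.
have ip0 : 0 < p^-1 by rewrite invr_gt0.
apply/cvgrPdist_lt => e e0.
have up : \forall t \near F, f t < (l `^ p + e) `^ p^-1.
  by apply: (cvgr_lt l) => //; rewrite -{1}(powR_root p0 l0) powR_lt// ltrDl.
have lo : \forall t \near F, l `^ p - e < f t `^ p.
  have [le0|le0] := ltP (l `^ p - e) 0.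
    by apply: nearW => t; rewrite (lt_le_trans le0)// powR_ge0.
  have : \forall t \near F, (l `^ p - e) `^ p^-1 < f t.
    by apply: (cvgr_gt l) => //; rewrite -{2}(powR_root p0 l0) powR_lt// ltrBlDr ltrDl.
  apply: filterS => t /(powR_lt p0 (powR_ge0 _ _)); rewrite powR_rootV//.
near=> t; have ltt : f t `^ p < l `^ p + e.
  have /(powR_lt p0 (f0 t)) : f t < (l `^ p + e) `^ p^-1 by near: t.
  by rewrite powR_rootV// addr_ge0// ltW.
have : l `^ p - e < f t `^ p by near: t.
by rewrite ltr_distl; lra.
Unshelve. all: by end_near. Qed.

End powers.

Section ultralimits.
Context {R : realType} (U : set_system nat) (UF : UltraFilter U) (Uoo : \oo `<=` U).

Lemma ulim_ex (F : nat -> R) (C : R) : (forall n, `|F n| <= C) -> exists l : R, F @ U --> l.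
Proof.
move=> FC; have := @segment_compact R (- C) C; rewrite compact_ultra.
pose G : set_system R := F @ U.
have GU : UltraFilter G.
  split=> [|H HF GH]; first exact: fmap_proper_filter.
  apply/seteqP; split => // A HA; have [//|nA] := in_ultra_setVsetC (F @^-1` A) UF.
  have : H (~` A) by apply: GH.
  by move=> /(filterI HA); rewrite setICr => /filter_ex [].
have GI : G `[- C, C]%classic.
  by apply: (@nearW _ U) => n; rewrite /= in_itv/= -ler_norml.
by move=> /(_ G GU GI) [l [_ Gl]]; exists l.
Qed.

Lemma ularge M : \forall n \near U, (M <= n)%N.
Proof. by apply: Uoo; exact: nbhs_infty_ge. Qed.

Lemma cvg_oo_U T (F : nat -> T) (G : set_system T) : F @ \oo `=>` G -> F @ U `=>` G.
Proof. by move=> FG A /FG; exact: Uoo. Qed.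

End ultralimits.

(** * Property (m_p) in terms of limits *)

Section limsup.
Context {R : realType}.
Implicit Types (a : nat -> R) (l : R).

Lemma limsupP a l : limn_esup (fun n => (a n)%:E) = l%:E <->
  (forall e, 0 < e -> \forall n \near \oo, a n < l + e) /\
  (forall e N, 0 < e -> exists2 n, (N <= n)%N & l - e < a n).
Proof.
rewrite /limn_esup limf_esupE; split=> [al|[up fr]].
  split=> [e e0|e N e0].
    have : (ereal_inf [set ereal_sup [set (a n)%:E | n in V] | V in \oo] < (l + e)%:E)%E.
      by rewrite al lte_fin ltrDl.
    move=> /ereal_inf_lt [_ [V Voo <-] Vl]; apply: filterS Voo => n Vn.
    by rewrite -lte_fin; apply: le_lt_trans Vl; apply: ereal_sup_ubound; exists n.
  apply: contrapT => nfr.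
  have : (l%:E <= (l - e)%:E)%E.
    rewrite -al; apply: le_trans (_ : ereal_sup [set (a n)%:E | n in [set n | (N <= n)%N]] <= _)%E.
      by apply: ereal_inf_lbound; exists [set n | (N <= n)%N] => //; exact: nbhs_infty_ge.
    apply: ge_ereal_sup => _ [n /= Nn <-]; rewrite lee_fin leNgt.
    by apply/negP => ?; apply: nfr; exists n.
  by rewrite lee_fin; lra.
apply/eqP; rewrite eq_le; apply/andP; split.
  apply/lee_addgt0Pr => e e0; apply: ereal_inf_le.
  exists (ereal_sup [set (a n)%:E | n in [set n | a n < l + e]]).
    by exists [set n | a n < l + e] => //; exact: up.
  by apply: ge_ereal_sup => _ [n /= an <-]; rewrite -EFinD lee_fin ltW.
apply: le_ereal_inf_tmp => _ [V [N _ NV] <-]; apply/lee_subgt0Pr => e e0.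
have [n Nn an] := fr _ N e0; rewrite -EFinB.
apply: le_trans (_ : (a n)%:E <= _)%E; first by rewrite lee_fin ltW.
by apply: ereal_sup_ubound; exists n => //; exact: NV.
Qed.

Lemma limsup_ex a C : (forall n, `|a n| <= C) ->
  exists l, limn_esup (fun n => (a n)%:E) = l%:E.
Proof.
move=> aC; pose s := limn_esup (fun n => (a n)%:E).
suff : s \is a fin_num by exists (fine s); rewrite fineK.
rewrite fin_numElt; apply/andP; split.
  apply: lt_le_trans (_ : (- C)%:E <= _)%E; first exact: ltNyr.
  apply: le_ereal_inf_tmp => _ [V [N _ NV] <-].
  apply: le_trans (_ : (a N)%:E <= _)%E.
    by rewrite lee_fin; have := aC N; rewrite ler_norml => /andP[].
  by apply: ereal_sup_ubound; exists N => //; apply: NV => /=.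
apply: le_lt_trans (_ : C%:E < _)%E; last exact: ltry.
apply: ereal_inf_le.
exists (ereal_sup [set (a n)%:E | n in setT]); first by exists setT => //; exact: filterT.
by apply: ge_ereal_sup => _ [n _ <-]; rewrite lee_fin; have := aC n; rewrite ler_norml => /andP[].
Qed.

Lemma limsup_pinfty a : (forall M N, exists2 n, (N <= n)%N & M < a n) ->
  limn_esup (fun n => (a n)%:E) = +oo%E.
Proof.
move=> fr; apply/eqP; rewrite -leye_eq; apply: le_ereal_inf_tmp => _ [V [N _ NV] <-].
rewrite leye_eq; apply/eqP/eqyP => M M0; have [n Nn an] := fr M N.
apply: le_trans (_ : (a n)%:E <= _)%E; first by rewrite lee_fin ltW.
by apply: ereal_sup_ubound; exists n => //; exact: NV.
Qed.

Lemma limsup_ge0 a l : (forall n, 0 <= a n) ->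
  limn_esup (fun n => (a n)%:E) = l%:E -> 0 <= l.
Proof.
move=> a0 /limsupP[up _]; apply/ler_addgt0Pl => e e0; rewrite addrC.
by have [N _ NP] := up e e0; rewrite (le_trans (a0 N))// ltW//; apply: NP => /=.
Qed.

Lemma limsup_powR p a l : 0 < p -> (forall n, 0 <= a n) ->
  limn_esup (fun n => (a n)%:E) = l%:E ->
  limn_esup (fun n => (a n `^ p)%:E) = (l `^ p)%:E.
Proof.
move=> p0 a0 al; have l0 := limsup_ge0 a0 al; have lp0 := powR_ge0 l p.
have ip0 : 0 < p^-1 by rewrite invr_gt0.
move: al => /limsupP[up fr]; apply/limsupP; split=> [e e0|e N e0].
  have d0 : 0 < (l `^ p + e) `^ p^-1 - l.
    by rewrite subr_gt0 -{1}(powR_root p0 l0) powR_lt// ltrDl.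
  have := up _ d0; apply: filterS => n; rewrite addrC subrK.
  by move=> /(powR_lt p0 (a0 n)); rewrite powR_rootV// addr_ge0// ltW.
have [le0|le0] := ltP (l `^ p - e) 0.
  by exists N => //; rewrite (lt_le_trans le0)// powR_ge0.
have d0 : 0 < l - (l `^ p - e) `^ p^-1.
  by rewrite subr_gt0 -{2}(powR_root p0 l0) powR_lt// ltrBlDr ltrDl.
have [n Nn] := fr _ N d0; rewrite opprB addrC subrK => /(powR_lt p0 (powR_ge0 _ _)).
by rewrite powR_rootV//; exists n.
Qed.

End limsup.

Section property_m_limit.
Context {R : realType} {X : normedModType R} (p : R) (p0 : 0 < p).

Definition weak0 (u : nat -> X) :=
  forall f, dball 1 f -> f (u n) @[n --> \oo] --> (0 : R).

Definition mprop := forall (x : X) (u : nat -> X) (C : R),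
  (forall n, `|u n| <= C) -> weak0 u ->
  `|x + u n| `^ p - `|u n| `^ p @[n --> \oo] --> `|x| `^ p.

Lemma weakly_nullE (u : nat -> X) : weakly_null u <-> weak0 u.
Proof.
split=> [wu f df|wu f cf].
  have lf : linear (f : X -> R^o) by move=> a x y; rewrite df.1.
  pose F : {linear X -> R^o} := HB.pack (f : X -> R^o) (GRing.isLinear.Build _ _ _ _ _ lf).
  apply: (wu F); apply: bounded_linear_continuous; apply/bounded_funP => r.
  by exists r => x xr; rewrite (le_trans (df.2 x))// mul1r.
have /linear_bounded_continuous/linear_boundedP[M [Mr fM]] := cf.
pose C : R := `|M| + 1.
have C0 : 0 < C by rewrite ltr_wpDl.
have df : dball C (f : X -> R).
  split=> [a x y|x]; first by rewrite linearP.
  by apply: fM; rewrite /C (le_lt_trans (ler_norm M))// ltrDl.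
have fE : (fun n => f (u n)) = (fun n => C * (C^-1 * f (u n))).
  by apply/funext => n; rewrite mulrA mulfV ?mul1r// gt_eqF.
rewrite fE -(mulr0 C); apply: cvgMl_tmp; exact: (wu _ (dball_inv C0 df)).
Qed.

Lemma weak0_sub (u : nat -> X) (h : nat -> nat) :
  (forall n, (n <= h n)%N) -> weak0 u -> weak0 (u \o h).
Proof.
move=> hn wu f df; apply/cvgrPdist_lt => e e0.
have /cvgrPdist_lt/(_ e e0) [N _ NP] := wu f df.
by exists N => // n /= Nn; apply: NP => /=; exact: leq_trans (hn n).
Qed.

(* Along a weakly null sequence the two upper limits of property (m_p) differ
   by |x|^p; applied to subsequences this forces convergence. *)
Let mprop_limsup (x : X) (v : nat -> X) (C : R) : property_m X p ->
  (forall n, `|v n| <= C) -> weak0 v -> exists A : R,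
  [/\ forall e, 0 < e -> \forall n \near \oo, `|v n| `^ p < A + e,
      forall e N, 0 < e -> exists2 n, (N <= n)%N & A - e < `|v n| `^ p,
      forall e, 0 < e -> \forall n \near \oo, `|x + v n| `^ p < `|x| `^ p + A + e &
      forall e N, 0 < e ->
        exists2 n, (N <= n)%N & `|x| `^ p + A - e < `|x + v n| `^ p].
Proof.
move=> Xm vC /weakly_nullE wv.
have [A AE] : exists A, limn_esup (fun n => (`|v n| `^ p)%:E) = A%:E.
  apply: (@limsup_ex _ _ (C `^ p)) => n.
  by rewrite ger0_norm ?powR_ge0// powR_le// ltW.
have A0 : 0 <= A by apply: limsup_ge0 AE => n; exact: powR_ge0.
have := Xm x v wv; rewrite AE -EFinD poweR_EFin => /(limsup_powR p0 (fun=> normr_ge0 _)).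
rewrite powR_rootV ?addr_ge0 ?powR_ge0// => /limsupP [xup xfr].
by move: AE => /limsupP [up fr]; exists A.
Qed.

Lemma property_m_mprop : property_m X p -> mprop.
Proof.
move=> Xm x u C uC wu; pose a n := `|x + u n| `^ p - `|u n| `^ p.
have sub (P : nat -> Prop) : (forall N, exists2 n, (N <= n)%N & P n) ->
    exists2 v, (forall n, `|v n| <= C) /\ weak0 v & forall n, exists m, v n = u m /\ P m.
  move=> h; have {}h N : exists n, (N <= n)%N /\ P n by have [n] := h N; exists n.
  have [k kP] := choice h; exists (u \o k).
    by split=> [n|]; [exact: uC|apply: weak0_sub => // n; case: (kP n)].
  by move=> n; exists (k n); case: (kP n).
have up e : 0 < e -> \forall n \near \oo, a n < `|x| `^ p + e.
  move=> e0; apply: contrapT => nup.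
  have [|v [vC wv] vP] := sub (fun n => `|x| `^ p + e <= a n).
    move=> N; apply: contrapT => h; apply: nup; exists N => // n /= Nn.
    by rewrite ltNge; apply/negP => ?; apply: h; exists n.
  have e2 : 0 < e / 2 by rewrite divr_gt0.
  have [A [_ fr + _]] := mprop_limsup x Xm vC wv.
  move=> /(_ _ e2)[N _ NP]; have [n Nn] := fr _ N e2.
  by have := NP n Nn; have [m [-> ]] := vP n; rewrite /a /=; lra.
have lo e : 0 < e -> \forall n \near \oo, `|x| `^ p - e < a n.
  move=> e0; apply: contrapT => nup.
  have [|v [vC wv] vP] := sub (fun n => a n <= `|x| `^ p - e).
    move=> N; apply: contrapT => h; apply: nup; exists N => // n /= Nn.
    by rewrite ltNge; apply/negP => ?; apply: h; exists n.
  have e2 : 0 < e / 2 by rewrite divr_gt0.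
  have [A [+ _ _ fr]] := mprop_limsup x Xm vC wv.
  move=> /(_ _ e2)[N _ NP]; have [n Nn] := fr _ N e2.
  by have := NP n Nn; have [m [-> ]] := vP n; rewrite /a /=; lra.
apply/cvgrPdist_lt => e e0; near=> n.
have h1 : a n < `|x| `^ p + e by near: n; exact: up.
have h2 : `|x| `^ p - e < a n by near: n; exact: lo.
by move: h1 h2; rewrite /a distrC ltr_distl => -> ->.
Unshelve. all: by end_near. Qed.

Lemma mprop_property_m : mprop -> property_m X p.
Proof.
move=> Xm x u /weakly_nullE wu; have ip0 : 0 < p^-1 by rewrite invr_gt0.
have [[C uC]|nb] := pselect (exists C, forall n, `|u n| <= C); last first.
  have big M N : exists2 n, (N <= n)%N & M < `|u n|.
    apply: contrapT => h; apply: nb; exists (`|M| + \sum_(i < N) `|u i|) => n.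
    have S0 : 0 <= \sum_(i < N) `|u i| by apply: sumr_ge0.
    have [nN|Nn] := ltnP n N.
      rewrite (bigD1 (Ordinal nN))//= ler_wpDl// lerDl; exact: sumr_ge0.
    rewrite (le_trans _ (_ : `|M| <= _)) ?lerDl// (le_trans _ (ler_norm M))//.
    by rewrite leNgt; apply/negP => ?; apply: h; exists n.
  rewrite limsup_pinfty; last first.
    move=> M N; have [n Nn un] := big (M + `|x|) N; exists n => //.
    have : `|u n| <= `|x + u n| + `|x|.
      by rewrite -{1}[u n](addKr x) addrC; exact: ler_normB.
    by lra.
  rewrite limsup_pinfty; first by rewrite addey// poweRyr// invr_eq0 gt_eqF.
  move=> M N; have [n Nn un] := big (`|M| `^ p^-1) N; exists n => //.
  rewrite (le_lt_trans (ler_norm M))// -(powR_rootV p0 (normr_ge0 M)).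
  by rewrite powR_lt// powR_ge0.
have [A AE] : exists A, limn_esup (fun n => (`|u n| `^ p)%:E) = A%:E.
  apply: (@limsup_ex _ _ (C `^ p)) => n.
  by rewrite ger0_norm ?powR_ge0// powR_le// ltW.
rewrite AE -EFinD poweR_EFin.
suff /(limsup_powR ip0 (fun=> powR_ge0 _ _)) :
    limn_esup (fun n => (`|x + u n| `^ p)%:E) = (`|x| `^ p + A)%:E.
  by under eq_fun do rewrite powR_root//.
move: AE => /limsupP [up fr]; apply/limsupP; split=> [e e0|e N e0].
  have e2 : 0 < e / 2 by rewrite divr_gt0.
  have /cvgrPdist_lt/(_ _ e2) := Xm x u C uC wu.
  move: (up _ e2); apply: filterS2 => n; rewrite ltr_norml.
  by move=> ? /andP[]; lra.
have e2 : 0 < e / 2 by rewrite divr_gt0.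
have /cvgrPdist_lt/(_ _ e2) [M _ MP] := Xm x u C uC wu.
have [n nMN] := fr _ (maxn M N) e2; move: nMN; rewrite geq_max => /andP[Mn Nn].
by have := MP n Mn; rewrite /= ltr_norml => /andP[]; exists n => //; lra.
Qed.

End property_m_limit.

Arguments mprop {R} X p.
Arguments weak0 {R X} u.

(** * Rosenthal's theorem *)

Section rosenthal.
Context {T : Type} (W : bool -> nat -> set T).
Implicit Types (M L : set nat) (D : set T).

Definition unbounded M := forall N, exists2 n, (N <= n)%N & M n.

Definition oscillates M s := forall b N, exists n, [/\ (N <= n)%N, M n & W b n s].

Definition oscillating M D := forall L, L `<=` M -> unbounded L ->
  exists2 s, D s & oscillates L s.

Lemma pigeonhole (I : finType) (f : nat -> I) :
  exists i, unbounded [set n | f n = i].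
Proof.
apply: contrapT => h.
have {h}h i : exists N, forall n, (N <= n)%N -> f n != i.
  apply: contrapT => hi; apply: h; exists i => N; apply: contrapT => hN.
  by apply: hi; exists N => n Nn; apply/eqP => fi; apply: hN; exists n.
have [g gP] := choice h; pose N := \max_i g i.
by have := gP (f N) N (leq_bigmax (f N)); rewrite eqxx.
Qed.

(* If every candidate [j] failed, some set D_i `&` W b j would be
   non-oscillating along a further subsequence; iterating, one pair (i, b)
   recurs infinitely often, and the corresponding [j]'s form a subsequence on
   which D_i does not oscillate. *)
Lemma oscillating_step k (D : nat -> set T) M N : unbounded M ->
  (forall i, (i < k)%N -> oscillating M (D i)) ->
  exists j M', [/\ (N <= j)%N, M j, M' `<=` M, unbounded M' &
    forall i b, (i < k)%N -> oscillating M' (D i `&` W b j)].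
Proof.
move=> M_unb DM; apply: contrapT => nostep.
have next (z : set nat * nat) : exists w : nat * (nat * bool) * set nat,
    z.1 `<=` M -> unbounded z.1 -> (N <= z.2)%N ->
    [/\ (z.2 <= w.1.1)%N /\ z.1 w.1.1, (w.1.2.1 < k)%N, w.2 `<=` z.1, unbounded w.2 &
      forall s, D w.1.2.1 s -> W w.1.2.2 w.1.1 s -> ~ oscillates w.2 s].
  case: z => L K /=; have [[LM L_unb NK]|nh] := pselect [/\ L `<=` M, unbounded L & (N <= K)%N]; last first.
    by exists (0%N, (0%N, true), L) => *; case: nh.
  have [j Kj Lj] := L_unb K.
  have : ~ forall i b, (i < k)%N -> oscillating L (D i `&` W b j).
    by move=> h; apply: nostep; exists j, L; split=> //; [exact: leq_trans Kj|exact: LM].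
  move=> /existsNP[i /existsNP[b /not_implyP[ik /existsNP[L' /not_implyP[L'L /not_implyP[L'_unb no]]]]]].
  exists (j, (i, b), L') => _ _ _; split => // s Ds Ws os; apply: no.
  by exists s.
have [F FP] := choice next.
pose st := fix st n := if n is m.+1 then ((F (st m)).2, (F (st m)).1.1.+1) else (M, N).
have stP n : [/\ (st n).1 `<=` M, unbounded (st n).1 & (N <= (st n).2)%N].
  elim: n => [|n [h1 h2 h3]]; first by split.
  have [[h4 h5] _ h6 h7 _] := FP _ h1 h2 h3; split => //=.
    exact: subset_trans h1.
  by rewrite (leq_trans h3)// (leq_trans h4).
pose j n := (F (st n)).1.1; pose ib n := (F (st n)).1.2.
have FPn n := let: And3 h1 h2 h3 := stP n in FP _ h1 h2 h3.
have stS n m : (n <= m)%N -> (st m).1 `<=` (st n).1 /\ ((st n).2 <= (st m).2)%N.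
  elim: m => [|m IHm]; first by rewrite leqn0 => /eqP ->; split.
  rewrite leq_eqVlt => /predU1P[->|]; [by split|rewrite ltnS => /IHm[h1 h2]].
  have [[h4 _] _ h6 _ _] := FPn m; split; first exact: subset_trans h1.
  by rewrite (leq_trans h2)// (leq_trans h4)/=.
have jlt n m : (n < m)%N -> (j n < j m)%N.
  move=> /stS[_ h]; have [[h4 _] _ _ _ _] := FPn m.
  by rewrite (leq_trans _ h4)// (leq_trans _ h).
have ibk n : ((ib n).1 < k)%N by have [_ ? _ _ _] := FPn n.
have [[i b] ibP] := pigeonhole (fun n => (Ordinal (ibk n), (ib n).2)).
pose L := [set j n | n in [set n | (Ordinal (ibk n), (ib n).2) = (i, b)]].
have nj n : (n <= j n)%N.
  by elim: n => // n IHn; rewrite (leq_ltn_trans IHn)// jlt.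
have LM : L `<=` M.
  by move=> _ [n _ <-]; have [[_ h] _ _ _ _] := FPn n; have [+ _ _] := stP n; exact.
have Lunb : unbounded L.
  by move=> K; have [n Kn nP] := ibP K; exists (j n); [exact: leq_trans (nj n)|exists n].
have [s Ds os] := DM i (ltn_ord i) L LM Lunb.
have [_ [_ [n nP <-] Wn]] := os b 0%N.
have [_ _ _ _ /(_ s)] := FPn n; rewrite -/(ib n) -/(j n).
case: nP => /(congr1 val)/= -> ->; apply => // b' K.
have [m' [+ [m mP mm'] Wm]] := os b' (maxn K (j n).+1).
rewrite -mm' geq_max => /andP[Km nm]; exists (j m); split => //; last by rewrite mm'.
have nltm : (n < m)%N.
  by rewrite ltnNge leq_eqVlt; apply/negP => /predU1P[mn|/jlt]; [rewrite mn ltnn in nm|rewrite ltnNge ltnW].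
have [+ _] := stS _ _ nltm; apply.
by have [[_ h] _ _ _ _] := FPn m.
Qed.

Lemma independent_subsequence M D : unbounded M -> oscillating M D ->
  exists h : nat -> nat, [/\ forall n, (h n < h n.+1)%N, forall n, M (h n) &
    forall n (b : nat -> bool), exists2 s, D s & forall i, (i < n)%N -> W (b i) (h i) s].
Proof.
move=> M_unb MD; pose state : Type := set nat * (nat -> set T) * nat * nat.
pose ok (z : state) := [/\ z.1.1.1 `<=` M, unbounded z.1.1.1 &
  forall i, (i < z.1.2)%N -> oscillating z.1.1.1 (z.1.1.2 i)].
have next (z : state) : exists w : nat * set nat, ok z ->
   [/\ (z.2 <= w.1)%N, z.1.1.1 w.1, w.2 `<=` z.1.1.1, unbounded w.2 &
    forall i b, (i < z.1.2)%N -> oscillating w.2 (z.1.1.2 i `&` W b w.1)].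
  have [okz|nok] := pselect (ok z); last by exists (0%N, setT).
  have [_ zu zo] := okz; have [j [M' jM']] := oscillating_step z.2 zu zo.
  by exists (j, M').
have [F FP] := choice next.
pose upd (z : state) : state := ((F z).2, fun i => z.1.1.2 i./2 `&` W (odd i) (F z).1,
  z.1.2.*2, (F z).1.+1).
pose st n := iter n upd (M, fun=> D, 1%N, 0%N).
have stP n : ok (st n).
  elim: n => [|n IHn]; first by split.
  have [h1 h2 h3 h4 h5] := FP _ IHn; have [h6 h7 h8] := IHn; split => //=.
    exact: subset_trans h6.
  by move=> i; rewrite -ltn_half_double => ik; exact: h5.
pose h n := (F (st n)).1.
exists h; split=> [n|n|n b].
- by have [+ _ _ _ _] := FP _ (stP n.+1).
- by have [_ + _ _ _] := FP _ (stP n); have [+ _ _] := stP n; apply.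
have [i ik iP] : exists2 i, (i < (st n).1.2)%N & (st n).1.1.2 i `<=` D `&` [set s | forall l, (l < n)%N -> W (b l) (h l) s].
  elim: n => [|n [i ik iP]]; first by exists 0%N.
  exists (b n + i.*2)%N => /=.
    by rewrite -ltn_half_double half_bit_double.
  rewrite half_bit_double oddD odd_double addbF oddb => s [/iP[Ds sP] Ws].
  by split => // l; rewrite ltnS leq_eqVlt => /predU1P[->//|]; exact: sP.
have [h1 h2 h3] := stP n.
by have [|s /iP[Ds sP] _] := h3 i ik (st n).1.1.1 _ h2 => //; exists s.
Qed.

End rosenthal.

Section weakly_cauchy.
Context {R : realType} {X : normedModType R}.

Definition weakly_cauchy (x : nat -> X) :=
  forall f, dball 1 f -> exists l : R, f (x n) @[n --> \oo] --> l.

Lemma osc_cvg (a : nat -> R) (C : R) : (forall n, `|a n| <= C) ->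
  (forall r s : rat, r < s -> ~ ((forall N, exists2 n, (N <= n)%N & a n < ratr r) /\
                         (forall N, exists2 n, (N <= n)%N & ratr s < a n))) ->
  exists l : R, a @ \oo --> l.
Proof.
move=> aC nosc; have [l /limsupP[up fr]] := limsup_ex aC; exists l.
have lo e : 0 < e -> \forall n \near \oo, l - e < a n.
  move=> e0; apply: contrapT => nlo.
  have /rat_in_itvoo[r /itvP rP] : l - e < l - e / 2 by lra.
  have /rat_in_itvoo[s /itvP sP] : l - e / 2 < l - e / 4 by lra.
  have rs : r < s by rewrite -(ltr_rat R) (lt_trans (y := l - e / 2))// ?rP ?sP.
  apply: (nosc r s rs); split=> N.
    apply: contrapT => h; apply: nlo; exists N => // n Nn; rewrite ltNge; apply/negP => an.
    by apply: h; exists n => //; rewrite (le_lt_trans an)// rP.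
  have [|n Nn an] := fr (e / 4) N; first by rewrite divr_gt0.
  by exists n => //; rewrite (lt_trans _ an)// sP.
apply/cvgrPdist_lt => e e0; near=> n; rewrite distrC ltr_distl; apply/andP; split.
  by near: n; exact: lo.
by near: n; exact: up.
Unshelve. all: by end_near. Qed.

Definition osc_sets (x : nat -> X) (r s : R) (b : bool) (n : nat) : set (X -> R) :=
  if b then [set f | s < f (x n)] else [set f | f (x n) < r].

Lemma weakly_cauchy_or_oscillating (x : nat -> X) (C : R) : (forall n, `|x n| <= C) ->
  (exists h : nat -> nat, (forall n, (h n < h n.+1)%N) /\ weakly_cauchy (x \o h)) \/
  (exists (r s : R) (M : set nat), [/\ r < s, unbounded M &
    oscillating (osc_sets x r s) M (dball 1)]).
Proof.
move=> xC; set P2 := (X in _ \/ X); have [|no] := pselect P2; first by right.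
left; pose Bn (k : nat) (L : set nat) := forall rs : rat * rat, unpickle k = Some rs ->
  rs.1 < rs.2 -> forall f, dball 1 f -> ~ oscillates (osc_sets x (ratr rs.1) (ratr rs.2)) L f.
have next (kM : nat * set nat) : exists L, unbounded kM.2 ->
    [/\ L `<=` kM.2, unbounded L & Bn kM.1 L].
  case: kM => k M /=; case E : (unpickle k : option (rat * rat)) => [[r s]|]; last first.
    by exists M => Mu; split => // rs; rewrite E.
  have [rs|sr] := ltP r s; last first.
    by exists M => Mu; split => // rs; rewrite E => -[<-] /=; rewrite ltNge sr.
  apply: contrapT => h; apply: no; exists (ratr r), (ratr s), M.
  split; first by rewrite ltr_rat.
    by apply: contrapT => nu; apply: h; exists M.
  move=> L LM Lu; apply: contrapT => nL; apply: h; exists L => Mu; split => // rs'.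
  by rewrite E => -[<-] _ f df of_; apply: nL; exists f.
have [F FP] := choice next.
pose L := fix L n := if n is m.+1 then F (m, L m) else setT.
have Lu n : unbounded (L n).
  by elim: n => [N|n IHn]; [exists N|have [] := FP (n, L n) IHn].
have LS n m : (n <= m)%N -> L m `<=` L n.
  elim: m => [|m IHm]; first by rewrite leqn0 => /eqP ->.
  rewrite leq_eqVlt => /predU1P[->//|]; rewrite ltnS => /IHm.
  by apply: subset_trans; have [] := FP (m, L m) (Lu m).
have hg (nN : nat * nat) : exists k, (nN.2 <= k)%N /\ L nN.1 k.
  by have [k] := Lu nN.1 nN.2; exists k.
have [g gP] := choice hg.
pose h := fix h n := if n is m.+1 then g (n.+1, (h m).+1) else g (1%N, 0%N).
have hS n : (h n < h n.+1)%N by have [] := gP (n.+2, (h n).+1).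
have hL n : L n.+1 (h n).
  by case: n => [|n]; [case: (gP (1%N, 0%N))|case: (gP (n.+2, (h n).+1))].
exists h; split => // f df; apply: (@osc_cvg _ C) => [n|r s rs [lo up]].
  by rewrite (le_trans (df.2 _))// mul1r; exact: xC.
have [_ _ /(_ (r, s)) bad] := FP (pickle (r, s), L (pickle (r, s))) (Lu _).
have homoh : {homo h : m n / (m <= n)%N}.
  by apply: homo_leq => // [|n]; [exact: leq_trans|exact: ltnW].
have nh n : (n <= h n)%N by elim: n => // n IHn; rewrite (leq_ltn_trans IHn).
apply: (bad _ rs f df); first by rewrite pickleK.
have Lh n : (pickle (r, s) <= n)%N -> L (pickle (r, s)).+1 (h n).
  by move=> kn; apply: (LS _ n.+1 _ _ (hL n)).
move=> b N; case: b.
  have [n] := up (maxn N (pickle (r, s))); rewrite geq_max => /andP[Nn kn] sn.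
  by exists (h n); split; [exact: leq_trans (nh n)|exact: Lh|].
have [n] := lo (maxn N (pickle (r, s))); rewrite geq_max => /andP[Nn kn] sn.
by exists (h n); split; [exact: leq_trans (nh n)|exact: Lh|].
Qed.

Lemma rosenthal_l1 (x : nat -> X) (r s : R) (M : set nat) : unbounded M ->
  oscillating (osc_sets x r s) M (dball 1) ->
  exists h : nat -> nat, forall n (c : nat -> R),
    (s - r) * \sum_(i < n) `|c i| <= 2 * `|\sum_(i < n) c i *: x (h i)|.
Proof.
move=> Mu /(independent_subsequence Mu)[h [_ _ hP]]; exists h => n c.
have [f df fP] := hP n (fun i => 0 <= c i).
have [g dg gP] := hP n (fun i => c i < 0).
pose v : X := \sum_(i < n) c i *: x (h i); rewrite -/v.
have fv : f v - g v <= 2 * `|v|.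
  have := df.2 v; have := dg.2 v; rewrite !ler_norml !mul1r => /andP[? ?] /andP[? ?]; lra.
apply: le_trans fv; rewrite /v (lfun_sum _ _ _ df.1) (lfun_sum _ _ _ dg.1).
rewrite -sumrB mulr_sumr; apply: ler_sum => i _.
rewrite (lfunZ _ _ df.1) (lfunZ _ _ dg.1) -mulrBr.
have := fP i (ltn_ord i); have := gP i (ltn_ord i).
have [c0|c0] := leP 0 (c i); rewrite /osc_sets/=.
  by rewrite ger0_norm// [c i * _]mulrC => ? ?; apply: ler_wpM2r => //; lra.
rewrite ltr0_norm// => ? ?; rewrite mulrN -mulNr mulrC -[leRHS]opprK -mulrN lerNr -mulrN.
by apply: ler_wnM2l; [exact: ltW|lra].
Qed.

End weakly_cauchy.

(** * Sums in l_p *)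

Section complete_sequences.
Context {R : realType}.

Definition cauchy_sequence (V : normedModType R) (u : nat -> V) :=
  forall e : R, 0 < e -> exists N, forall m n, (N <= m)%N -> (N <= n)%N -> `|u m - u n| <= e.

Definition seq_complete (V : normedModType R) :=
  forall u : nat -> V, cauchy_sequence u -> exists l : V, u @ \oo --> l.

Lemma complete_seq_complete (V : completeNormedModType R) : seq_complete V.
Proof.
move=> u uc; have : cauchy (u @ \oo).
  apply/cauchy_ballP => e e0; have e2 : 0 < e / 2 by rewrite divr_gt0.
  have [N NP] := uc _ e2; rewrite near_map2; exists ([set n | (N <= n)%N], [set n | (N <= n)%N]) => /=.
    by split; exact: nbhs_infty_ge.
  move=> [m n] /= [Nm Nn]; rewrite -ball_normE /= (le_lt_trans (NP _ _ Nm Nn))//.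
  by rewrite ltr_pdivrMr// ltr_pMr// ltr1n.
by move=> /cauchy_cvgP /cvg_ex[l ul]; exists l.
Qed.

Lemma cvg_cauchy_sequence (V : normedModType R) (u : nat -> V) (l : V) :
  u @ \oo --> l -> cauchy_sequence u.
Proof.
move=> ul e e0; have e2 : 0 < e / 2 by rewrite divr_gt0.
have /cvgrPdist_lt/(_ _ e2)[N _ NP] := ul; exists N => m n Nm Nn.
rewrite (splitr e) -(subrKA l) (le_trans (ler_normD _ _))// lerD//.
  by rewrite distrC ltW//; exact: NP.
by rewrite ltW//; exact: NP.
Qed.

End complete_sequences.

Section lp_sums.
Context {R : realType} (p : R) (p1 : 1 <= p) (E : nat -> normedModType R).
Implicit Types x y : lp_sum p1 E.

Let p0 : 0 < p. Proof. exact: lt_le_trans p1. Qed.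

Let pow_ge0 (z : forall n, E n) k : (0 <= (`|z k| `^ p)%:E)%E.
Proof. by rewrite lee_fin powR_ge0. Qed.

Lemma lp_norm_pow x : (\sum_(0 <= n <oo) (`|x n| `^ p)%:E)%E = (`|x| `^ p)%:E.
Proof.
have := lp_normE x; rewrite /lp_enorm.
have : (0 <= \sum_(0 <= n <oo) (`|x n| `^ p)%:E)%E by apply: nneseries_ge0 => n _ _.
case: (\sum_(0 <= n <oo) _)%E => [s s0|_|//].
  by rewrite poweR_EFin => -[nx]; congr EFin; rewrite -[`|x|]/(lp_norm x) nx powR_rootV.
by rewrite poweRyr// gt_eqF// invr_gt0.
Qed.

Lemma lp_psum_le x N : \sum_(n < N) `|x n| `^ p <= `|x| `^ p.
Proof.
rewrite -lee_fin -lp_norm_pow -sumEFin -(big_mkord xpredT (fun n => (`|x n| `^ p)%:E)).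
exact: nneseries_lim_ge.
Qed.

Lemma lp_coord_le x n : `|x n| <= `|x|.
Proof.
rewrite -(powR_leE p0)//; apply: le_trans (lp_psum_le x n.+1).
by rewrite big_ord_recr/= ler_wpDl// sumr_ge0// => i _; exact: powR_ge0.
Qed.

Lemma lp_cvg x : \sum_(n < N) `|x n| `^ p @[N --> \oo] --> `|x| `^ p.
Proof.
have := lp_norm_pow x => xE.
have : (\sum_(0 <= n < N) (`|x n| `^ p)%:E)%E @[N --> \oo] --> (`|x| `^ p)%:E.
  by rewrite -xE; apply: is_cvg_nneseries => n _ _.
move=> /fine_cvg; apply: cvg_trans; apply: near_eq_cvg; near=> N.
by rewrite /= sumEFin/= big_mkord.
Unshelve. all: by end_near. Qed.

Lemma nneseries_le (z : forall n, E n) (B : R) : (forall N, \sum_(n < N) `|z n| `^ p <= B) ->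
  (\sum_(0 <= n <oo) (`|z n| `^ p)%:E <= B%:E)%E.
Proof.
move=> zB; apply: lime_le; first by apply: is_cvg_nneseries => n _ _.
by apply: nearW => N; rewrite sumEFin lee_fin big_mkord.
Qed.

Lemma lp_mem (z : forall n, E n) (B : R) : (forall N, \sum_(n < N) `|z n| `^ p <= B) ->
  (lp_enorm p z < +oo)%E.
Proof.
move=> /nneseries_le; rewrite /lp_enorm.
have : (0 <= \sum_(0 <= n <oo) (`|z n| `^ p)%:E)%E by apply: nneseries_ge0 => n _ _.
by case: (\sum_(0 <= n <oo) _)%E => [s _ _|//|//]; rewrite poweR_EFin ltry.
Qed.

Lemma lp_norm_le x (B : R) : (forall N, \sum_(n < N) `|x n| `^ p <= B) -> `|x| `^ p <= B.
Proof. by move=> /nneseries_le; rewrite lp_norm_pow lee_fin. Qed.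

End lp_sums.

Lemma lp_sum_complete (R : realType) (p : R) (p1 : 1 <= p)
  (E : nat -> normedModType R) : (forall n, seq_complete (E n)) -> seq_complete (lp_sum p1 E).
Proof.
move=> Ec u uc; have p0 : 0 < p := lt_le_trans ltr01 p1.
have h n : exists l : E n, u m n @[m --> \oo] --> l.
  apply: Ec => e e0; have [N NP] := uc e e0; exists N => m k Nm Nk.
  exact: le_trans (lp_coord_le (u m - u k) n) (NP _ _ Nm Nk).
have [l lP] : exists l : forall n, E n, forall n, u m n @[m --> \oo] --> l n.
  by exists (fun n => projT1 (cid (h n))) => n; exact: (projT2 (cid (h n))).
have tail e : 0 < e -> exists M, forall m, (M <= m)%N -> forall N,
    \sum_(n < N) `|l n - u m n| `^ p <= e `^ p.
  move=> e0; have [M MP] := uc e e0; exists M => m Mm N.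
  have cv : \sum_(n < N) `|u k n - u m n| `^ p @[k --> \oo] -->
      \sum_(n < N) `|l n - u m n| `^ p.
    apply: cvg_big => [|n _]; first exact: add_continuous.
    apply: cvg_powR => //; apply: cvg_norm; apply: cvgB (lP n) _; exact: cvg_cst.
  apply: cvgr_to_le cv _; exists M => // k /= Mk; apply: le_trans (lp_psum_le (u k - u m) N) _.
  by apply: powR_le; [exact: ltW|exact: normr_ge0|exact: MP].
have [M1 M1P] := tail 1 ltr01.
pose z : lp_sum p1 E :=
  @LpSum _ _ p1 _ (fun n => l n - u M1 n) (lp_mem (M1P _ (leqnn M1))).
exists (z + u M1); apply/cvgrPdist_le => e e0; have [M MP] := tail e e0.
exists M => // m /= Mm; rewrite -(powR_leE p0 (normr_ge0 _) (ltW e0)); apply: lp_norm_le => N.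
apply: le_trans (MP m Mm N); apply: ler_sum => n _.
by rewrite -[X in `|X|]/(l n - u M1 n + u M1 n - u m n) subrK.
Qed.

Section range.
Context {R : realType} (V W : normedModType R) (T : {linear V -> W}) (m M : R).
Hypotheses (m0 : 0 < m) (Tm : forall x, m * `|x| <= `|T x|)
  (TM : forall x, `|T x| <= M * `|x|) (Vc : seq_complete V).

Let P : {pred W} := fun w => `[< exists v, T v = w >].

Let P_closed : submod_closed P.
Proof.
split; first by apply/asboolP; exists 0; rewrite linear0.
move=> a w1 w2 /asboolP[v1 <-] /asboolP[v2 <-]; apply/asboolP.
by exists (a *: v1 + v2); rewrite linearP.
Qed.

Lemma range_isomorphism : exists (Z : submodClosed W)
    (T' : {linear V -> subnormed Z}) (S' : {linear subnormed Z -> V}),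
  [/\ closed [set x | x \in Z], isomorphism T' S' & forall x, \val (T' x) = T x].
Proof.
pose Z : submodClosed W := HB.pack P (GRing.isSubmodClosed.Build _ _ _ P_closed).
have TZ v : T v \in Z by apply/asboolP; exists v.
pose T0 v : subnormed Z := exist _ (T v) (TZ v).
have T0l : linear T0 by move=> a x y; apply: val_inj; rewrite /= linearP.
pose T' : {linear V -> subnormed Z} := HB.pack T0 (GRing.isLinear.Build _ _ _ _ _ T0l).
have h (z : subnormed Z) : exists v, T v = \val z by have := valP z => /asboolP.
have [S0 S0P] := choice h.
have Tinj : injective T.
  move=> x y xy; apply/eqP; rewrite -subr_eq0 -normr_le0 -(pmulr_rle0 _ m0).
  by rewrite (le_trans (Tm _))// linearB xy subrr normr0.
have S0l : linear S0.
  by move=> a x y; apply: Tinj; rewrite linearP !S0P.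
pose S' : {linear subnormed Z -> V} := HB.pack S0 (GRing.isLinear.Build _ _ _ _ _ S0l).
exists Z, T', S'; split => //; last split.
- move=> w clw; have [u uP] : exists u : nat -> V, forall n, `|w - T (u n)| < n.+1%:R^-1.
    have hw n : exists v, `|w - T v| < n.+1%:R^-1.
      have e0 : 0 < n.+1%:R^-1 :> R by rewrite invr_gt0.
      have [_ [/asboolP[v <-] wv]] := clw _ (nbhsx_ballx w _ e0).
      by exists v; rewrite -ball_normE in wv.
    by have [u uP] := choice hw; exists u.
  have Tu : T (u n) @[n --> \oo] --> w.
    apply/cvgrPdist_lt => e e0; near=> n; rewrite (lt_trans (uP n))//.
    near: n; exact: near_infty_natSinv_lt (PosNum e0).
  have uc : cauchy_sequence u.
    move=> e e0; have [N NP] := cvg_cauchy_sequence Tu (mulr_gt0 m0 e0).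
    exists N => i j Ni Nj; rewrite -(ler_pM2l m0) (le_trans (Tm _))// linearB.
    exact: NP.
  have [v uv] := Vc uc; apply/asboolP; exists v.
  have Tuv : T (u n) @[n --> \oo] --> T v.
    apply: continuous_cvg => //; apply: bounded_linear_continuous.
    apply/bounded_funP => r; exists (`|M| * r) => x xr; rewrite (le_trans (TM x))//.
    by rewrite (le_trans (ler_wpM2r (normr_ge0 _) (ler_norm M)))// ler_wpM2l.
  exact: cvg_unique Tuv Tu.
- apply: bounded_linear_continuous; apply/bounded_funP => r; exists (`|M| * r) => x xr.
  rewrite -[leLHS]/(`|T x|) (le_trans (TM x))//.
  rewrite (le_trans (ler_wpM2r (normr_ge0 _) (ler_norm M)))// ler_wpM2l//.
- apply: bounded_linear_continuous; apply/bounded_funP => r; exists (m^-1 * r) => x xr.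
  rewrite ler_pdivlMl// (le_trans (Tm _))//=.
  by rewrite S0P.
- by move=> x; apply: Tinj; rewrite /= S0P.
- by move=> z; apply: val_inj => /=; rewrite S0P.
Unshelve. all: by end_near. Qed.

End range.

Section no_l1.
Context {R : realType} (X : completeNormedModType R).

Lemma l1_contained (y : nat -> X) (C d : R) : (forall n, `|y n| <= C) -> 0 < d ->
  (forall n (c : nat -> R), d * \sum_(i < n) `|c i| <= `|\sum_(i < n) c i *: y i|) ->
  contains_l1 X.
Proof.
move=> yC d0 dy; have C0 : 0 <= C by apply: le_trans (yC 0%N).
have l1_cvg (c : l1 (R := R)) : \sum_(i < n) `|c i| @[n --> \oo] --> `|c|.
  have := @lp_cvg R 1 (lexx 1) (fun=> R^o) c; rewrite powRr1//; apply: cvg_trans; apply: near_eq_cvg; near=> n.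
  by apply: eq_bigr => i _; rewrite powRr1.
have l1_le (c : l1 (R := R)) n : \sum_(i < n) `|c i| <= `|c|.
  have := @lp_psum_le R 1 (lexx 1) (fun=> R^o) c n; rewrite powRr1//; apply: le_trans.
  by rewrite le_eqVlt; apply/orP; left; apply/eqP/eq_bigr => i _; rewrite powRr1.
have cyC (c : l1 (R := R)) n : \sum_(i < n) `|c i *: y i| <= C * `|c|.
  apply: le_trans (_ : C * \sum_(i < n) `|c i| <= _); last exact: ler_wpM2l.
  by rewrite mulr_sumr; apply: ler_sum => i _; rewrite normrZ mulrC ler_wpM2r.
have h (c : l1 (R := R)) : exists v : X, \sum_(i < n) c i *: y i @[n --> \oo] --> v.
  have : cvgn (series (fun i => c i *: y i)).
    apply: normed_cvg; have -> : [normed series (fun i => c i *: y i)] =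
        (fun n => \sum_(i < n) `|c i *: y i|).
      by apply/funext => n; exact: (big_mkord xpredT (fun i => `|c i *: y i|)).
    apply: nondecreasing_is_cvgn.
      by apply/nondecreasing_seqP => n; rewrite big_ord_recr/= lerDl.
    by exists (C * `|c|) => _ [n _ <-].
  by move=> /cvg_ex[v vP]; exists v; rewrite seriesEord in vP.
have [T0 T0P] := choice h.
have T0l : linear T0.
  move=> a c1 c2; apply: cvg_unique (T0P _) _ => //.
  have -> : (fun n => \sum_(i < n) (a *: c1 + c2 : l1) i *: y i) =
      (fun n => a *: (\sum_(i < n) c1 i *: y i) + \sum_(i < n) c2 i *: y i).
    apply/funext => n; rewrite scaler_sumr -big_split/=; apply: eq_bigr => i _.
    by rewrite scalerDl scalerA.
  by apply: cvgD => //; apply: cvgZl_tmp.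
pose T : {linear l1 -> X} := HB.pack T0 (GRing.isLinear.Build _ _ _ _ _ T0l).
have Td c : d * `|c| <= `|T c|.
  have dn : d * \sum_(i < n) `|c i| @[n --> \oo] --> d * `|c| by apply: cvgMl_tmp.
  have cn : `|\sum_(i < n) c i *: y i| @[n --> \oo] --> `|T c| by apply: cvg_norm; exact: T0P.
  by apply: ler_cvg_to dn cn _; apply: nearW => n; exact: dy.
have TC c : `|T c| <= C * `|c|.
  have cn : `|\sum_(i < n) c i *: y i| @[n --> \oo] --> `|T c| by apply: cvg_norm; exact: T0P.
  apply: cvgr_to_le cn _; apply: nearW => n.
  by rewrite (le_trans (ler_norm_sum _ _ _))//; exact: cyC.
have l1c : seq_complete (l1 (R := R)).
  by apply: lp_sum_complete => n; exact: (complete_seq_complete (V := R^o)).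
have [Z [T' [S' [Zc TS _]]]] := range_isomorphism d0 Td TC l1c.
by exists Z; split => //; exists T', S'.
Unshelve. all: by end_near. Qed.

Lemma weakly_cauchy_subsequence (x : nat -> X) (C : R) : ~ contains_l1 X ->
  (forall n, `|x n| <= C) ->
  exists h : nat -> nat, (forall n, (h n < h n.+1)%N) /\ weakly_cauchy (x \o h).
Proof.
move=> nl1 xC; have [//|[r [s [M [rs Mu /(rosenthal_l1 Mu)[h hP]]]]]] :=
  weakly_cauchy_or_oscillating xC.
exfalso; apply: nl1; apply: (@l1_contained (x \o h) C ((s - r) / 2)) => [n||n c].
- exact: xC.
- by rewrite divr_gt0// subr_gt0.
- by have := hP n c; set A := \sum_(i < n) _; set B := `|_|; rewrite mulrAC; lra.
Qed.

End no_l1.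

(** * Weak convergence of weakly Cauchy sequences *)

Section james_argument.
Context {R : realType} {X : completeNormedModType R} (p : R) (p1 : 1 < p).
Context (U : set_system nat) (UF : UltraFilter U) (Uoo : \oo `<=` U).
Hypothesis Xm : mprop X p.
Variables (x : nat -> X) (C : R) (l : (X -> R) -> R).
Hypotheses (xC : forall n, `|x n| <= C)
  (xl : forall f, dball 1 f -> f (x n) @[n --> \oo] --> l f).

Let p0 : 0 < p. Proof. exact: lt_trans p1. Qed.
Let C0 : 0 <= C. Proof. exact: le_trans (xC 0%N). Qed.

(* The iterated limit of |w + s_0 x_(m_0) + ... + s_k x_(m_k)| as m_k, then
   m_(k-1), ..., then m_0 tend to U. *)
Fixpoint Lam (s : seq R) (w : X) : R :=
  if s is a :: t then lim ((fun m => Lam t (w + a *: x m)) @ U) else `|w|.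

Fixpoint comb (s : seq R) (ms : seq nat) : X :=
  if (s, ms) is (a :: t, m :: ms') then a *: x m + comb t ms' else 0.

Let xaC a m : `|a *: x m| <= `|a| * C.
Proof. by rewrite normrZ ler_wpM2l. Qed.

Let Lam_main s : (forall w, 0 <= Lam s w <= `|w| + C * \sum_(a <- s) `|a|) /\
  (forall w v, `|Lam s w - Lam s v| <= `|w - v|).
Proof.
elim: s => [|a s [IH1 IH2]].
  split=> [w|w v] /=; first by rewrite big_nil mulr0 addr0 normr_ge0 lexx.
  exact: ler_dist_dist.
have bnd w m : `|Lam s (w + a *: x m)| <= `|w| + C * \sum_(b <- a :: s) `|b|.
  have /andP[h1 h2] := IH1 (w + a *: x m); rewrite ger0_norm// (le_trans h2)//.
  by rewrite big_cons; have := ler_normD w (a *: x m); have := xaC a m; lra.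
have cv w : Lam s (w + a *: x m) @[m --> U] --> Lam (a :: s) w.
  have [L hL] := ulim_ex UF (bnd w).
  by rewrite /= (_ : lim _ = L)//; apply: cvg_lim.
split=> [w|w v].
  apply/andP; split.
    apply: cvgr_to_ge (cv w) _; apply: nearW => m.
    by have /andP[] := IH1 (w + a *: x m).
  apply: cvgr_to_le (cv w) _; apply: nearW => m.
  exact: le_trans (ler_norm _) (bnd w m).
have cn : `|Lam s (w + a *: x m) - Lam s (v + a *: x m)| @[m --> U] -->
    `|Lam (a :: s) w - Lam (a :: s) v| by apply: cvg_norm; apply: cvgB.
apply: cvgr_to_le cn _; apply: nearW => m; apply: le_trans (IH2 _ _) _.
by rewrite opprD addrACA subrr addr0.
Qed.

Lemma Lam_ge0 s w : 0 <= Lam s w.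
Proof. by have [/(_ w)/andP[]] := Lam_main s. Qed.

Lemma Lam_lip s w v : `|Lam s w - Lam s v| <= `|w - v|.
Proof. exact: (Lam_main s).2. Qed.

Lemma Lam_cvg a s w : Lam s (w + a *: x m) @[m --> U] --> Lam (a :: s) w.
Proof.
have [L hL] : exists L : R, Lam s (w + a *: x m) @[m --> U] --> L.
  apply: (@ulim_ex _ _ _ _ (`|w| + `|a| * C + C * \sum_(b <- s) `|b|)) => // m.
  have /andP[h1 h2] := (Lam_main s).1 (w + a *: x m).
  rewrite ger0_norm// (le_trans h2)// lerD2r (le_trans (ler_normD _ _))//.
  by rewrite lerD2l.
by rewrite /= (_ : lim _ = L)//; apply: cvg_lim.
Qed.

Lemma Lam_cat_le t (B : R) : (forall w, `|Lam t w - `|w| | <= B) ->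
  forall s w, `|Lam (s ++ t) w - Lam s w| <= B.
Proof.
move=> tB; elim=> [|a s IHs] w; first exact: tB.
have cn : `|Lam (s ++ t) (w + a *: x m) - Lam s (w + a *: x m)| @[m --> U] -->
    `|Lam ((a :: s) ++ t) w - Lam (a :: s) w|.
  by apply: cvg_norm; apply: cvgB; exact: Lam_cvg.
by apply: cvgr_to_le cn _; apply: nearW => m.
Qed.

Lemma Lam_nseq_cat a k s w : `|Lam (nseq k a ++ s) w - Lam s w| <= k%:R * (`|a| * C).
Proof.
elim: k w => [|k IHk] w; first by rewrite mul0r subrr normr0.
have cn : `|Lam (nseq k a ++ s) (w + a *: x m) - Lam s w| @[m --> U] -->
    `|Lam (nseq k.+1 a ++ s) w - Lam s w|.
  by apply: cvg_norm; apply: cvgB; [exact: Lam_cvg|exact: cvg_cst].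
apply: cvgr_to_le cn _; apply: nearW => m.
rewrite -(subrKA (Lam s (w + a *: x m))) (le_trans (ler_normD _ _))//.
rewrite -natr1 mulrDl mul1r lerD// (le_trans (Lam_lip _ _ _))//.
by rewrite addrC addKr.
Qed.

Lemma Lam_opp s w : Lam (map -%R s) (- w) = Lam s w.
Proof.
elim: s w => [|a s IHs] w; first by rewrite /= normrN.
rewrite /=; congr (lim (_ @ U)); apply/funext => m.
by rewrite scaleNr -opprD IHs.
Qed.

Lemma Lam_witness s t w c : Lam (s ++ t) w < c ->
  exists2 ms, size ms = size s & Lam t (w + comb s ms) < c.
Proof.
elim: s w => [|a s IHs] w wc; first by exists [::]; rewrite //= addr0.
have nwc : \forall m \near U, Lam (s ++ t) (w + a *: x m) < c.
  exact: cvgr_lt (@Lam_cvg a (s ++ t) w) _ wc.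
have [m /IHs[ms szms h]] := filter_ex nwc.
by exists (m :: ms); rewrite /= ?szms// addrA.
Qed.

Lemma Lam_dual f s w : dball 1 f -> `|f w + (\sum_(a <- s) a) * l f| <= Lam s w.
Proof.
move=> df; elim: s w => [|a s IHs] w.
  by rewrite big_nil mul0r addr0 (le_trans (df.2 w))// mul1r.
have fx := cvg_oo_U Uoo (xl df).
have cn : `|f w + (\sum_(b <- s) b) * l f + a * f (x m)| @[m --> U] -->
    `|f w + (\sum_(b <- s) b) * l f + a * l f|.
  by apply: cvg_norm; apply: cvgD; [exact: cvg_cst|exact: cvgMl_tmp].
have -> : f w + (\sum_(b <- a :: s) b) * l f = f w + (\sum_(b <- s) b) * l f + a * l f.
  by rewrite big_cons; lra.
apply: ler_cvg_to cn (@Lam_cvg a s w) _; apply: nearW => m.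
apply: le_trans (IHs (w + a *: x m)).
by rewrite (lfunD _ _ df.1) (lfunZ _ _ df.1) addrAC.
Qed.

Let comb_bnd s ms : `|comb s ms| <= C * \sum_(a <- s) `|a|.
Proof.
elim: s ms => [|a s IHs] [|m ms] /=; rewrite ?normr0 ?big_nil ?mulr0//.
  by rewrite mulr_ge0// sumr_ge0.
rewrite (le_trans (ler_normD _ _))// big_cons mulrDr lerD// mulrC; exact: xaC.
Qed.

Let comb_fun f s ms (e : R) N : dball 1 f -> 0 <= e -> (forall n, (N <= n)%N -> `|f (x n) - l f| <= e) ->
  size ms = size s -> all (leq N) ms ->
  `|f (comb s ms) - (\sum_(a <- s) a) * l f| <= e * \sum_(a <- s) `|a|.
Proof.
move=> df e0 fe; elim: s ms => [|a s IHs] [|m ms] //=.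
  by rewrite !big_nil (lfun0 df.1) mul0r mulr0 subrr normr0.
move=> [szms] /andP[Nm Nms]; rewrite !big_cons (lfunD _ _ df.1) (lfunZ _ _ df.1).
have -> : a * f (x m) + f (comb s ms) - (a + \sum_(b <- s) b) * l f =
  a * (f (x m) - l f) + (f (comb s ms) - (\sum_(b <- s) b) * l f) by lra.
rewrite (le_trans (ler_normD _ _))// [e * _]mulrDr lerD//; last exact: IHs.
by rewrite normrM mulrC ler_wpM2r// fe.
Qed.

Let far s w (e : R) : \sum_(a <- s) a = 0 -> 0 < e ->
  exists N, forall ms, size ms = size s -> all (leq N) ms ->
    `| `|w + comb s ms| `^ p - `|comb s ms| `^ p - `|w| `^ p| <= e.
Proof.
move=> s0 e0; apply: contrapT => /forallNP h.
have {}h N : exists ms, [/\ size ms = size s, all (leq N) ms &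
    e < `| `|w + comb s ms| `^ p - `|comb s ms| `^ p - `|w| `^ p|].
  have /existsNP[ms /not_implyP[szms /not_implyP[Nms /negP]]] := h N.
  by rewrite -ltNge; exists ms.
have [g gP] := choice h; pose u n := comb s (g n).
have : `|w + u n| `^ p - `|u n| `^ p @[n --> \oo] --> `|w| `^ p.
  apply: (Xm (C := C * \sum_(a <- s) `|a|)) => [n|f df]; first exact: comb_bnd.
  apply/cvgrPdist_le => d d0; pose K := 1 + \sum_(a <- s) `|a|.
  have K0 : 0 < K by rewrite ltr_pwDl// sumr_ge0.
  have dK : 0 < d / K by rewrite divr_gt0.
  have /cvgrPdist_le/(_ _ dK)[N _ NP] := xl df.
  exists N => // n /= Nn; have [szg allg _] := gP n.
  rewrite sub0r normrN -[f _]subr0 -[X in _ - X](mul0r (l f)) -s0.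
  apply: le_trans (comb_fun df (ltW dK) _ szg allg) _.
    by move=> k nk; rewrite distrC; apply: NP; exact: leq_trans nk.
  by rewrite mulrAC ler_pdivrMr// ler_wpM2l ?(ltW d0)// /K lerDr.
move=> /cvgrPdist_le/(_ _ e0)[N _ /(_ N (leqnn N))] /=; have [_ _] := gP N.
by rewrite distrC ltNge => /negP.
Qed.

Let Lam_far s w v (e : R) N : (forall ms, size ms = size s -> all (leq N) ms ->
    `| `|w + (v + comb s ms)| `^ p - `|v + comb s ms| `^ p - `|w| `^ p| <= e) ->
  `|Lam s (w + v) `^ p - Lam s v `^ p - `|w| `^ p| <= e.
Proof.
elim: s v => [|a s IHs] v h.
  by have := h [::] erefl erefl; rewrite /= addr0.
have cn : `|Lam s (w + v + a *: x m) `^ p - Lam s (v + a *: x m) `^ p - `|w| `^ p| @[m --> U] -->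
    `|Lam (a :: s) (w + v) `^ p - Lam (a :: s) v `^ p - `|w| `^ p|.
  apply: cvg_norm; apply: cvgB; last exact: cvg_cst.
  by apply: cvgB; apply: cvg_powR => //; try exact: Lam_cvg; move=> m; exact: Lam_ge0.
apply: cvgr_to_le cn _; have := ularge Uoo N; apply: filterS => m Nm.
rewrite -[w + v + _]addrA; apply: IHs => ms szms Nms.
by have := h (m :: ms); rewrite /= szms Nm Nms [v + (_ + _)]addrA; exact.
Qed.

Lemma Lam_zero_sum s w : \sum_(a <- s) a = 0 -> Lam s w `^ p = Lam s 0 `^ p + `|w| `^ p.
Proof.
move=> s0; apply/eqP; rewrite -subr_eq0 opprD addrA -normr_le0.
apply/ler_addgt0Pl => e e0; rewrite addr0; have [N NP] := far w s0 e0.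
have := @Lam_far s w 0 e N; rewrite addr0; apply => ms szms Nms.
by rewrite add0r; exact: NP.
Qed.

Lemma Lam_cat t (B : R) : (forall w, Lam t w `^ p = B + `|w| `^ p) ->
  forall s w, Lam (s ++ t) w `^ p = B + Lam s w `^ p.
Proof.
move=> tB; elim=> [|a s IHs] w; first exact: tB.
have h1 : Lam (s ++ t) (w + a *: x m) `^ p @[m --> U] --> Lam ((a :: s) ++ t) w `^ p.
  by apply: cvg_powR => //; [move=> m; exact: Lam_ge0|exact: Lam_cvg].
have h2 : B + Lam s (w + a *: x m) `^ p @[m --> U] --> B + Lam (a :: s) w `^ p.
  apply: cvgD; first exact: cvg_cst.
  by apply: cvg_powR => //; [move=> m; exact: Lam_ge0|exact: Lam_cvg].
have fE : (fun m => Lam (s ++ t) (w + a *: x m) `^ p) =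
  (fun m => B + Lam s (w + a *: x m) `^ p) by apply/funext => m; exact: IHs.
by rewrite fE in h1; exact: cvg_unique h1 h2.
Qed.

Definition up k : seq R := nseq k 1 ++ nseq k (-1).
Definition down k : seq R := nseq k (-1) ++ nseq k 1.
Definition lam k := Lam (up k) 0.

Let sum_up k : \sum_(a <- up k) a = 0.
Proof. by rewrite big_cat/= !big_nseq !iter_addr_0 -mulrnDl subrr mul0rn. Qed.

Let Lam_up k w : Lam (up k) w `^ p = lam k `^ p + `|w| `^ p.
Proof. exact: Lam_zero_sum. Qed.

Let Lam_down k w : Lam (down k) w `^ p = lam k `^ p + `|w| `^ p.
Proof.
rewrite -Lam_opp /down map_cat !map_nseq opprK.
by rewrite -/(up k) Lam_up normrN.
Qed.

Let Lam_flatten t (B : R) : (forall w, Lam t w `^ p = B + `|w| `^ p) ->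
  forall n w, Lam (flatten (nseq n t)) w `^ p = n%:R * B + `|w| `^ p.
Proof.
move=> tB; elim=> [|n IHn] w; first by rewrite mul0r add0r.
by rewrite /= (Lam_cat IHn) tB -natr1; lra.
Qed.

(* Shifting by [k] regroups [n + 1] blocks of length [4k] into [2n + 1] blocks
   of length [2k]. *)
Let shift n k : flatten (nseq n.+1 (up k.*2)) =
  nseq k 1 ++ (up k ++ flatten (nseq n (down k ++ up k))) ++ nseq k (-1).
Proof.
have upE : up k.*2 = nseq k 1 ++ up k ++ nseq k (-1).
  by rewrite /up -addnn !nseqD -!catA.
elim: n => [|n IHn]; first by rewrite /= !cats0.
have -> : flatten (nseq n.+2 (up k.*2)) = up k.*2 ++ flatten (nseq n.+1 (up k.*2)) by [].
by rewrite IHn upE /= /up /down -!catA.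
Qed.

Lemma lam_double k : lam k.*2 <= 2 `^ p^-1 * lam k.
Proof.
have ip0 : 0 < p^-1 by rewrite invr_gt0.
apply/ler_addgt0Pl => e e0; pose D : R := k%:R * C + k%:R * C.
have D0 : 0 <= D by rewrite addr_ge0// mulr_ge0.
pose n := Num.truncn ((D / e) `^ p); pose N : R := n.+1%:R.
have DN : (D / e) `^ p <= N by exact/ltW/truncnS_gt.
have N0 : 0 < N by rewrite /N ltr0n.
have V1 : Lam (flatten (nseq n.+1 (up k.*2))) 0 `^ p = N * lam k.*2 `^ p.
  by rewrite (Lam_flatten (Lam_up _)) normr0 powR0 ?addr0// gt_eqF.
pose V := up k ++ flatten (nseq n (down k ++ up k)).
have V2 : Lam V 0 `^ p <= 2 * N * lam k `^ p.
  have B w : Lam (down k ++ up k) w `^ p = 2 * lam k `^ p + `|w| `^ p.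
    by rewrite (Lam_cat (Lam_up k)) Lam_down; lra.
  rewrite /V (Lam_cat (Lam_flatten B n)) Lam_up normr0 powR0 ?gt_eqF// addr0.
  by rewrite /N -natr1; have := powR_ge0 (lam k) p; lra.
have V12 : Lam (flatten (nseq n.+1 (up k.*2))) 0 <= Lam V 0 + D.
  rewrite shift -/V.
  have h1 := Lam_nseq_cat 1 k (V ++ nseq k (-1)) 0.
  have h2 : `|Lam (V ++ nseq k (-1)) 0 - Lam V 0| <= k%:R * C.
    apply: Lam_cat_le => w; have := Lam_nseq_cat (-1) k [::] w.
    by rewrite cats0 normrN1 mul1r.
  by move: h1 h2; rewrite normr1 mul1r !ler_norml /D => /andP[_ ?] /andP[_ ?]; lra.
have {V1} : Lam (flatten (nseq n.+1 (up k.*2))) 0 = N `^ p^-1 * lam k.*2.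
  rewrite -(powR_root p0 (Lam_ge0 _ _)) V1 powRM ?powR_ge0 ?(ltW N0)//.
  by rewrite powR_root// Lam_ge0.
have {V2} : Lam V 0 <= N `^ p^-1 * (2 `^ p^-1 * lam k).
  rewrite -(powR_root p0 (Lam_ge0 V 0)); apply: le_trans (powR_le (ltW ip0) (powR_ge0 _ _) V2) _.
  rewrite powRM ?powR_ge0//; last by rewrite mulr_ge0// ltW.
  by rewrite powR_root ?Lam_ge0// powRM ?(ltW N0)// mulrA [X in X * _ <= _]mulrC.
have {DN} : D <= N `^ p^-1 * e.
  rewrite -ler_pdivrMr// -(powR_root p0 (_ : 0 <= D / e)); last by rewrite divr_ge0// ltW.
  by apply: powR_le => //; [exact: ltW|exact: powR_ge0].
have NN : 0 < N `^ p^-1 by rewrite powR_gt0.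
move=> h1 h2 h3; rewrite -(ler_pM2l NN) -h3 (le_trans V12)// mulrDr addrC lerD//.
Qed.

Lemma lam_average (e : R) : 0 < e -> exists k, (0 < k)%N /\ lam k < k%:R * e.
Proof.
move=> e0; pose q : R := 2 `^ p^-1 / 2.
have q0 : 0 <= q by rewrite divr_ge0// powR_ge0.
have q1 : q < 1.
  rewrite ltr_pdivrMr// mul1r lt_neqAle ler1_powR ?ler1n ?invf_le1 ?(ltW p1)// andbT.
  apply/eqP => /(congr1 (@ln R)); rewrite ln_powR => h.
  have ln2 : 0 < ln (2 : R) by rewrite ln_gt0// ltr1n.
  have : p^-1 < 1 by rewrite invf_lt1.
  by rewrite -(ltr_pM2r ln2) h mul1r ltxx.
have lamq j : lam (2 ^ j)%N <= (2 ^ j)%:R * (q ^+ j * lam 1).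
  elim: j => [|j IHj]; first by rewrite expn0 expr0 !mul1r.
  rewrite expnS mul2n (le_trans (lam_double _))//.
  rewrite (le_trans (ler_wpM2l (powR_ge0 _ _) IHj))// -mul2n natrM exprS.
  rewrite le_eqVlt; apply/orP; left; apply/eqP.
  by rewrite /q; field.
have : q ^+ j * lam 1 @[j --> \oo] --> 0 * lam 1.
  by apply: cvgMr_tmp; apply: cvg_expr; rewrite ger0_norm.
rewrite mul0r => /cvgr_lt/(_ _ e0)[j _ jP]; exists (2 ^ j)%N; rewrite expn_gt0; split => //.
by rewrite (le_lt_trans (lamq j))// ltr_pM2l ?ltr0n ?expn_gt0//; exact: (jP j (leqnn j)).
Qed.

Lemma weakly_cauchy_cvg : exists z, forall f, dball 1 f -> f (x n) @[n --> \oo] --> f z.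
Proof.
have h (n : nat) : exists z, forall f, dball 1 f -> `|f z - l f| <= n.+1%:R^-1.
  have n0 : 0 < n.+1%:R^-1 :> R by rewrite invr_gt0 ltr0n.
  have [k [k0 /Lam_witness[ms szms kP]]] := lam_average n0.
  have kR : 0 < k%:R :> R by rewrite ltr0n.
  exists (k%:R^-1 *: (0 + comb (nseq k 1) ms)) => f df.
  have := le_lt_trans (Lam_dual (nseq k (-1)) _ df) kP.
  rewrite big_nseq iter_addr_0 mulNrn => /ltW h; rewrite (lfunZ _ _ df.1).
  rewrite -(ler_pM2l kR) (le_trans _ h)//.
  rewrite -[X in X * _ <= _]gtr0_norm// -normrM mulrBr mulrA mulfV ?gt_eqF// mul1r.
  by rewrite mulNr.
have [z zP] := choice h.
have hn (e : R) : 0 < e -> exists N, forall n, (N <= n)%N -> n.+1%:R^-1 < e.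
  by move=> e0; have [N _ NP] := near_infty_natSinv_lt (PosNum e0); exists N.
have zc : cauchy_sequence z.
  move=> e e0; have e2 : 0 < e / 2 by rewrite divr_gt0.
  have [N NP] := hn _ e2; exists N => m n Nm Nn.
  have [f [df <-]] := norming (z m - z n); rewrite (lfunB _ _ df.1).
  have := zP m f df; have := zP n f df; have := NP m Nm; have := NP n Nn.
  move: (n.+1%:R^-1) (m.+1%:R^-1) => a b.
  by move=> ? ?; rewrite !ler_norml => /andP[? ?] /andP[? ?]; lra.
have [w zw] := complete_seq_complete zc.
exists w => f df; suff -> : f w = l f by exact: xl.
apply/eqP; rewrite -subr_eq0 -normr_le0; apply/ler_addgt0Pl => e e0; rewrite addr0.
have e2 : 0 < e / 2 by rewrite divr_gt0.
have [N NP] := hn _ e2; have /cvgrPdist_le/(_ _ e2)[M _ MP] := zw.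
have := MP (maxn M N) (leq_maxl _ _); have /ltW := NP (maxn M N) (leq_maxr _ _).
move=> h1 h2; have := zP (maxn M N) f df; have := dball_leB w (z (maxn M N)) df.
rewrite mul1r => h3 h4; rewrite -(subrKA (f (z (maxn M N)))).
by rewrite (le_trans (ler_normD _ _))// [e]splitr lerD// ?(le_trans h3)// (le_trans h4).
Qed.

End james_argument.

(** * Separability of the dual *)

Lemma near_all_lt T (F : set_system T) (P : nat -> T -> Prop) k : Filter F ->
  (forall i, (i < k)%N -> \forall t \near F, P i t) ->
  \forall t \near F, forall i, (i < k)%N -> P i t.
Proof.
move=> FF; elim: k => [|k IHk] h; first exact: nearW.
have := IHk (fun i ik => h i (ltnW ik)); have := h k (leqnn _).
apply: filterS2 => t Pk Pt i; rewrite ltnS leq_eqVlt => /predU1P[->//|]; exact: Pt.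
Qed.

Lemma lfun_kernel (R : realType) (X : normedModType R) (h : nat -> X -> R) N (f : X -> R) :
  (forall i, lfun (h i)) -> lfun f ->
  (forall x, (forall i, (i < N)%N -> h i x = 0) -> f x = 0) ->
  exists c : nat -> R, forall x, f x = \sum_(i < N) c i * h i x.
Proof.
move=> hl; elim: N f => [|N IHN] f fl fh.
  by exists (fun=> 0) => x; rewrite big_ord0; exact: fh.
have [[v [vN hv]]|nv] := pselect (exists v, (forall i, (i < N)%N -> h i v = 0) /\ h N v != 0).
  pose a := f v / h N v; pose g x := f x - a * h N x.
  have gl : lfun g by move=> b x y; rewrite /g fl hl; lra.
  have [c cP] : exists c : nat -> R, forall x, g x = \sum_(i < N) c i * h i x.
    apply: IHN => // x hx; have := fh (x - (h N x / h N v) *: v).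
    rewrite (lfunB _ _ fl) (lfunZ _ _ fl) => /(_ _)/eqP H.
    apply/eqP; rewrite /g /a (_ : f v / _ * _ = h N x / h N v * f v); last by lra.
    apply: H => i; rewrite ltnS (lfunB _ _ (hl i)) (lfunZ _ _ (hl i)) leq_eqVlt.
    case/predU1P => [->|iN]; first by rewrite divfK// subrr.
    by rewrite (hx i iN) (vN i iN) mulr0 subrr.
  exists (fun i => if i == N then a else c i) => x; rewrite big_ord_recr/= eqxx.
  rewrite -[LHS](subrK (a * h N x)) -/(g x) cP; congr (_ + _).
  by apply: eq_bigr => i _; rewrite ltn_eqF.
have [c cP] : exists c : nat -> R, forall x, f x = \sum_(i < N) c i * h i x.
  apply: IHN => // x hx; apply: fh => i; rewrite ltnS leq_eqVlt => /predU1P[->|]; last exact: hx.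
  by apply/eqP; apply: contrapT => /negP hN; apply: nv; exists x.
exists (fun i => if i == N then 0 else c i) => x; rewrite big_ord_recr/= eqxx mul0r addr0 cP.
by apply: eq_bigr => i _; rewrite ltn_eqF.
Qed.

Definition dense_sequence (R : realType) (X : normedModType R) (e : nat -> X) :=
  forall (x : X) (d : R), 0 < d -> exists n, `|x - e n| < d.

Lemma separable_sequence (R : realType) (X : normedModType R) :
  separable_space X -> exists e : nat -> X, dense_sequence e.
Proof.
move=> [D Dc Dd].
have near_D (x : X) (d : R) : 0 < d -> exists2 y, D y & `|x - y| < d.
  move=> d0; have [y [xy Dy]] := Dd (ball x d) (ex_intro _ x (ballxx x d0)) (ball_open x d).
  by exists y => //; rewrite -ball_normE in xy.
have /countable_injP[g ginj] := Dc.
have h n : exists y, forall z, D z -> g z = n -> z = y.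
  have [[y Dy gy]|ny] := pselect (exists2 y, D y & g y = n).
    by exists y => z Dz gz; apply: ginj; rewrite ?inE// gz gy.
  by exists 0 => z Dz gz; case: ny; exists z.
have [e eP] := choice h; exists e => x d /(near_D x)[y Dy xy].
by exists (g y); rewrite -(eP (g y) y Dy erefl).
Qed.

Section reflexivity.
Context {R : realType} {X : completeNormedModType R} (p : R) (p1 : 1 < p).
Hypotheses (Xm : mprop X p) (nl1 : ~ contains_l1 X).

Let p0 : 0 < p. Proof. exact: lt_trans p1. Qed.

Lemma weakly_cvg_subsequence (x : nat -> X) (C : R) : (forall n, `|x n| <= C) ->
  exists (h : nat -> nat) (z : X), (forall n, (n <= h n)%N) /\
    forall f, dball 1 f -> f (x (h n)) @[n --> \oo] --> f z.
Proof.
move=> xC; have [h [hS wc]] := weakly_cauchy_subsequence nl1 xC.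
have nh n : (n <= h n)%N by elim: n => // n IHn; rewrite (leq_ltn_trans IHn).
have lim_ex f : exists l : R, dball 1 f -> f (x (h n)) @[n --> \oo] --> l.
  by have [df|nf] := pselect (dball 1 f); [have [l] := wc f df; exists l|exists 0].
have [l lP] := choice lim_ex.
have [U [UF Uoo]] := ultraFilterLemma (eventually_filter : ProperFilter \oo).
have [z zP] := weakly_cauchy_cvg p1 UF Uoo Xm (fun n => xC (h n)) lP.
by exists h, z.
Qed.

Variables (e : nat -> X).
Hypothesis e_dense : dense_sequence e.

Let total_sequence : exists h : nat -> X -> R, (forall i, dball 1 (h i)) /\
  forall x, (forall i, h i x = 0) -> x = 0.
Proof.
have [h hP] := choice (fun n => norming (e n)).
exists h; split=> [i|x hx]; first by case: (hP i).
apply/eqP; rewrite -normr_le0; apply/ler_addgt0Pl => d d0; rewrite addr0.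
have d2 : 0 < d / 2 by rewrite divr_gt0.
have [n xn] := e_dense x d2; have [dh hn] := hP n.
have : `|e n| <= `|x - e n|.
  rewrite -hn -[h n (e n)]subr0 -(hx n) -(lfunB _ _ dh.1) distrC.
  by rewrite (le_trans (ler_norm _))// (le_trans (dh.2 _))// mul1r.
by have := ler_normD (x - e n) (e n); rewrite subrK; lra.
Qed.

Let span_dense : exists h : nat -> X -> R, (forall i, dball 1 (h i)) /\
  forall f (d : R), dball 1 f -> 0 < d ->
    exists N (c : nat -> R), dball d (fun x => f x - \sum_(i < N) c i * h i x).
Proof.
have [h [hb htot]] := total_sequence; exists h; split => // f d df d0.
apply: contrapT => nospan.
have hx (N : nat) : exists x, [/\ forall i, (i < N)%N -> h i x = 0, `|x| <= 1 & d < `|f x|].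
  apply: contrapT => nox; pose V := [set x : X | forall i, (i < N)%N -> h i x = 0].
  have [||||g [dg gf]] := @hahn_banach _ _ V f d.
  - split=> [i iN|a x y Vx Vy i iN]; first exact: lfun0 (hb i).1.
    by rewrite (hb i).1 Vx// Vy// mulr0 addr0.
  - by move=> a x y _ _; exact: df.1.
  - move=> x Vx; rewrite leNgt; apply/negP => fx.
    have x0 : 0 < `|x|.
      rewrite normr_gt0; apply: contraTneq fx => ->.
      by rewrite (lfun0 df.1) !normr0 mulr0 ltxx.
    apply: nox; exists (`|x|^-1 *: x); split.
    + by move=> i iN; rewrite (lfunZ _ _ (hb i).1) Vx// mulr0.
    + by rewrite normrZ normfV normr_id mulVf// gt_eqF.
    + by rewrite (lfunZ _ _ df.1) normrM normfV normr_id mulrC ltr_pdivlMr.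
  - exact: ltW.
  have [|||c cP] := @lfun_kernel R X h N (fun x => f x - g x).
  - by move=> i; case: (hb i).
  - by move=> a x y; rewrite df.1 dg.1; lra.
  - by move=> x Vx; rewrite gf// subrr.
  apply: nospan; exists N, c; have -> // : (fun x => f x - \sum_(i < N) c i * h i x) = g.
  by apply/funext => x; rewrite -cP; lra.
have [x xP] := choice hx.
have [|k [z [nk kz]]] := @weakly_cvg_subsequence x 1; first by move=> n; case: (xP n).
have z0 : z = 0.
  apply: htot => i; have h0 : h i (x (k n)) @[n --> \oo] --> (0 : R).
    apply/cvgrPdist_lt => r r0; exists i.+1 => // n /= iN.
    have [h0 _ _] := xP (k n).
    by rewrite (h0 i (leq_trans iN (nk n))) subr0 normr0.
  exact: cvg_unique (kz _ (hb i)) h0.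
have fz := kz f df; rewrite z0 (lfun0 df.1) in fz.
have /cvgrPdist_lt/(_ _ d0)[N _ /(_ N (leqnn N))] := fz.
by rewrite /= sub0r normrN; have [_ _] := xP (k N); lra.
Qed.

Lemma dual_separable : exists g : nat -> X -> R, (forall i, dball 1 (g i)) /\
  forall f (d : R), dball 1 f -> 0 < d -> exists i, dball d (fun x => f x - g i x).
Proof.
have [h [hb hd]] := span_dense.
pose F (s : seq rat) x := \sum_(i < size s) ratr (nth 0 s i) * h i x : R.
have Fb s : dball (\sum_(i < size s) `|ratr (nth 0 s i) : R|) (F s).
  split=> [a x y|x].
    rewrite /F mulr_sumr -big_split/=; apply: eq_bigr => i _.
    by rewrite (hb i).1; lra.
  rewrite mulr_suml (le_trans (ler_norm_sum _ _ _))//; apply: ler_sum => i _.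
  by rewrite normrM ler_wpM2l// (le_trans ((hb i).2 x))// mul1r.
have S0 (s : seq rat) : 0 <= \sum_(i < size s) `|ratr (nth 0 s i) : R| by apply: sumr_ge0.
pose m s := Num.max 1 (dn (F s)).
have m1 s : 1 <= m s by rewrite le_max lexx.
have m0 s : 0 < m s := lt_le_trans ltr01 (m1 s).
pose G s x := (m s)^-1 * F s x.
have Gb s : dball 1 (G s).
  apply: dball_inv => //; apply: dball_le (dn_dball (Fb s) (S0 s)).
  by rewrite le_max lexx orbT.
exists (fun n => G (odflt [::] (unpickle n))); split=> [i|f d df d0]; first exact: Gb.
have d4 : 0 < d / 4 by rewrite divr_gt0.
have [N [c cP]] := hd f _ df d4.
have K0 : 0 < d / 4 / N.+1%:R by rewrite divr_gt0// ltr0n.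
have hq (K : R) (i : nat) : 0 < K -> exists q : rat, `|c i - ratr q| <= K.
  move=> K1; have /rat_in_itvoo[q] : c i - K < c i by rewrite ltrBlDr ltrDl.
  by rewrite in_itv/= => /andP[? ?]; exists q; rewrite ler_norml; lra.
have [q qP] := choice (fun i => hq _ i K0); pose s := mkseq q N.
have FE x : F s x = \sum_(i < N) ratr (q i) * h i x.
  by rewrite /F size_mkseq; apply: eq_bigr => i _; rewrite nth_mkseq.
have lF : lfun (F s) := (Fb s).1.
have fF x : `|f x - F s x| <= d / 2 * `|x|.
  rewrite FE; set A := \sum_(i < N) _; pose B := \sum_(i < N) c i * h i x.
  have h1 : `|f x - B| <= d / 4 * `|x| := cP.2 x.
  have h2 : `|B - A| <= d / 4 * `|x|.
    rewrite /A /B -sumrB (le_trans (ler_norm_sum _ _ _))//.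
    apply: le_trans (_ : \sum_(i < N) (d / 4 / N.+1%:R * `|x|) <= _).
      apply: ler_sum => i _; rewrite -mulrBl normrM ler_pM//.
      by rewrite (le_trans ((hb i).2 x))// mul1r.
    rewrite sumr_const card_ord -mulrnAl ler_wpM2r// -mulr_natl mulrCA.
    by rewrite ler_piMr ?(ltW d4)// ler_pdivrMr ?ltr0n// mul1r ler_nat.
  by rewrite -(subrKA B) (le_trans (ler_normD _ _))//; lra.
have dF : dball (d / 2) (fun x => f x - F s x).
  by split => // a x y; rewrite df.1 lF; lra.
have dnF : m s <= 1 + d / 2.
  rewrite ge_max lerDl divr_ge0 ?(ltW d0)//=.
  apply: dn_le; last by rewrite addr_ge0// divr_ge0// ltW.
  have -> : F s = (fun x => f x - (f x - F s x)) by apply/funext => x; lra.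
  exact: dballB.
exists (pickle s); rewrite pickleK /=; split.
  by move=> a x y; rewrite df.1 (Gb s).1; lra.
move=> x; have h1 := fF x; have h2 := (Gb s).2 x; rewrite mul1r in h2.
have FG : F s x = m s * G s x by rewrite /G mulrA mulfV ?mul1r// gt_eqF.
rewrite -(subrKA (F s x)) (le_trans (ler_normD _ _))//.
have : `|F s x - G s x| <= d / 2 * `|x|.
  rewrite FG -[X in _ - X]mul1r -mulrBl normrM ler_pM// ger0_norm ?subr_ge0//.
  by rewrite lerBlDr addrC.
by have := normr_ge0 x; lra.
Qed.

Variables (g : nat -> X -> R).
Hypotheses (gb : forall i, dball 1 (g i))
  (g_dense : forall f (d : R), dball 1 f -> 0 < d -> exists i, dball d (fun x => f x - g i x)).

Lemma dense_cvg T (F : set_system T) (u : T -> X) (z : X) (C : R) : Filter F ->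
  (forall t, `|u t| <= C) -> (forall i, g i (u t) @[t --> F] --> g i z) ->
  forall f, dball 1 f -> f (u t) @[t --> F] --> f z.
Proof.
move=> FF uC gz f df; apply/cvgrPdist_le => d d0; pose K : R := 1 + `|C| + `|z|.
have K0 : 0 < K by rewrite /K; have := normr_ge0 C; have := normr_ge0 z; lra.
have d2 : 0 < d / 2 by rewrite divr_gt0.
have dK : 0 < d / 2 / K by rewrite divr_gt0.
have [i [_ fg]] := g_dense df dK.
have /cvgrPdist_le/(_ _ d2) := gz i; apply: filterS => t gt.
have e1 := fg (u t); have e2 := fg z.
have e3 : d / 2 / K * `|u t| + d / 2 / K * `|z| <= d / 2.
  rewrite -mulrDr -mulrA ler_piMr ?(ltW d2)// mulrC ler_pdivrMr// mul1r /K.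
  by have := uC t; have := ler_norm C; lra.
by move: gt e1 e2; rewrite !ler_norml => /andP[? ?] /andP[? ?] /andP[? ?]; lra.
Qed.

Context (U : set_system nat) (UF : UltraFilter U) (Uoo : \oo `<=` U).

Lemma weak_ulim (x : nat -> X) (C : R) : (forall n, `|x n| <= C) ->
  exists z, forall f, dball 1 f -> f (x n) @[n --> U] --> f z.
Proof.
move=> xC; have gx i n : `|g i (x n)| <= C.
  by rewrite (le_trans ((gb i).2 _))// mul1r.
have [l lP] := choice (fun i => ulim_ex UF (gx i)).
have hn (k : nat) : exists n, forall i, (i < k)%N -> `|l i - g i (x n)| < k.+1%:R^-1.
  have nU : \forall n \near U, forall i, (i < k)%N -> `|l i - g i (x n)| < k.+1%:R^-1.
    apply: near_all_lt => i _.
    by have /cvgrPdist_lt := lP i; apply; rewrite invr_gt0 ltr0n.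
  exact: filter_ex nU.
have [n nP] := choice hn.
have [k [z [nk kz]]] := @weakly_cvg_subsequence (x \o n) C (fun j => xC (n j)).
exists z; apply: (dense_cvg _ xC) => i; have -> // : g i z = l i.
apply: cvg_unique (kz _ (gb i)) _ => //; apply/cvgrPdist_lt => d d0; near=> j.
apply: lt_trans (nP (k j) i _) _.
  by rewrite (leq_trans _ (nk j))//; near: j; exact: nbhs_infty_gt.
apply: (@le_lt_trans _ _ j.+1%:R^-1).
  by rewrite lef_pV2 ?posrE ?ltr0n// ler_nat ltnS nk.
by near: j; exact: near_infty_natSinv_lt (PosNum d0).
Unshelve. all: by end_near. Qed.

Lemma mprop_ulim (w : X) (u : nat -> X) (C l : R) : (forall n, `|u n| <= C) ->
  (forall f, dball 1 f -> f (u n) @[n --> U] --> (0 : R)) -> `|u n| @[n --> U] --> l ->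
  `|w + u n| `^ p @[n --> U] --> `|w| `^ p + l `^ p.
Proof.
move=> uC u0 ul; pose a n := `|w + u n| `^ p - `|u n| `^ p.
suff ha : a n @[n --> U] --> `|w| `^ p.
  have -> : (fun n => `|w + u n| `^ p) = (fun n => a n + `|u n| `^ p).
    by apply/funext => n; rewrite /a subrK.
  by apply: cvgD => //; exact: cvg_powR.
apply/cvgrPdist_lt => d d0; have [//|nU] := in_ultra_setVsetC [set n | `| `|w| `^ p - a n| < d] UF.
exfalso; have hn (k : nat) : exists n, d <= `| `|w| `^ p - a n| /\
    forall i, (i < k)%N -> `|g i (u n)| < k.+1%:R^-1.
  suff nU' : \forall n \near U, forall i, (i < k)%N -> `|g i (u n)| < k.+1%:R^-1.
    have [n [h1 h2]] := filter_ex (filterI nU nU'); exists n; split => //.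
    by move/negP: h1; rewrite -leNgt.
  apply: near_all_lt => i _; have /cvgrPdist_lt/(_ k.+1%:R^-1) := u0 _ (gb i).
  rewrite invr_gt0 ltr0n => /(_ isT); apply: filterS => n.
  by rewrite sub0r normrN.
have [n nP] := choice hn.
have un0 : weak0 (u \o n).
  move=> f df; rewrite -(lfun0 df.1).
  have gun i : g i (u (n k)) @[k --> \oo] --> g i 0.
    rewrite (lfun0 (gb i).1); apply/cvgrPdist_lt => r r0; near=> k.
    rewrite sub0r normrN; apply: lt_trans ((nP k).2 i _) _.
      by near: k; exact: nbhs_infty_gt.
    by near: k; exact: near_infty_natSinv_lt (PosNum r0).
  exact: (@dense_cvg nat \oo (u \o n) 0 C _ (fun k => uC (n k)) gun f df).
have aw : a (n k) @[k --> \oo] --> `|w| `^ p.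
  exact: (@Xm w (u \o n) C (fun k => uC (n k)) un0).
have /cvgrPdist_lt/(_ _ d0)[N _ /(_ N (leqnn N))] := aw.
by rewrite ltNge => /negP; apply; case: (nP N).
Unshelve. all: by end_near. Qed.

End reflexivity.

(** * Asymptotic splitting of vectors and functionals *)

Section far_functionals.
Context {R : realType} {X : normedModType R} (e : nat -> X) (g : nat -> X -> R).

Definition far (N : nat) (f : X -> R) :=
  dball 1 f /\ forall j, (j < N)%N -> `|f (e j)| <= N.+1%:R^-1.

Lemma far_le N N' f : (N <= N')%N -> far N' f -> far N f.
Proof.
move=> NN' [df ff]; split => // j jN; apply: le_trans (ff j _) _.
  exact: leq_trans NN'.
by rewrite lef_pV2 ?posrE ?ltr0n// ler_nat ltnS.
Qed.

Lemma far_zero N : far N (fun=> 0).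
Proof. by split; [exact: dball_zero|move=> j _; rewrite normr0 invr_ge0]. Qed.

Lemma far_cvg0 (v : nat -> X -> R) : dense_sequence e -> (forall n, far n (v n)) ->
  forall x, v n x @[n --> \oo] --> (0 : R).
Proof.
move=> ed vf x; apply/cvgrPdist_lt => d d0.
have d2 : 0 < d / 2 by rewrite divr_gt0.
have [j xj] := ed x _ d2; near=> n; rewrite sub0r normrN.
have h1 : `|v n (e j)| <= n.+1%:R^-1.
  by apply: (vf n).2; near: n; exact: nbhs_infty_gt.
have h2 : n.+1%:R^-1 < d / 2 by near: n; exact: near_infty_natSinv_lt (PosNum d2).
have h3 := dball_leB x (e j) (vf n).1; rewrite mul1r in h3.
rewrite -(subrK (v n (e j)) (v n x)) (le_lt_trans (ler_normD _ _))// [d]splitr.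
by rewrite ltrD//; [exact: le_lt_trans h3 xj|exact: le_lt_trans h1 h2].
Unshelve. all: by end_near. Qed.

Definition mu (M N : nat) (x : X) : R :=
  \big[Num.max/0]_(i < M) (if `[< far N (g i) >] then `|g i x| else 0).

Lemma mu_ge0 M N x : 0 <= mu M N x.
Proof. by rewrite /mu; elim/big_rec: _ => // i y _ y0; rewrite le_max y0 orbT. Qed.

Lemma mu_ge M N x i : (i < M)%N -> far N (g i) -> `|g i x| <= mu M N x.
Proof.
move=> iM fi; rewrite /mu (bigD1 (Ordinal iM))//= le_max.
by case: asboolP => // _; rewrite lexx.
Qed.

Lemma mu_ex M N x : mu M N x = 0 \/
  exists i, [/\ (i < M)%N, far N (g i) & mu M N x = `|g i x|].
Proof.
rewrite /mu; elim/big_rec: _ => [|i y _ hy]; first by left.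
case: asboolP => fi; rewrite /Num.max; case: ifP => // _; [|by left].
by right; exists i.
Qed.

Lemma mu_le M N x (c : R) : 0 <= c -> (forall i, (i < M)%N -> far N (g i) -> `|g i x| <= c) ->
  mu M N x <= c.
Proof. by move=> c0 h; have [->//|[i [iM fi ->]]] := mu_ex M N x; exact: h. Qed.

Lemma mu_mono M M' N x : (M <= M')%N -> mu M N x <= mu M' N x.
Proof.
move=> MM'; apply: mu_le => [|i iM fi]; first exact: mu_ge0.
by apply: mu_ge => //; exact: leq_trans MM'.
Qed.

Lemma mu_le_norm M N x : mu M N x <= `|x|.
Proof.
by apply: mu_le => // i _ [[_ gi] _]; rewrite (le_trans (gi x))// mul1r.
Qed.

End far_functionals.

Section asymptotic.
Context {R : realType} {X : normedModType R} (p : R) (p1 : 1 < p).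
Context (U : set_system nat) (UF : UltraFilter U) (Uoo : \oo `<=` U).
Hypothesis weak_lim : forall (x : nat -> X) (C : R), (forall n, `|x n| <= C) ->
  exists z, forall f, dball 1 f -> f (x n) @[n --> U] --> f z.
Hypothesis norm_lim : forall (w : X) (u : nat -> X) (C l : R), (forall n, `|u n| <= C) ->
  (forall f, dball 1 f -> f (u n) @[n --> U] --> (0 : R)) -> `|u n| @[n --> U] --> l ->
  `|w + u n| `^ p @[n --> U] --> `|w| `^ p + l `^ p.

Let p0 : 0 < p. Proof. exact: lt_trans p1. Qed.

Lemma ulim_split (x : nat -> X) : (forall n, `|x n| <= 1) -> exists y (l : R),
  [/\ `|y| <= 1, 0 <= l <= 1,
      forall f, dball 1 f -> f (x n) @[n --> U] --> f y,
      `|x n - y| @[n --> U] --> l &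
      `|x n| `^ p @[n --> U] --> `|y| `^ p + l `^ p].
Proof.
move=> x1; have [y yP] := weak_lim x1.
have bnd n : `|x n - y| <= 1 + `|y| by rewrite (le_trans (ler_normB _ _))// lerD2r.
have [l lP] : exists l : R, `|x n - y| @[n --> U] --> l.
  by apply: (@ulim_ex _ _ UF _ (1 + `|y|)) => n; rewrite normr_id.
have l0 : 0 <= l by apply: cvgr_to_ge lP _; exact: nearW.
have u0 f : dball 1 f -> f (x n - y) @[n --> U] --> (0 : R).
  move=> df; have -> : (fun n => f (x n - y)) = (fun n => f (x n) - f y).
    by apply/funext => n; rewrite (lfunB _ _ df.1).
  by rewrite -(subrr (f y)); apply: cvgB; [exact: yP|exact: cvg_cst].
have xp : `|x n| `^ p @[n --> U] --> `|y| `^ p + l `^ p.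
  have -> : (fun n => `|x n| `^ p) = (fun n => `|y + (x n - y)| `^ p).
    by apply/funext => n; rewrite addrC subrK.
  exact: (@norm_lim y (fun n => x n - y) _ l bnd u0 lP).
have le1 : `|y| `^ p + l `^ p <= 1.
  apply: cvgr_to_le xp _; apply: nearW => n.
  by rewrite powR_le1.
exists y, l; rewrite l0; split => //=; rewrite -(powR_le1 p0)//.
  by rewrite (le_trans _ le1)// lerDl powR_ge0.
by rewrite (le_trans _ le1)// lerDr powR_ge0.
Qed.

Lemma far_splitting (e : nat -> X) (g : nat -> X -> R) (M : nat) (d : R) :
  dense_sequence e -> (forall i, dball 1 (g i)) -> 0 < d ->
  exists N, forall v x, far e N v -> `|x| <= 1 -> exists y, [/\ `|y| <= 1,
    forall i, (i < M)%N -> `|g i x| `^ p <= `|g i y| `^ p + d &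
    `|y| `^ p + `|v x| `^ p <= `|x| `^ p + d].
Proof.
move=> ed gb d0; apply: contrapT => /forallNP h.
have {}h N : exists vx : (X -> R) * X, [/\ far e N vx.1, `|vx.2| <= 1 &
    forall y, `|y| <= 1 ->
    (forall i, (i < M)%N -> `|g i vx.2| `^ p <= `|g i y| `^ p + d) ->
    `|vx.2| `^ p + d < `|y| `^ p + `|vx.1 vx.2| `^ p].
  have /existsNP[v /existsNP[x /not_implyP[fv /not_implyP[x1 no]]]] := h N.
  exists (v, x); split => // y y1 yg; rewrite ltNge; apply/negP => yx.
  by apply: no; exists y.
have [vx vxP] := choice h; pose v n := (vx n).1; pose x n := (vx n).2.
have x1 n : `|x n| <= 1 by case: (vxP n).
have vf n : far e n (v n) by case: (vxP n).
have [y [l [y1 /andP[l0 l1] xy xl xp]]] := ulim_split x1.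
have vy : v n y @[n --> U] --> (0 : R) by exact: (cvg_oo_U Uoo (@far_cvg0 _ _ _ _ ed vf y)).
have [V VP] : exists V : R, `|v n (x n)| @[n --> U] --> V.
  apply: (@ulim_ex _ _ UF _ 1) => n; rewrite normr_id.
  exact: dball_le1 (vf n).1 (x1 n).
have Vl : V <= l.
  have h1 : `|v n y| + `|x n - y| @[n --> U] --> `|0 : R| + l.
    by apply: cvgD => //; exact: cvg_norm.
  rewrite normr0 add0r in h1; apply: ler_cvg_to VP h1 _; apply: nearW => n.
  have := dball_leB (x n) y (vf n).1; rewrite mul1r => h2.
  by rewrite -{1}(subrK (v n y) (v n (x n))) (le_trans (ler_normD _ _))// addrC lerD2l.
have V0 : 0 <= V by apply: cvgr_to_ge VP _; exact: nearW.
have h1 : \forall n \near U, forall i, (i < M)%N -> `|g i (x n)| `^ p <= `|g i y| `^ p + d.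
  apply: near_all_lt => i _.
  have gy : `|g i (x n)| `^ p @[n --> U] --> `|g i y| `^ p.
    by apply: cvg_powR => //; apply: cvg_norm; exact: xy.
  by apply: (cvgr_le _ gy); rewrite ltrDl.
have h2 : \forall n \near U, `|y| `^ p + `|v n (x n)| `^ p <= `|x n| `^ p + d.
  have c1 : `|y| `^ p + `|v n (x n)| `^ p @[n --> U] --> `|y| `^ p + V `^ p.
    by apply: cvgD; [exact: cvg_cst|exact: cvg_powR].
  have d2 : 0 < d / 2 by rewrite divr_gt0.
  have n1 : \forall n \near U, `|y| `^ p + `|v n (x n)| `^ p < `|y| `^ p + V `^ p + d / 2.
    by apply: (cvgr_lt _ c1); rewrite ltrDl.
  have n2 : \forall n \near U, `|y| `^ p + l `^ p - d / 2 < `|x n| `^ p.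
    by apply: (cvgr_gt _ xp); rewrite ltrBlDr ltrDl.
  have Vlp : V `^ p <= l `^ p by rewrite powR_le// ltW.
  by apply: filterS2 n1 n2 => n; lra.
have [n [n1 n2]] := filter_ex (filterI h1 h2).
by have [_ _ /(_ y y1 n1)] := vxP n; rewrite ltNge n2.
Qed.

Lemma dual_lower (F : nat -> X -> R) (f : X -> R) (b : R) :
  (forall n, dball 1 (F n)) -> dball 1 f -> (forall x, F n x @[n --> U] --> f x) ->
  dn (fun x => F n x - f x) @[n --> U] --> b ->
  forall s t, 0 <= s -> 0 <= t -> dn f * s + b * t <= (s `^ p + t `^ p) `^ p^-1.
Proof.
have arith (a c d D r s t : R) : s * a + t * (b - c) <= r -> s * (D - c) <= s * a ->
    c * s + c * t <= d -> D * s + b * t <= d + r by lra.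
move=> bF bf Ff Fb s t s0 t0; apply/ler_addgt0Pl => d d0.
pose K : R := 1 + s + t; have K0 : 0 < K by rewrite /K; lra.
have dK : 0 < d / K by rewrite divr_gt0.
have bW n : dball 2 (fun x => F n x - f x) by have := dballB (bF n) bf.
have [x [x1 fx]] := dn_ex bf ler01 dK.
have [y yP] := choice (fun n => dn_ex (bW n) (ler0n _ 2) dK).
have y1 n : `|y n| <= 1 by case: (yP n).
have [z [l [z1 /andP[l0 l1] yz yl _]]] := ulim_split y1.
have c1 : `|s *: x + t *: (y n - z)| `^ p @[n --> U] --> `|s *: x| `^ p + (t * l) `^ p.
  apply: (@norm_lim (s *: x) (fun n => t *: (y n - z)) (t * 2) (t * l)) => [n|f' df'|].
  - rewrite normrZ ger0_norm// ler_wpM2l// (le_trans (ler_normB _ _))//.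
    by have := y1 n; lra.
  - have -> : (fun n => f' (t *: (y n - z))) = (fun n => t * (f' (y n) - f' z)).
      by apply/funext => n; rewrite (lfunZ _ _ df'.1) (lfunB _ _ df'.1).
    rewrite -(mulr0 t) -[X in t * X](subrr (f' z)); apply: cvgMl_tmp.
    by apply: cvgB; [exact: yz|exact: cvg_cst].
  - have -> : (fun n => `|t *: (y n - z)|) = (fun n => t * `|y n - z|).
      by apply/funext => n; rewrite normrZ ger0_norm.
    by apply: cvgMl_tmp.
have ip0 : 0 < p^-1 by rewrite invr_gt0.
have c2 : `|s *: x + t *: (y n - z)| @[n --> U] --> (`|s *: x| `^ p + (t * l) `^ p) `^ p^-1.
  have -> : (fun n => `|s *: x + t *: (y n - z)|) = (fun n => (`|s *: x + t *: (y n - z)| `^ p) `^ p^-1).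
    by apply/funext => n; rewrite powR_root.
  by apply: cvg_powR => // n; exact: powR_ge0.
have c3 : s * F n x + t * (f (y n) - F n z) + t * (dn (fun x => F n x - f x) - d / K) @[n --> U]
    --> s * f x + t * (f z - f z) + t * (b - d / K).
  apply: cvgD; first apply: cvgD.
  - by apply: cvgMl_tmp; exact: Ff.
  - by apply: cvgMl_tmp; apply: cvgB; [exact: yz|exact: Ff].
  - by apply: cvgMl_tmp; apply: cvgB => //; exact: cvg_cst.
have main : s * f x + t * (f z - f z) + t * (b - d / K) <= (`|s *: x| `^ p + (t * l) `^ p) `^ p^-1.
  apply: ler_cvg_to c3 c2 _; apply: nearW => n.
  have := (bF n).2 (s *: x + t *: (y n - z)); rewrite mul1r; apply: le_trans.
  apply: le_trans (ler_norm _); have lF := (bF n).1.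
  rewrite (lfunD _ _ lF) !(lfunZ _ _ lF) (lfunB _ _ lF).
  have [_ h] := yP n; have := ler_wpM2l t0 (ltW h); lra.
have le1 : (`|s *: x| `^ p + (t * l) `^ p) `^ p^-1 <= (s `^ p + t `^ p) `^ p^-1.
  apply: powR_le; [exact: ltW|by rewrite addr_ge0// powR_ge0|].
  rewrite lerD// powR_le ?(ltW p0)// ?mulr_ge0//; last by rewrite ler_piMr.
  by rewrite normrZ ger0_norm// ler_piMr.
have hs : s * (dn f - d / K) <= s * f x by rewrite ler_wpM2l// ltW.
have hK : d / K * s + d / K * t <= d.
  by rewrite -mulrDr mulrAC ler_pdivrMr// ler_wpM2l ?(ltW d0)// /K -addrA lerDr.
rewrite subrr mulr0 addr0 in main; exact: arith (le_trans main le1) hs hK.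
Qed.

End asymptotic.

Section dual_splitting.
Context {R : realType} {X : normedModType R} (p : R) (p1 : 1 < p).
Context (U : set_system nat) (UF : UltraFilter U) (Uoo : \oo `<=` U).
Hypothesis weak_lim : forall (x : nat -> X) (C : R), (forall n, `|x n| <= C) ->
  exists z, forall f, dball 1 f -> f (x n) @[n --> U] --> f z.
Hypothesis norm_lim : forall (w : X) (u : nat -> X) (C l : R), (forall n, `|u n| <= C) ->
  (forall f, dball 1 f -> f (u n) @[n --> U] --> (0 : R)) -> `|u n| @[n --> U] --> l ->
  `|w + u n| `^ p @[n --> U] --> `|w| `^ p + l `^ p.
Variables (e : nat -> X) (g : nat -> X -> R).
Hypotheses (gb : forall i, dball 1 (g i))
  (g_dense : forall f (d : R), dball 1 f -> 0 < d ->
    exists i, dball d (fun x => f x - g i x)).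

Let p0 : 0 < p. Proof. exact: lt_trans p1. Qed.

Lemma weak_star_ulim (F : nat -> X -> R) : (forall n, dball 1 (F n)) ->
  exists f, dball 1 f /\ forall x, F n x @[n --> U] --> f x.
Proof.
move=> bF; have h x : exists l : R, F n x @[n --> U] --> l.
  apply: (@ulim_ex _ _ UF _ `|x|) => n.
  by have := (bF n).2 x; rewrite mul1r.
have [f fP] := choice h; exists f; split => //; split=> [a x y|x].
  have c1 : F n (a *: x + y) @[n --> U] --> a * f x + f y.
    have -> : (fun n => F n (a *: x + y)) = (fun n => a * F n x + F n y).
      by apply/funext => n; rewrite (bF n).1.
    by apply: cvgD => //; apply: cvgMl_tmp.
  exact: cvg_unique (fP _) c1.
have c1 : `|F n x| @[n --> U] --> `|f x| by apply: cvg_norm; exact: fP.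
by apply: cvgr_to_le c1 _; apply: nearW => n; exact: (bF n).2.
Qed.

Let far_dense N f (d : R) : dball 1 f -> 0 < d ->
  (forall j, (j < N)%N -> `|f (e j)| <= (2 * N.+1%:R)^-1) ->
  exists i, far e N (g i) /\ dball d (fun x => f x - g i x).
Proof.
move=> df d0 fe; pose K : R := 1 + \sum_(j < N) `|e j|.
have K0 : 0 < K by rewrite /K ltr_pwDl// sumr_ge0.
have NN : 0 < (2 * N.+1%:R)^-1 :> R by rewrite invr_gt0 mulr_gt0// ltr0n.
pose d' := Num.min d ((2 * N.+1%:R)^-1 / K).
have d'0 : 0 < d' by rewrite lt_min d0 divr_gt0.
have [i ig] := g_dense df d'0; exists i; split; last first.
  by apply: dball_le ig; rewrite ge_min lexx.
split=> // j jN; have := ig.2 (e j) => h1; have h2 := fe j jN.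
have ejK : `|e j| <= K.
  by rewrite /K (bigD1 (Ordinal jN))//= addrCA lerDl addr_ge0// sumr_ge0.
have h3 : d' * `|e j| <= (2 * N.+1%:R)^-1.
  apply: le_trans (_ : (2 * N.+1%:R)^-1 / K * K <= _); last by rewrite divfK// gt_eqF.
  by rewrite ler_pM// ?(ltW d'0)// ge_min lexx orbT.
have -> : N.+1%:R^-1 = (2 * N.+1%:R)^-1 + (2 * N.+1%:R)^-1 :> R.
  rewrite invfM -mulrDl; have -> : 2^-1 + 2^-1 = 1 :> R by lra.
  by rewrite mul1r.
rewrite -(subrK (f (e j)) (g i (e j))) (le_trans (ler_normD _ _))// lerD//.
by rewrite distrC (le_trans h1).
Qed.

(* A weak* cluster point f of the functionals F M carries the coefficient
   |f|, the remainders F M - f (normalized) become far, and [dual_lower] bounds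
   the two coefficients. *)
Lemma dual_splitting (N' N2 : nat) (d : R) : 0 < d -> exists M, forall f x,
  dball 1 f -> `|x| <= 1 ->
  (forall j, (j < N')%N -> 8 * N'.+1%:R * `|f (e j)| <= d) ->
  exists v, far e N2 v /\ `|f x| <= (mu e g M N' x `^ p + `|v x| `^ p) `^ p^-1 + d.
Proof.
move=> d0; apply: contrapT => /forallNP no.
have {}no M : exists fx : (X -> R) * X, [/\ dball 1 fx.1, `|fx.2| <= 1,
    forall j, (j < N')%N -> 8 * N'.+1%:R * `|fx.1 (e j)| <= d &
    forall v, far e N2 v ->
      (mu e g M N' fx.2 `^ p + `|v fx.2| `^ p) `^ p^-1 + d < `|fx.1 fx.2|].
  have /existsNP[f /existsNP[x /not_implyP[df /not_implyP[x1 /not_implyP[fe nv]]]]] := no M.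
  exists (f, x); split => // v fv; rewrite ltNge; apply/negP => h.
  by apply: nv; exists v.
have [Fx FxP] := choice no; pose F n := (Fx n).1; pose x n := (Fx n).2.
have bF n : dball 1 (F n) by case: (FxP n).
have x1 n : `|x n| <= 1 by case: (FxP n).
have Fe n j : (j < N')%N -> 8 * N'.+1%:R * `|F n (e j)| <= d by case: (FxP n) => _ _ + _; exact.
have [f [bf Ff]] := weak_star_ulim bF.
pose W n y := F n y - f y.
have bW n : dball 2 (W n) by have := dballB (bF n) bf.
have [b Wb] : exists b : R, dn (W n) @[n --> U] --> b.
  apply: (@ulim_ex _ _ UF _ 2) => n.
  by rewrite ger0_norm ?(dn_ge0 (bW n))// (dn_le (bW n)).
have low := dual_lower p1 UF weak_lim norm_lim bF bf Ff Wb.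
pose a := dn f; have a0 : 0 <= a by exact: (dn_ge0 bf).
have a1 : a <= 1 by exact: (dn_le bf).
have b0 : 0 <= b by apply: cvgr_to_ge Wb _; apply: nearW => n; exact: (dn_ge0 (bW n)).
have fe j : (j < N')%N -> 8 * N'.+1%:R * `|f (e j)| <= d.
  move=> jN; have c1 : 8 * N'.+1%:R * `|F n (e j)| @[n --> U] --> 8 * N'.+1%:R * `|f (e j)|.
    by apply: cvgMl_tmp; apply: cvg_norm; exact: Ff.
  by apply: cvgr_to_le c1 _; apply: nearW => n; exact: Fe.
have d4 : 0 < d / 4 by rewrite divr_gt0.
have t1 : \forall n \near U, `|f (x n)| <= a * mu e g n N' (x n) + d / 4.
  have [ad|ad] := leP a (d / 4).
    apply: nearW => n; rewrite (le_trans (dn_ge bf _ (x1 n)))// -/a.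
    by rewrite (le_trans ad)// lerDr mulr_ge0// mu_ge0.
  have ap : 0 < a by exact: lt_trans ad.
  pose f' y := a^-1 * f y.
  have bf' : dball 1 f' by apply: dball_inv => //; exact: dn_dball bf _.
  have [i [fi gi]] : exists i, far e N' (g i) /\ dball (d / 4) (fun x => f' x - g i x).
    apply: far_dense => // j jN; rewrite /f' normrM gtr0_norm ?invr_gt0//.
    rewrite mulrC ler_pdivrMr// -ler_pdivrMl ?invr_gt0 ?mulr_gt0 ?ltr0n// invrK.
    by have := fe j jN; move: (N'.+1%:R : R) => c; lra.
  have := ularge Uoo i.+1; apply: filterS => n ni.
  have fE : f (x n) = a * f' (x n) by rewrite /f' mulrA mulfV ?mul1r// gt_eqF.
  rewrite fE normrM (gtr0_norm ap).
  have h1 := gi.2 (x n); have h2 := mu_ge (x n) ni fi.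
  have h3 : `|f' (x n)| <= mu e g n N' (x n) + d / 4.
    rewrite -(subrK (g i (x n)) (f' (x n))) (le_trans (ler_normD _ _))// addrC lerD//.
    by rewrite (le_trans h1)// ler_piMr// ltW.
  rewrite (le_trans (ler_wpM2l a0 h3))// mulrDr lerD2l ler_piMl// ltW//.
have t2 : \forall n \near U, exists v, far e N2 v /\ `|W n (x n)| <= b * `|v (x n)| + d / 4.
  have [bd|bd] := leP b (d / 8).
    have : \forall n \near U, dn (W n) <= d / 4.
      by apply: (cvgr_le _ Wb); rewrite (le_lt_trans bd)//; lra.
    apply: filterS => n Wn; exists (fun=> 0); split; first exact: far_zero.
    rewrite normr0 mulr0 add0r (le_trans _ Wn)//; exact: (dn_ge (bW n)).
  have bp : 0 < b by rewrite (lt_trans _ bd)// divr_gt0.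
  have n1 : \forall n \near U, b / 2 < dn (W n).
    by apply: (cvgr_gt _ Wb); rewrite ltr_pdivrMr// ltr_pMr// ltr1n.
  have n2 : \forall n \near U, dn (W n) < b + d / 4 by apply: (cvgr_lt _ Wb); rewrite ltrDl.
  have n3 : \forall n \near U, forall j, (j < N2)%N -> `|W n (e j)| <= b / 2 / N2.+1%:R.
    apply: near_all_lt => j _.
    have c1 : `|W n (e j)| @[n --> U] --> (0 : R).
      rewrite -(normr0 R); apply: cvg_norm; rewrite -(subrr (f (e j))).
      by apply: cvgB; [exact: Ff|exact: cvg_cst].
    by apply: (cvgr_le _ c1); rewrite !divr_gt0// ltr0n.
  apply: filterS3 n1 n2 n3 => n n1 n2 n3.
  have Wp : 0 < dn (W n) by rewrite (lt_trans _ n1)// divr_gt0.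
  have bv : dball 1 (fun y => (dn (W n))^-1 * W n y).
    by apply: dball_inv => //; exact: dn_dball (bW n) _.
  exists (fun y => (dn (W n))^-1 * W n y); split.
    split => // j jN; rewrite normrM gtr0_norm ?invr_gt0// mulrC ler_pdivrMr//.
    rewrite (le_trans (n3 j jN))// mulrC ler_wpM2l ?invr_ge0// ltW//.
  have := dball_le1 bv (x1 n); set v := _ * W n (x n) => v1.
  have -> : W n (x n) = dn (W n) * v by rewrite /v mulrA mulfV ?mul1r// gt_eqF.
  rewrite normrM gtr0_norm//.
  have := ler_wpM2r (normr_ge0 v) (ltW n2).
  have : d / 4 * `|v| <= d / 4 by rewrite ler_piMr// ltW.
  by lra.
have [n [h1 [v [fv h2]]]] := filter_ex (filterI t1 t2).
have [_ _ _ /(_ v fv)] := FxP n; apply/negP; rewrite -leNgt -/(F n) -/(x n).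
have h3 := low _ _ (mu_ge0 e g n N' (x n)) (normr_ge0 (v (x n))).
rewrite -(subrK (f (x n)) (F n (x n))) (le_trans (ler_normD _ _))//.
move: h1 h2 h3; rewrite -/a /W; lra.
Qed.

End dual_splitting.

(** * Blocks of functionals *)

Lemma uniform_bound k (P : nat -> nat -> Prop) :
  (forall i M M', (M <= M')%N -> P i M -> P i M') ->
  (forall i, (i < k)%N -> exists M, P i M) -> exists M, forall i, (i < k)%N -> P i M.
Proof.
move=> mono; elim: k => [|k IHk] h; first by exists 0%N.
have [M MP] := IHk (fun i ik => h i (ltnW ik)); have [M' M'P] := h k (leqnn _).
exists (maxn M M') => i; rewrite ltnS leq_eqVlt => /predU1P[->|ik].
  exact: mono (leq_maxr _ _) M'P.
exact: mono (leq_maxl _ _) (MP i ik).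
Qed.

Lemma powR_modulus (R : realType) (p L d : R) : 0 < p -> 0 < d ->
  exists2 c : R, 0 < c & forall T, 0 <= T -> T <= L -> (T + c) `^ p <= T `^ p + d.
Proof.
move=> p0 d0; apply: contrapT => no.
have h (n : nat) : exists T : R, [/\ 0 <= T, T <= L & T `^ p + d < (T + n.+1%:R^-1) `^ p].
  apply: contrapT => nT; apply: no; exists n.+1%:R^-1; first by rewrite invr_gt0 ltr0n.
  by move=> T T0 TL; rewrite leNgt; apply/negP => ?; apply: nT; exists T.
have [T TP] := choice h.
have [U [UF Uoo]] := ultraFilterLemma (eventually_filter : ProperFilter \oo).
have [t Tt] : exists t : R, T n @[n --> U] --> t.
  by apply: (@ulim_ex _ _ UF _ L) => n; have [T0 TL _] := TP n; rewrite ger0_norm.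
have inv0 : n.+1%:R^-1 @[n --> U] --> (0 : R).
  apply: (cvg_oo_U Uoo); apply/cvgrPdist_lt => r r0; near=> n.
  rewrite sub0r normrN ger0_norm ?invr_ge0//.
  by near: n; exact: near_infty_natSinv_lt (PosNum r0).
have c1 : (T n + n.+1%:R^-1) `^ p @[n --> U] --> (t + 0) `^ p.
  apply: cvg_powR => //; last exact: cvgD.
  by move=> n; have [T0 _ _] := TP n; rewrite addr_ge0// invr_ge0.
have c2 : T n `^ p + d @[n --> U] --> t `^ p + d.
  apply: cvgD; last exact: cvg_cst.
  by apply: cvg_powR => // n; have [] := TP n.
have : t `^ p + d <= (t + 0) `^ p.
  by apply: ler_cvg_to c2 c1 _; apply: nearW => n; have [_ _ /ltW] := TP n.
by rewrite addr0; lra.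
Unshelve. all: by end_near. Qed.

Lemma sum_residues (R : realType) (F : nat -> R) K m :
  \sum_(c < m * K) F c = \sum_(r < K) \sum_(i < m) F (r + i * K)%N.
Proof.
elim: m => [|m IHm].
  by rewrite mul0n big_ord0 big1// => r _; rewrite big_ord0.
rewrite mulSn addnC big_split_ord /= IHm -big_split /=; apply: eq_bigr => r _.
by rewrite big_ord_recr /= addnC.
Qed.

Section stages.
Context {R : realType} {X : normedModType R} (p : R) (p1 : 1 < p).
Variables (e : nat -> X) (g : nat -> X -> R).

Let p0 : 0 < p. Proof. exact: lt_trans p1. Qed.

Hypothesis splitting : forall (N' N2 : nat) (d : R), 0 < d -> exists M, forall f x,
  dball 1 f -> `|x| <= 1 ->
  (forall j, (j < N')%N -> 8 * N'.+1%:R * `|f (e j)| <= d) ->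
  exists v, far e N2 v /\ `|f x| <= (mu e g M N' x `^ p + `|v x| `^ p) `^ p^-1 + d.

Definition far_split M (d : R) N := forall v x, far e N v -> `|x| <= 1 -> exists y, [/\ `|y| <= 1,
  forall i, (i < M)%N -> `|g i x| `^ p <= `|g i y| `^ p + d &
  `|y| `^ p + `|v x| `^ p <= `|x| `^ p + d].

Hypothesis farP : forall M d, 0 < d -> exists N, far_split M d N.

Definition dual_split N1 N' N2 (d : R) M := forall f x, far e N1 f -> `|x| <= 1 ->
  exists v, far e N2 v /\ `|f x| `^ p <= mu e g M N' x `^ p + `|v x| `^ p + d.

Definition good N' N1 (d : R) := forall N2, exists M, dual_split N1 N' N2 d M.

Let dual_split_mono N1 N' N2 d M M' : (M <= M')%N ->
  dual_split N1 N' N2 d M -> dual_split N1 N' N2 d M'.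
Proof.
move=> MM' h f x ff x1; have [v [fv vP]] := h f x ff x1; exists v; split => //.
apply: le_trans vP _; rewrite -!addrA lerD2r powR_le ?(ltW p0) ?mu_ge0//.
exact: mu_mono.
Qed.

Let goodP N' (d : R) : 0 < d -> exists c : R, 0 < c /\ forall N1,
  (forall f, far e N1 f -> forall j, (j < N')%N -> 8 * N'.+1%:R * `|f (e j)| <= c) ->
  good N' N1 d.
Proof.
move=> d0; have [c c0 cP] := powR_modulus 2 p0 d0; exists c; split => // N1 h N2.
have [M MP] := splitting N' N2 c0; exists M => f x ff x1.
have [v [fv vx]] := MP f x ff.1 x1 (h f ff); exists v; split => //.
set A := mu e g M N' x `^ p + `|v x| `^ p in vx *.
have A0 : 0 <= A by rewrite addr_ge0// powR_ge0.
have A2 : A <= 2 `^ p.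
  apply: (@le_trans _ _ 2); last by apply: le1r_powR; [rewrite ler1n|exact: ltW].
  rewrite /A (_ : 2 = 1 + 1 :> R)// lerD// powR_le1// ?mu_ge0//.
    exact: le_trans (mu_le_norm _ _ _ _ x) x1.
  exact: dball_le1 fv.1 x1.
have T0 := powR_ge0 A p^-1.
have T2 : A `^ p^-1 <= 2 by rewrite -(powR_leE p0)// powR_rootV.
have := cP _ T0 T2; rewrite powR_rootV//; apply: le_trans.
exact: powR_le (ltW p0) (normr_ge0 _) vx.
Qed.

Lemma good0 d : 0 < d -> good 0 0 d.
Proof. by move=> d0; have [c [c0 cP]] := goodP 0 d0; apply: cP. Qed.

Let good_ex N' d : 0 < d -> exists N1, good N' N1 d.
Proof.
move=> d0; have [c [c0 cP]] := goodP N' d0.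
pose n := Num.truncn (8 * N'.+1%:R / c); exists (maxn N' n); apply: cP => f ff j jN.
have fe := ff.2 j (leq_trans jN (leq_maxl _ _)).
have N0 : 0 < 8 * N'.+1%:R :> R by rewrite mulr_gt0// ltr0n.
rewrite mulrC -ler_pdivlMr// (le_trans fe)// -[c / _]invrK lef_pV2 ?posrE ?invr_gt0 ?divr_gt0 ?ltr0n//.
rewrite invf_div (le_trans (ltW (truncnS_gt _)))// ler_nat ltnS leq_maxr//.
Qed.

Let good_mono N' N1 N1' d : (N1 <= N1')%N -> good N' N1 d -> good N' N1' d.
Proof.
move=> NN h N2; have [M MP] := h N2; exists M => f x ff; apply: MP.
exact: far_le ff.
Qed.

Lemma stage_sequence (eps : nat -> R) : (forall s, 0 < eps s) ->
  exists N : nat -> nat, [/\ N 0%N = 0%N, forall s, (N s < N s.+1)%N,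
    forall a b, (a <= b)%N -> dual_split (N a) (N a.-1) (N b) (eps a) (N b.+1) &
    forall s, far_split (N s) (eps s.+1 / s.+2%:R) (N s.+1)].
Proof.
move=> eps0; pose P s n n' := [/\ (n < n')%N, good n n' (eps s.+1),
  forall a, (a < s.+1)%N -> forall n1, (n1 < n.+1)%N -> forall m, (m < n.+1)%N ->
    good m n1 (eps a) -> dual_split n1 m n (eps a) n' &
  far_split n (eps s.+1 / s.+2%:R) n'].
have next (sn : nat * nat) : exists n', P sn.1 sn.2 n'.
  case: sn => s n /=.
  have [N1 N1P] := good_ex n (eps0 s.+1).
  have [N2 N2P] : exists N2, far_split n (eps s.+1 / s.+2%:R) N2.
    by apply: farP; rewrite divr_gt0// ltr0n.
  have [N3 N3P] : exists N3, forall a, (a < s.+1)%N -> forall n1, (n1 < n.+1)%N ->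
      forall m, (m < n.+1)%N -> good m n1 (eps a) -> dual_split n1 m n (eps a) N3.
    apply: uniform_bound => [a M M' MM' h n1 n1n m mn gm|a _].
      exact: dual_split_mono MM' (h n1 n1n m mn gm).
    apply: uniform_bound => [n1 M M' MM' h m mn gm|n1 _].
      exact: dual_split_mono MM' (h m mn gm).
    apply: uniform_bound => [m M M' MM' h gm|m _]; first exact: dual_split_mono MM' (h gm).
    have [gm|ng] := pselect (good m n1 (eps a)); last by exists 0%N.
    by have [M MP] := gm n; exists M.
  exists (maxn (maxn n.+1 N1) (maxn N2 N3)); split.
  - by rewrite !leq_max leqnn.
  - by apply: good_mono N1P; rewrite !leq_max leqnn orbT.
  - move=> a as_ n1 n1n m mn gm; apply: dual_split_mono (N3P a as_ n1 n1n m mn gm).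
    by rewrite !leq_max leqnn !orbT.
  - by move=> v x fv; apply: N2P; apply: far_le fv; rewrite !leq_max leqnn !orbT.
have [F FP] := choice next.
pose N := fix N s := if s is t.+1 then F (t, N t) else 0%N.
have NP s : P s (N s) (N s.+1) by exact: (FP (s, N s)).
have Nlt s : (N s < N s.+1)%N by case: (NP s).
have Nmono : {homo N : a b / (a <= b)%N}.
  by apply: homo_leq => // [|n]; [exact: leq_trans|exact: ltnW].
have Ngood s : good (N s.-1) (N s) (eps s).
  by case: s => [|s]; [exact: good0|case: (NP s)].
exists N; split => // [a b ab|s]; last by case: (NP s).
have [_ _ h _] := NP b; apply: h => //; rewrite ltnS ?Nmono//.
by rewrite (leq_trans _ ab)// leq_pred.
Qed.

Variables (eps : nat -> R) (N : nat -> nat).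
Hypotheses (eps0 : forall s, 0 < eps s) (eps_anti : forall a b, (a <= b)%N -> eps b <= eps a)
  (N0 : N 0%N = 0%N) (Nlt : forall s, (N s < N s.+1)%N)
  (Nsplit : forall a b, (a <= b)%N -> dual_split (N a) (N a.-1) (N b) (eps a) (N b.+1))
  (Nfar : forall s, far_split (N s) (eps s.+1 / s.+2%:R) (N s.+1)).

Let Nmono : {homo N : a b / (a <= b)%N}.
Proof. by apply: homo_leq => // [|n]; [exact: leq_trans|exact: ltnW]. Qed.

Lemma upper_estimate (tau theta : nat -> nat) :
  (forall j, (j <= tau j)%N) -> (forall j, (tau j <= tau j.+1)%N) ->
  (forall j, (tau j < theta j.+1)%N) -> forall J x, `|x| <= 1 ->
  \sum_(j < J) mu e g (N (tau j)) (N (theta j)) x `^ p <= `|x| `^ p + \sum_(j < J) eps j.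
Proof.
move=> jtau tauS tautheta; elim=> [|J IHJ] x x1.
  by rewrite !big_ord0 addr0 powR_ge0.
have taumono : {homo tau : a b / (a <= b)%N}.
  by apply: homo_leq => // n; exact: leq_trans.
have [mu0|[i [iN fi muE]]] := mu_ex e g (N (tau J)) (N (theta J)) x.
  rewrite [leLHS]big_ord_recr/= mu0 powR0 ?gt_eqF// addr0 (le_trans (IHJ x x1))//.
  by rewrite lerD2l big_ord_recr/= lerDl ltW.
case: J IHJ iN fi muE => [|J] IHJ iN fi muE.
  rewrite !big_ord_recr !big_ord0 /= !add0r; apply: (@le_trans _ _ (`|x| `^ p)).
    by rewrite powR_le ?(ltW p0) ?mu_ge0// mu_le_norm.
  by rewrite lerDl ltW.
have fi' : far e (N (tau J).+1) (g i) by apply: far_le fi; exact/Nmono/tautheta.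
set t := tau J in fi'; pose d := eps t.+1 / t.+2%:R.
have d0 : 0 < d by rewrite divr_gt0// ltr0n.
have [y [y1 yg yx]] := Nfar fi' x1; rewrite -/d in yg yx.
have muy j : (j < J.+1)%N -> mu e g (N (tau j)) (N (theta j)) x `^ p <=
    mu e g (N (tau j)) (N (theta j)) y `^ p + d.
  move=> jJ; have [->|[k [kN fk ->]]] := mu_ex e g (N (tau j)) (N (theta j)) x.
    by rewrite powR0 ?gt_eqF// addr_ge0 ?powR_ge0// ltW.
  apply: le_trans (yg k _) _; first by rewrite (leq_trans kN)//; exact/Nmono/taumono.
  by rewrite lerD2r powR_le ?(ltW p0)//; exact: mu_ge.
rewrite [leLHS]big_ord_recr/= muE.
have h1 : \sum_(j < J.+1) mu e g (N (tau j)) (N (theta j)) x `^ p <=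
    \sum_(j < J.+1) mu e g (N (tau j)) (N (theta j)) y `^ p + J.+1%:R * d.
  apply: (@le_trans _ _ (\sum_(j < J.+1) (mu e g (N (tau j)) (N (theta j)) y `^ p + d))).
    by apply: ler_sum => j _; exact: muy.
  by rewrite big_split/= sumr_const card_ord mulr_natl.
have h2 := IHJ y y1.
have h3 : J.+1%:R * d + d <= eps J.+1.
  have -> : J.+1%:R * d + d = eps t.+1 * (J.+2%:R / t.+2%:R).
    by rewrite [RHS]mulrCA -/d -[J.+2%:R]natr1 mulrDl mul1r.
  apply: (@le_trans _ _ (eps t.+1)); last by apply: eps_anti; rewrite ltnS jtau.
  by rewrite ler_piMr ?(ltW (eps0 _))// ler_pdivrMr ?ltr0n// mul1r ler_nat !ltnS jtau.
rewrite [X in _ <= _ + X]big_ord_recr/=.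
by move: h1 h2 h3 yx; rewrite /=; lra.
Qed.

Variables (K : nat).
Hypothesis K3 : (3 < K)%N.

(* The cut points congruent to r modulo K split the line into alternating
   pieces: [start c, c] before the cut c, and the short piece [c, c + 3]. *)
Definition start c : nat := if (c < K)%N then 0%N else (c + 3 - K)%N.
Definition mid c x := mu e g (N c.+1) (N (start c).-1) x.
Definition zone c x := mu e g (N (c + 3).+1) (N c.-1) x.

Let start_add c : start (c + K) = (c + 3)%N.
Proof. by rewrite /start ltnNge leq_addl /= addnAC addnK. Qed.

Let start_le c : (start c <= c)%N.
Proof. by rewrite /start; case: ifP => // _; rewrite leq_subLR addnC leq_add2r ltnW. Qed.

Lemma start_ge r m : (m <= start (r + m * K))%N.
Proof.
case: m => // m; rewrite mulSn addnCA addnC start_add addn3 ltnS.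
apply: (@leq_trans (r + m * K)%N); last by rewrite -addn2 leq_addr.
by rewrite (leq_trans _ (leq_addl _ _))// leq_pmulr// (ltn_trans _ K3).
Qed.

Lemma mid_upper m x : `|x| <= 1 ->
  \sum_(c < m * K) mid c x `^ p <= K%:R * (`|x| `^ p + \sum_(j < m) eps j).
Proof.
move=> x1; rewrite (sum_residues (fun c => mid c x `^ p)).
rewrite -[K%:R]/(K%:R : R) mulr_natl -[X in _ *+ X]card_ord -sumr_const; apply: ler_sum => r _.
apply: (@upper_estimate (fun j => (r + j * K).+1) (fun j => (start (r + j * K)).-1)) => // j.
- by rewrite (leq_trans (leq_pmulr j (ltn_trans _ K3)))// (leq_trans (leq_addl r _)).
- by rewrite ltnS leq_add2l leq_mul2r leqnSn orbT.
- by rewrite mulSn [(K + _)%N]addnC addnA start_add !addnS addn0.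
Qed.

Lemma zone_upper m x : `|x| <= 1 ->
  \sum_(c < m * 6) zone c x `^ p <= 6 * (`|x| `^ p + \sum_(j < m) eps j).
Proof.
move=> x1; rewrite (sum_residues (fun c => zone c x `^ p)).
rewrite mulr_natl -[X in _ *+ X]card_ord -sumr_const; apply: ler_sum => r _.
apply: (@upper_estimate (fun j => (r + j * 6 + 3).+1) (fun j => (r + j * 6).-1)) => // j.
- by rewrite -addnS (leq_trans _ (leq_addr _ _))// (leq_trans (leq_pmulr j _) (leq_addl r _)).
- by rewrite ltnS leq_add2r leq_add2l leq_mul2r leqnSn orbT.
- by rewrite mulSn [(6 + _)%N]addnC addnA !addnS.
Qed.

Lemma lower_chain r m f x : (r < K)%N -> dball 1 f -> `|x| <= 1 -> exists v,
  far e (N (start (r + m * K))) v /\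
  `|f x| `^ p <= \sum_(i < m) (mid (r + i * K) x `^ p + zone (r + i * K) x `^ p) +
    `|v x| `^ p + 2 * \sum_(i < m) eps i.
Proof.
move=> rK df x1; elim: m => [|m [v [fv vP]]].
  exists f; rewrite /start mul0n addn0 rK N0; split; first by split.
  by rewrite !big_ord0 mulr0 addr0 add0r.
set c := (r + m * K)%N in fv vP.
have [w [fw wP]] := Nsplit (start_le c) fv x1.
have [z [fz zP]] := Nsplit (leq_addr 3 c) fw x1.
have cS : (r + m.+1 * K)%N = (c + K)%N by rewrite mulSn addnCA addnC.
exists z; rewrite cS start_add; split => //.
rewrite !big_ord_recr/= -/c.
have e1 : eps (start c) <= eps m.
  by apply: eps_anti; exact: start_ge.
have e2 : eps c <= eps m.
  apply: eps_anti; rewrite /c (leq_trans _ (leq_addl _ _))// leq_pmulr//.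
  exact: ltn_trans K3.
by move: vP wP zP; rewrite -/(mid c x) -/(zone c x); lra.
Qed.

End stages.

Lemma psum_mono (R : numDomainType) (F : nat -> R) m n : (forall i, 0 <= F i) -> (m <= n)%N ->
  \sum_(i < m) F i <= \sum_(i < n) F i.
Proof.
move=> F0 /subnKC <-; elim: (n - m)%N => [|k IHk]; first by rewrite addn0.
by rewrite addnS big_ord_recr/= (le_trans IHk)// lerDl.
Qed.

Section row_norm.
Context {R : realType} {n : nat}.
Implicit Types v : 'rV[R]_n.

Lemma row_coord_le v i : `|v ord0 i| <= `|v|.
Proof.
have -> : `|v| = mx_norm v by []; rewrite mx_normrE; apply/bigmax_geP; right => /=.
by exists (ord0, i).
Qed.

Lemma row_norm_le v (c : R) : 0 <= c -> (forall i, `|v ord0 i| <= c) -> `|v| <= c.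
Proof.
move=> c0 h; have -> : `|v| = mx_norm v by []; rewrite mx_normrE; apply/bigmax_leP; split => // -[i j] _ /=.
by rewrite (ord1 i).
Qed.

End row_norm.

Section main_estimate.
Context {R : realType} {X : completeNormedModType R} (p : R) (p1 : 1 < p).
Hypotheses (Xm : mprop X p) (nl1 : ~ contains_l1 X) (Xsep : separable_space X).

Let p0 : 0 < p. Proof. exact: lt_trans p1. Qed.

Definition coords (M : nat -> nat) (G : nat -> nat -> X -> R) (c : nat) (x : X) :
  'rV[R]_(M c) := \row_(i < M c) G c i x.

Lemma coords_norm_estimate (d : R) : 0 < d -> d <= 1 ->
  exists (M : nat -> nat) (G : nat -> nat -> X -> R) (K : R),
  [/\ 0 < K, forall c, (M c < M c.+1)%N, forall c i, dball 1 (G c i),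
      forall x n, \sum_(c < n) `|coords M G c x| `^ p <= K * (1 + d) * `|x| `^ p &
      forall x, exists n, K * (1 - d) * `|x| `^ p <= \sum_(c < n) `|coords M G c x| `^ p].
Proof.
move=> d0 d1; have [e ed] := separable_sequence Xsep.
have [g [gb gd]] := dual_separable p1 Xm nl1 ed.
have [U [UF Uoo]] := ultraFilterLemma (eventually_filter : ProperFilter \oo).
have wl := weak_ulim p1 Xm nl1 gb gd UF.
have nl := mprop_ulim p1 Xm gb gd UF.
have split := dual_splitting p1 UF Uoo wl nl e gb gd.
have farP (m : nat) (r : R) : 0 < r -> exists N, far_split p e g m r N.
  by move=> r0; exact (far_splitting p1 UF Uoo wl nl m ed gb r0).
pose eps (s : nat) : R := d / 8 / 2 ^+ s.+1.
have eps0 s : 0 < eps s by rewrite !divr_gt0// exprn_gt0.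
have eps_anti a b : (a <= b)%N -> eps b <= eps a.
  move=> ab; rewrite /eps ler_pM2l ?divr_gt0// lef_pV2 ?posrE ?exprn_gt0//.
  by rewrite ler_weXn2l// ler1n.
have eps_sum m : \sum_(s < m) eps s <= d / 8.
  suff -> : \sum_(s < m) eps s = d / 8 - d / 8 / 2 ^+ m.
    by rewrite lerBlDr lerDl !divr_ge0 ?exprn_ge0// ltW.
  elim: m => [|m IHm]; first by rewrite big_ord0 expr0 divr1 subrr.
  by rewrite big_ord_recr/= IHm /eps exprS invfM; lra.
have [N [N0 Nlt Nsplit Nfar]] := stage_sequence p1 split farP eps0.
have Nid s : (s <= N s)%N.
  by elim: s => // s IHs; exact: leq_ltn_trans (Nlt s).
pose K := (Num.truncn (12 / d)).+4.
have K3 : (3 < K)%N by [].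
have Kd : 12 / d < K%:R.
  by rewrite (lt_le_trans (truncnS_gt _))// ler_nat; exact: (leq_addl 3).
have Kpos : 0 < K%:R :> R by rewrite ltr0n.
pose M c := N c.+1.
pose G c i : X -> R := if `[< far e (N (start K c).-1) (g i) >] then g i else fun=> 0.
have Gb c i : dball 1 (G c i).
  by rewrite /G; case: asboolP => // _; exact: dball_zero.
have GE c x : `|coords M G c x| = mid e g N K c x.
  apply/eqP; rewrite eq_le; apply/andP; split.
    apply: row_norm_le => [|i]; first exact: mu_ge0.
    rewrite mxE /G; case: asboolP => fi; last by rewrite normr0 mu_ge0.
    exact: mu_ge.
  apply: mu_le => // i iM fi; have := row_coord_le (coords M G c x) (Ordinal iM).
  by rewrite mxE /G/=; case: asboolP.
have coordsZ c a x : `|coords M G c (a *: x)| = `|a| * `|coords M G c x|.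
  rewrite -normrZ; congr (`|_|); apply/rowP => i; rewrite !mxE.
  by rewrite (lfunZ _ _ (Gb c i).1).
have sumZ n a x : \sum_(c < n) `|coords M G c (a *: x)| `^ p =
    `|a| `^ p * \sum_(c < n) `|coords M G c x| `^ p.
  by rewrite mulr_sumr; apply: eq_bigr => c _; rewrite coordsZ powRM.
have up x n : `|x| = 1 -> \sum_(c < n) `|coords M G c x| `^ p <= K%:R * (1 + d).
  move=> x1; apply: (@le_trans _ _ (\sum_(c < n * K) mid e g N K c x `^ p)).
    rewrite [leLHS](eq_bigr (fun c : 'I_n => mid e g N K c x `^ p)).
      apply: (psum_mono (F := fun c => mid e g N K c x `^ p)) => [c|].
        exact: powR_ge0.
      by rewrite leq_pmulr.
    by move=> c _; rewrite GE.
  have x1' : `|x| <= 1 by rewrite x1.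
  apply: le_trans (mid_upper p1 eps0 eps_anti Nlt Nfar K3 n x1') _.
  rewrite x1 powR1 ler_pM2l// lerD2l (le_trans (eps_sum n))//; lra.
have low x : `|x| = 1 -> exists n, K%:R * (1 - d) <= \sum_(c < n) `|coords M G c x| `^ p.
  move=> x1; have x1' : `|x| <= 1 by rewrite x1.
  have [f [df fx]] := norming x.
  pose h := (d / 8) `^ p^-1.
  have h0 : 0 < h by rewrite powR_gt0// divr_gt0.
  have [m mP] : exists m, forall v k, (m <= k)%N -> far e k v -> `|v x| <= h.
    apply: contrapT => no.
    have ex m : exists v, far e m v /\ h < `|v x|.
      apply: contrapT => nv; apply: no; exists m => v k mk fv.
      rewrite leNgt; apply/negP => hv; apply: nv; exists v; split => //.
      exact: far_le fv.
    have [v vP] := choice ex.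
    have vx : v n x @[n --> \oo] --> (0 : R) by apply: (far_cvg0 ed) => n; case: (vP n).
    have /cvgrPdist_le/(_ _ h0)[m _ /(_ m (leqnn m))] := vx.
    by rewrite /= sub0r normrN; have [_] := vP m; lra.
  exists (m * K)%N.
  have chain (r : 'I_K) : 1 <= \sum_(i < m) (mid e g N K (r + i * K) x `^ p +
      zone e g N (r + i * K) x `^ p) + d / 8 + 2 * (d / 8).
    have [v [fv vP]] := lower_chain eps_anti N0 Nsplit K3 m (ltn_ord r) df x1'.
    move: vP; rewrite fx x1 normr1 powR1 => vP; have := eps_sum m.
    have : `|v x| `^ p <= d / 8.
      rewrite -(powR_rootV p0 (_ : 0 <= d / 8)) ?divr_ge0 ?(ltW d0)//.
      apply: powR_le => //; first exact: ltW.
      apply: mP fv; rewrite (leq_trans (start_ge K3 r m))//; exact: Nid.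
    by lra.
  have tot : K%:R <= \sum_(c < m * K) (mid e g N K c x `^ p + zone e g N c x `^ p) +
      K%:R * (d / 8 + 2 * (d / 8)).
    rewrite (sum_residues (fun c => mid e g N K c x `^ p + zone e g N c x `^ p)).
    have -> : K%:R = \sum_(r < K) (1 : R) by rewrite sumr_const card_ord.
    rewrite [X in _ + X]mulr_suml -big_split/=; apply: ler_sum => r _.
    by have := chain r; rewrite mul1r addrA.
  have zon : \sum_(c < m * K) zone e g N c x `^ p <= 6 * (1 + d / 8).
    apply: (@le_trans _ _ (\sum_(c < (m * K) * 6) zone e g N c x `^ p)).
      apply: (psum_mono (F := fun c => zone e g N c x `^ p)) => [c|].
        exact: powR_ge0.
      by rewrite leq_pmulr.
    apply: le_trans (zone_upper p1 eps0 eps_anti Nlt Nfar (m * K) x1') _.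
    by rewrite x1 powR1 ler_pM2l// lerD2l.
  rewrite (eq_bigr (fun c : 'I_(m * K) => mid e g N K c x `^ p)); last by move=> c _; rewrite GE.
  have Kd' : 12 < K%:R * d by rewrite -ltr_pdivrMr.
  by move: tot zon; rewrite big_split/=; lra.
have nz (x : X) : x != 0 -> x = `|x| *: (`|x|^-1 *: x) /\ `| `|x|^-1 *: x| = 1.
  move=> x0; have nx : `|x| != 0 by rewrite normr_eq0.
  by rewrite scalerA mulfV// scale1r normrZ normfV normr_id mulVf.
exists M, G, K%:R; split => //.
- by move=> c; exact: Nlt.
- move=> x n; have [->|x0] := eqVneq x 0.
    have := sumZ n 0 (0 : X).
    rewrite scale0r normr0 powR0 ?gt_eqF// mul0r => ->.
    by rewrite normr0 powR0 ?gt_eqF// mulr0.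
  have [xE nx] := nz x x0; rewrite {1}xE sumZ normr_id mulrC ler_wpM2r ?powR_ge0//.
  exact: up.
- move=> x; have [->|x0] := eqVneq x 0.
    exists 0%N; rewrite normr0 powR0 ?gt_eqF// mulr0; exact: sumr_ge0.
  have [xE nx] := nz x x0; have [n nP] := low _ nx; exists n.
  rewrite [x in leRHS]xE sumZ normr_id mulrC ler_wpM2l ?powR_ge0//.
Qed.

End main_estimate.

(** * Embedding into C_p *)

Section operator_norms.
Context {R : realType} {V W : normedModType R}.
Implicit Types T : {linear V -> W}.

Lemma op_norm_le T (C : R) : 0 <= C -> (forall x, `|T x| <= C * `|x|) -> (op_norm T <= C%:E)%E.
Proof.
move=> C0 TC; apply: ge_ereal_sup => _ [x /= x1 <-]; rewrite lee_fin (le_trans (TC x))//.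
by rewrite ler_piMr.
Qed.

Lemma op_norm_ex T : continuous T -> exists A : R,
  [/\ 0 <= A, op_norm T = A%:E & forall x, `|T x| <= A * `|x|].
Proof.
move=> /linear_bounded_continuous/linear_boundedP.
move=> /(filterI (nbhs_pinfty_ge (num_real 0))) /pinfty_ex_gt0 [C C0 [_ TC]].
have := op_norm_le (ltW C0) TC.
have Tle x : `|x| <= 1 -> (`|T x|%:E <= op_norm T)%E.
  by move=> x1; apply: ereal_sup_ubound; exists x.
have : (0 <= op_norm T)%E.
  by apply: le_trans (Tle 0 _); rewrite ?normr0// lee_fin.
move: Tle; case: (op_norm T) => [A Tle|//|//]; rewrite !lee_fin => A0 AC.
exists A; split => // x; have [->|x0] := eqVneq x 0; first by rewrite linear0 !normr0 mulr0.
have nx : 0 < `|x| by rewrite normr_gt0.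
have := Tle (`|x|^-1 *: x); rewrite linearZ !normrZ normfV normr_id lee_fin mulVf ?gt_eqF//.
by move=> /(_ (lexx _)); rewrite ler_pdivrMl// mulrC.
Qed.

End operator_norms.

Section finite_dimension.
Context {R : realType}.

HB.instance Definition _ m n := Complete.copy 'M[R]_(m, n) 'M[R^o]_(m, n).

Lemma row_finite_dim n : finite_dim 'rV[R]_n.
Proof.
exists n, (fun i => delta_mx 0 i) => v; exists (fun i => v 0 i).
exact: row_sum_delta.
Qed.

Lemma row_linear_inj a b (f : {linear 'rV[R]_a -> 'rV[R]_b}) : injective f -> (a <= b)%N.
Proof.
move=> fi; have : row_free (lin1_mx f).
  apply: inj_row_free => v; rewrite mul_rV_lin1 => fv; apply: fi; by rewrite fv linear0.
by rewrite -row_leq_rank => /leq_trans; apply; exact: rank_leq_col.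
Qed.

Lemma row_embedding (E : nat -> completeNormedModType R) (m : nat) (e : R) :
  bm_dense E -> 0 < e -> exists n (J : {linear 'rV[R]_m -> E n}) (T : {linear E n -> 'rV[R]_m}),
  injective T /\ forall v, `|v| <= `|J v| <= (1 + e) * `|v|.
Proof.
move=> dE e0; have [n] := dE _ (row_finite_dim m) e e0.
move=> /ereal_inf_lt[_ [T [S [[Tc Sc TS ST] ->]]]].
have [A [A0 -> TA]] := op_norm_ex Tc; have [B [B0 -> SB]] := op_norm_ex Sc.
rewrite -EFinM lte_fin => ABe; exists n, (A \*: S), T; split; first exact: can_inj TS.
move=> v; rewrite /= normrZ ger0_norm//; apply/andP; split; first by rewrite -{1}(ST v).
rewrite (le_trans (ler_wpM2l A0 (SB v)))// mulrA ler_wpM2r//; exact: ltW.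
Qed.

End finite_dimension.

Lemma psum_inj (R : numDomainType) (F : nat -> R) (P : pred nat) (h : nat -> nat) N :
  (forall i, 0 <= F i) -> {in P &, injective h} ->
  exists n, \sum_(i < N | P i) F (h i) <= \sum_(i < n) F i.
Proof.
move=> F0 hi; pose n := \max_(i < N) h i; exists n.+1.
pose h' (i : 'I_N) : 'I_n.+1 := inord (h i).
have hE i : h' i = h i :> nat by rewrite inordK// ltnS (leq_bigmax i).
rewrite (eq_bigr (fun i => F (h' i))) => [|i _]; last by rewrite hE.
rewrite -(big_imset (fun i : 'I_n.+1 => F i)) => [|i j Pi Pj /(congr1 val)]; last first.
  by rewrite /= !hE => /hi ij; apply/val_inj/ij.
by rewrite big_mkcond/=; apply: ler_sum => i _; case: ifP.
Qed.

Section embedding.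
Context {R : realType} (p : R) (p1 : 1 < p).

Let p0 : 0 < p. Proof. exact: lt_trans p1. Qed.

Variables (E : nat -> completeNormedModType R) (X : completeNormedModType R).
Variables (M : nat -> nat) (L : forall c, {linear X -> 'rV[R]_(M c)}) (lo hi : R).
Hypotheses (dE : bm_dense E) (Mlt : forall c, (M c < M c.+1)%N) (lo0 : 0 < lo) (hi0 : 0 <= hi)
  (L_hi : forall x n, \sum_(c < n) `|L c x| `^ p <= (hi * `|x|) `^ p)
  (L_lo : forall x, exists n, (lo * `|x|) `^ p <= \sum_(c < n) `|L c x| `^ p).

(* The blocks have distinct dimensions, so they land in distinct summands. *)
Lemma lp_embedding (e : R) : 0 < e -> exists T : {linear X -> C_ p1 E},
  forall x, lo * `|x| <= `|T x| <= (1 + e) * hi * `|x|.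
Proof.
move=> e0; have e1 : 0 <= 1 + e by rewrite addr_ge0// ltW.
have H c := row_embedding (M c) dE e0; pose idx c := projT1 (cid (H c)).
have HJ c : exists (J : {linear 'rV[R]_(M c) -> E (idx c)})
    (T : {linear E (idx c) -> 'rV[R]_(M c)}),
    injective T /\ forall v, `|v| <= `|J v| <= (1 + e) * `|v|.
  exact: (projT2 (cid (H c))).
have Minc : {homo M : i j / (i < j)%N} by apply: homo_ltn => //; exact: ltn_trans.
have idx_le c c' : idx c = idx c' -> (M c <= M c')%N.
  move=> cc'; have [J [_ [_ JP]]] := HJ c; have [_ [T [Ti _]]] := HJ c'.
  rewrite -cc' in T Ti.
  apply: (@row_linear_inj _ _ _ (T \o J)) => u v /= /Ti Juv; apply/eqP.
  rewrite -subr_eq0 -normr_le0; have /andP[+ _] := JP (u - v).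
  by rewrite linearB Juv subrr normr0.
have idx_inj : injective idx.
  move=> c c' cc'; have := idx_le _ _ cc'; have := idx_le _ _ (esym cc').
  by have [/Minc|/Minc|//] := ltngtP c c'; rewrite ltnNge idx_le.
have HF n : exists f : X -> E n, [/\ linear f, (forall c, idx c = n -> forall x,
    `|L c x| <= `|f x| <= (1 + e) * `|L c x|) &
    (forall c, idx c <> n) -> forall x, f x = 0].
  have [[c <-]|nc] := pselect (exists c, idx c = n).
    have [J [_ [_ JP]]] := HJ c; exists (J \o L c); split; first exact: linearP.
      by move=> c' /idx_inj -> x; exact: JP.
    by move=> /(_ c).
  exists (fun=> 0); split => //; first by move=> a x y; rewrite scaler0 addr0.
  by move=> c cn; case: nc; exists c.
pose f n := projT1 (cid (HF n)).
have fP n : [/\ linear (f n), (forall c, idx c = n -> forall x,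
    `|L c x| <= `|f n x| <= (1 + e) * `|L c x|) &
    (forall c, idx c <> n) -> forall x, f n x = 0] by exact: (projT2 (cid (HF n))).
have inv n : exists c, (exists c', idx c' = n) -> idx c = n.
  have [[c <-]|nc] := pselect (exists c, idx c = n); first by exists c.
  by exists 0%N => cn.
have [k kP] := choice inv.
have f_hi x N : \sum_(n < N) `|f n x| `^ p <= ((1 + e) * hi * `|x|) `^ p.
  pose Q n := `[< exists c, idx c = n >].
  have [n nP] : exists n, \sum_(i < N | Q i) `|L (k i) x| `^ p <= \sum_(c < n) `|L c x| `^ p.
    apply: (psum_inj (F := fun c => `|L c x| `^ p)) => [c|i j /asboolP Qi /asboolP Qj kij].
      exact: powR_ge0.
    by rewrite -(kP i Qi) -(kP j Qj) kij.
  apply: (@le_trans _ _ ((1 + e) `^ p * \sum_(i < N | Q i) `|L (k i) x| `^ p)).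
    rewrite mulr_sumr [leRHS]big_mkcond/=; apply: ler_sum => i _; case: ifPn => [/asboolP Qi|/asboolP Qi].
      have [_ /(_ _ (kP i Qi) x)/andP[_ fx] _] := fP i.
      by rewrite -powRM//; apply: powR_le => //; exact: ltW.
    have [_ _ ->] := fP i; first by rewrite normr0 powR0 ?gt_eqF.
    by move=> c ci; apply: Qi; exists c.
  rewrite -mulrA powRM ?mulr_ge0// ler_wpM2l ?powR_ge0//.
  exact: le_trans nP (L_hi x n).
pose T0 x : C_ p1 E := @LpSum _ _ (ltW p1) _ (fun n => f n x) (@lp_mem R p (fun n => E n) (fun n => f n x) _ (f_hi x)).
have T0l : linear T0.
  by move=> a x y; apply: lp_sumP => n /=; have [fl _ _] := fP n; rewrite fl.
pose T : {linear X -> C_ p1 E} := HB.pack T0 (GRing.isLinear.Build _ _ _ _ _ T0l).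
exists T => x; apply/andP; split; last first.
  rewrite -(powR_leE p0) ?mulr_ge0//; apply: lp_norm_le => N; exact: f_hi.
rewrite -(powR_leE p0) ?mulr_ge0 ?(ltW lo0)//; have [n nP] := L_lo x; apply: le_trans nP _.
have [N NP] := @psum_inj _ (fun i => `|f i x| `^ p) xpredT idx n (fun i => powR_ge0 _ _)
  (fun i j _ _ => @idx_inj i j).
apply: le_trans (lp_psum_le (T x) N); apply: le_trans NP; apply: ler_sum => c _.
have [_ /(_ _ erefl x)/andP[fx _] _] := fP (idx c).
by apply: powR_le => //; exact: ltW.
Qed.

End embedding.

Lemma mprop_embedding (R : realType) (E : nat -> completeNormedModType R) (p : R) (p1 : 1 < p)
    (X : completeNormedModType R) (e : R) :
  bm_dense E -> mprop X p -> ~ contains_l1 X -> separable_space X -> 0 < e ->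
  exists X0 : submodClosed (C_ p1 E), closed [set x | x \in X0] /\
    (bm_dist X (subnormed X0) < (1 + e)%:E)%E.
Proof.
move=> dE Xm nl1 Xsep e0; have p0 : 0 < p by exact: lt_trans p1.
pose d := Num.min (2^-1) (e / 8).
have d0 : 0 < d by rewrite lt_min invr_gt0 ltr0n divr_gt0.
have d2 : d <= 2^-1 by rewrite ge_min lexx.
have de : d <= e / 8 by rewrite ge_min lexx orbT.
have d1 : d <= 1 by lra.
have [M [G [K [K0 Mlt Gb Lhi Llo]]]] := coords_norm_estimate p1 Xm nl1 Xsep d0 d1.
pose s := (K^-1) `^ p^-1.
have s0 : 0 <= s by exact: powR_ge0.
have sK : s `^ p = K^-1 by rewrite powR_rootV// invr_ge0 ltW.
have Ll c : linear (fun x => s *: coords M G c x).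
  move=> a x y; rewrite !scalerA mulrC -scalerA -scalerDr; congr (_ *: _).
  by apply/rowP => i; rewrite !mxE (Gb c i).1.
pose L c : {linear X -> 'rV[R]_(M c)} := HB.pack (fun x => s *: coords M G c x)
  (GRing.isLinear.Build _ _ _ _ _ (Ll c)).
have LE x n : \sum_(c < n) `|L c x| `^ p = K^-1 * \sum_(c < n) `|coords M G c x| `^ p.
  by rewrite mulr_sumr; apply: eq_bigr => c _; rewrite /= normrZ powRM// (ger0_norm s0) sK.
have hiP x n : \sum_(c < n) `|L c x| `^ p <= ((1 + d) * `|x|) `^ p.
  rewrite LE ler_pdivrMl// (le_trans (Lhi x n))// -mulrA ler_pM2l// powRM ?addr_ge0 ?(ltW d0)//.
  by rewrite ler_wpM2r ?powR_ge0// le1r_powR// ?(ltW p1)// lerDl ltW.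
have loP x : exists n, ((1 - d) * `|x|) `^ p <= \sum_(c < n) `|L c x| `^ p.
  have [n nP] := Llo x; exists n; rewrite LE ler_pdivlMl//; apply: le_trans nP.
  rewrite -mulrA ler_pM2l// powRM ?subr_ge0// ler_wpM2r ?powR_ge0//.
  by apply: ge1r_powR; [lra|exact: ltW].
have lo0 : 0 < 1 - d by lra.
have hi0 : 0 <= 1 + d by lra.
have [T TP] := lp_embedding p1 dE Mlt lo0 hi0 hiP loP d0.
have T1 x : (1 - d) * `|x| <= `|T x| by have /andP[] := TP x.
have T2 x : `|T x| <= (1 + d) * (1 + d) * `|x| by have /andP[] := TP x.
have [Z [T' [S' [Zc iso TE]]]] := range_isomorphism lo0 T1 T2 (complete_seq_complete (V := X)).
exists Z; split => //.
have nT' x : `|T' x| = `|T x| by rewrite -TE.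
apply: (@le_lt_trans _ _ (op_norm T' * op_norm S')%E).
  by apply: ereal_inf_lbound; exists T', S'.
have hT : (op_norm T' <= ((1 + d) * (1 + d))%:E)%E.
  by apply: op_norm_le => [|x]; [rewrite mulr_ge0|rewrite nT'].
have hS : (op_norm S' <= ((1 - d)^-1)%:E)%E.
  apply: op_norm_le => [|z]; first by rewrite invr_ge0 ltW.
  by rewrite ler_pdivlMl// (le_trans (T1 _))// -nT'; case: iso => _ _ _ ->.
apply: (@le_lt_trans _ _ (((1 + d) * (1 + d))%:E * ((1 - d)^-1)%:E)%E).
  apply: lee_pmul => //; first by apply: ereal_sup_ubound; exists 0; rewrite /= ?normr0 ?linear0 ?normr0.
  by apply: ereal_sup_ubound; exists 0; rewrite /= ?normr0 ?linear0 ?normr0.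
rewrite -EFinM lte_fin ltr_pdivrMr//; nra.
Qed.

(** * The converse *)

Section finite_rank.
Context {R : realType} {V : normedModType R}.

(* P is extended to a new vector b by P + h(.) (b - P b), where h is a norming
   functional of b - P b made to vanish on the range of P. *)
Lemma weak_strong_projection (s : seq V) : exists (P : V -> V) (K : R),
  [/\ 0 <= K, forall a x y, P (a *: x + y) = a *: P x + P y, forall x, P (P x) = P x,
      forall x, `|P x| <= K * `|x| &
      (forall v, v \in s -> P v = v) /\
      forall u, weak0 u -> P (u n) @[n --> \oo] --> (0 : V)].
Proof.
elim: s => [|b s [P [K [K0 Pl PP PK [Ps Pw]]]]].
  exists (fun=> 0), 0; split => //; first by move=> a x y; rewrite scaler0 addr0.
    by move=> x; rewrite normr0 mul0r.
  split => // u _; exact: cvg_cst.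
have [r rE] : exists r, r = b - P b by exists (b - P b).
have [r0|r0] := eqVneq r 0.
  exists P, K; split => //; split => // v; rewrite inE => /predU1P[->|]; last exact: Ps.
  by apply/eqP; rewrite eq_sym -subr_eq0 -rE r0.
have nr : 0 < `|r| by rewrite normr_gt0.
have PB x y : P (x - y) = P x - P y.
  by rewrite addrC -scaleN1r Pl scaleN1r addrC.
have P0 : P 0 = 0 by have := PB 0 0; rewrite !subrr.
have [f [df fr]] := norming r; pose h x : R := `|r|^-1 * f (x - P x).
have hl a x y : h (a *: x + y) = a * h x + h y.
  rewrite /h Pl opprD addrACA -scalerBr df.1; lra.
have hK x : `|h x| <= `|r|^-1 * (1 + K) * `|x|.
  rewrite /h normrM ger0_norm ?invr_ge0// -mulrA ler_pM2l ?invr_gt0//.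
  rewrite (le_trans (df.2 _))// mul1r (le_trans (ler_normB _ _))// mulrDl mul1r lerD2l.
  exact: PK.
have hP x : h (P x) = 0 by rewrite /h PP subrr lfun0 ?mulr0//; exact: df.1.
have Pr : P r = 0 by rewrite rE PB PP subrr.
have hr : h r = 1 by rewrite /h Pr subr0 fr mulVf// gt_eqF.
have C0 : 0 < `|r|^-1 * (1 + K) by rewrite mulr_gt0 ?invr_gt0// ltr_pwDl.
exists (fun x => P x + h x *: r), (K + `|r|^-1 * (1 + K) * `|r|); split.
- by rewrite addr_ge0// mulr_ge0// ltW.
- by move=> a x y; rewrite Pl hl scalerDl scalerDr -scalerA addrACA.
- move=> x; have hPx : h (P x + h x *: r) = h x.
    by rewrite addrC hl hr mulr1 hP addr0.
  by rewrite hPx addrC (addrC (P x)) Pl Pr scaler0 add0r PP addrC.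
- move=> x; rewrite mulrDl (le_trans (ler_normD _ _))// lerD// normrZ mulrAC.
  by rewrite ler_wpM2r.
split=> [v|u wu].
  rewrite inE => /predU1P[->|vs].
    have -> : h b = 1 by rewrite /h -rE fr mulVf// gt_eqF.
    by rewrite scale1r rE addrC subrK.
  by rewrite /h (Ps v vs) subrr lfun0 ?mulr0 ?scale0r ?addr0//; exact: df.1.
rewrite -[0]addr0 -[X in _ + X](scale0r r); apply: cvgD; first exact: Pw.
apply: cvgZr_tmp.
have dh : dball (`|r|^-1 * (1 + K)) h by split.
have -> : (fun n => h (u n)) =
    (fun n => `|r|^-1 * (1 + K) * ((`|r|^-1 * (1 + K))^-1 * h (u n))).
  by apply/funext => n; rewrite mulrA mulfV ?mul1r// gt_eqF.
rewrite -[0](mulr0 (`|r|^-1 * (1 + K))); apply: cvgMl_tmp.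
exact: (wu _ (dball_inv C0 dh)).
Qed.

Lemma finite_dim_weak0 (u : nat -> V) : finite_dim V -> weak0 u -> u n @[n --> \oo] --> (0 : V).
Proof.
move=> [n [b bV]] wu; have [P [K [_ Pl _ _ [Pb Pw]]]] := weak_strong_projection (codom b).
have -> : u = P \o u; last exact: Pw.
have P0 : P 0 = 0 by have := Pl (-1) 0 0; rewrite scaler0 addr0 scaleN1r addNr.
apply/funext => k /=; have [c ->] := bV (u k).
elim/big_rec: _ => [|i x _ xP]; first by rewrite P0.
by rewrite Pl Pb ?codom_f// -xP.
Qed.

End finite_rank.

Section lp_property.
Context {R : realType} (p : R) (p1 : 1 <= p) (E : nat -> normedModType R).
Implicit Types (y z : lp_sum p1 E).

Let p0 : 0 < p. Proof. exact: lt_le_trans p1. Qed.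

Lemma head_psum_le N y : forall m,
  \sum_(k < m) `|if (k < N)%N then y k else 0| `^ p <= `|y| `^ p.
Proof.
move=> m; apply: le_trans (lp_psum_le y m); apply: ler_sum => k _.
by case: ifP => // _; rewrite normr0 powR0 ?gt_eqF ?powR_ge0.
Qed.

Definition head N y : lp_sum p1 E :=
  @LpSum _ _ p1 _ (fun k => if (k < N)%N then y k else 0) (lp_mem (head_psum_le N y)).

Definition tail N y := y - head N y.

Lemma head_tail_norm N y z : `|head N y + tail N z| `^ p = `|head N y| `^ p + `|tail N z| `^ p.
Proof.
have c1 := @lp_cvg _ _ p1 _ (head N y + tail N z).
have c2 : \sum_(n < m) `|(head N y + tail N z) n| `^ p @[m --> \oo] -->
    `|head N y| `^ p + `|tail N z| `^ p.
  have -> : (fun m => \sum_(n < m) `|(head N y + tail N z) n| `^ p) =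
      (fun m => \sum_(n < m) `|head N y n| `^ p + \sum_(n < m) `|tail N z n| `^ p).
    apply/funext => m; rewrite -big_split/=; apply: eq_bigr => k _.
    by case: ifP => _; rewrite ?subrr ?subr0 ?addr0 ?add0r normr0 powR0 ?gt_eqF// ?addr0 ?add0r.
  by apply: cvgD; exact: lp_cvg.
exact: cvg_unique c1 c2.
Qed.

Lemma head_norm N y : `|head N y| `^ p = \sum_(k < N) `|y k| `^ p.
Proof.
apply: le_anti; apply/andP; split; last first.
  apply: le_trans (lp_psum_le (head N y) N); apply: ler_sum => k _ /=.
  by rewrite ltn_ord.
apply: lp_norm_le => m; apply: (@le_trans _ _ (\sum_(k < N + m) `|head N y k| `^ p)).
  apply: (psum_mono (F := fun k => `|head N y k| `^ p)) => [k|]; first exact: powR_ge0.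
  exact: leq_addl.
rewrite big_split_ord/= [X in _ + X]big1 ?addr0.
  by apply: ler_sum => k _; rewrite ltn_ord.
by move=> k _; rewrite ltnNge leq_addr /= normr0 powR0// gt_eqF.
Qed.

Lemma tail_cvg y : `|tail N y| `^ p @[N --> \oo] --> (0 : R).
Proof.
have c : `|y| `^ p - \sum_(n < N) `|y n| `^ p @[N --> \oo] --> `|y| `^ p - `|y| `^ p.
  apply: cvgB; first exact: cvg_cst.
  exact: (@lp_cvg _ _ p1 _ y).
rewrite subrr in c; have -> : (fun N => `|tail N y| `^ p) =
    (fun N => `|y| `^ p - \sum_(n < N) `|y n| `^ p); last exact: c.
apply/funext => N; rewrite -head_norm; apply/eqP; rewrite eq_sym subr_eq addrC.
rewrite -head_tail_norm /tail addrCA subrr addr0; exact: eqxx.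
Qed.

Lemma head_cvg N (w : nat -> lp_sum p1 E) : (forall k, w n k @[n --> \oo] --> (0 : E k)) ->
  `|head N (w n)| `^ p @[n --> \oo] --> (0 : R).
Proof.
move=> w0; have hs : \sum_(k < N) `|w n k| `^ p @[n --> \oo] --> \sum_(k < N) (0 : R).
  apply: cvg_big => [|k _]; first exact: add_continuous.
  rewrite -(@powR0 R p) ?gt_eqF//; apply: cvg_powR => //.
  by rewrite -[0](@normr0 _ (E k)); apply: cvg_norm; exact: w0.
rewrite big1_eq in hs.
by under eq_fun do rewrite head_norm.
Qed.

End lp_property.

Section gliding_hump.
Context {R : realType} (p : R) (p0 : 0 < p) (V : normedModType R).

Lemma powR_uniform (L d : R) : 0 < d -> exists2 c, 0 < c & forall a b, 0 <= a -> 0 <= b ->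
  a <= L -> b <= L -> `|a - b| <= c -> `|a `^ p - b `^ p| <= d.
Proof.
move=> d0; have [c c0 cP] := powR_modulus L p0 d0; exists c => // a b a0 b0 aL bL.
rewrite !ler_norml => /andP[ab ba].
have h1 : b `^ p <= (a + c) `^ p by apply: powR_le => //; [exact: ltW|lra].
have h2 : a `^ p <= (b + c) `^ p by apply: powR_le => //; [exact: ltW|lra].
by move: (cP a a0 aL) (cP b b0 bL) => h3 h4; apply/andP; split; lra.
Qed.

Lemma gliding_hump (h t : nat -> V -> V) (y : V) (w : nat -> V) (C : R) :
  (forall N z, z = h N z + t N z) ->
  (forall N y z, `|h N y + t N z| `^ p = `|h N y| `^ p + `|t N z| `^ p) ->
  (forall n, `|w n| <= C) -> `|t N y| `^ p @[N --> \oo] --> (0 : R) ->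
  (forall N, `|h N (w n)| `^ p @[n --> \oo] --> (0 : R)) ->
  `|y + w n| `^ p - `|w n| `^ p @[n --> \oo] --> `|y| `^ p.
Proof.
have arith (a b W v yp h' t' d : R) : `|a - b| <= d / 3 -> `|W - v| <= d / 3 ->
    yp = h' + t' -> b = h' + v -> 0 <= t' -> t' <= d / 3 -> `|yp - (a - W)| <= d.
  by rewrite !ler_norml => /andP[? ?] /andP[? ?] *; apply/andP; split; lra.
move=> htE ht_norm wC t_cvg h_cvg.
have y_norm N z : `|z| `^ p = `|h N z| `^ p + `|t N z| `^ p by rewrite -ht_norm -htE.
have t_le N z : `|t N z| <= `|z|.
  by rewrite -(powR_leE p0)// (y_norm N z) lerDr powR_ge0.
have h_le N z : `|h N z| <= `|z|.
  by rewrite -(powR_leE p0)// (y_norm N z) lerDl powR_ge0.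
have tE N z : t N z = z - h N z by rewrite {2}(htE N z) addrAC subrr add0r.
apply/cvgrPdist_le => /= d d0; have d3 : 0 < d / 3 by rewrite divr_gt0.
have C0 : 0 <= C := le_trans (normr_ge0 _) (wC 0%N).
have [c c0 mod] := powR_uniform (`|y| + C) d3.
have c2 : 0 < c / 2 by rewrite divr_gt0.
have cc : c / 2 <= c by rewrite ler_pdivrMr// ler_peMr ?(ltW c0)// ler1n.
have cp0 : 0 < (c / 2) `^ p by exact: powR_gt0.
have small (v : V) (m : R) : `|0 - `|v| `^ p| <= m -> `|v| `^ p <= m.
  by rewrite sub0r normrN ger0_norm ?powR_ge0.
have small' (v : V) : `|v| `^ p <= (c / 2) `^ p -> `|v| <= c / 2.
  by rewrite powR_leE// ltW.
have /cvgrPdist_le tc := t_cvg.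
have [N1 _ N1P] := tc _ d3; have [N2 _ N2P] := tc _ cp0.
pose N := maxn N1 N2.
have Nd : `|t N y| `^ p <= d / 3 by apply/small/N1P/leq_maxl.
have Nc : `|t N y| <= c / 2 by apply/small'/small/N2P/leq_maxr.
have /cvgrPdist_le/(_ _ cp0)[n0 _ n0P] := h_cvg N; exists n0 => // n nn.
have hc : `|h N (w n)| <= c / 2 by apply/small'/small/n0P.
have wn := wC n.
have m1 : `| `|y + w n| `^ p - `|h N y + t N (w n)| `^ p| <= d / 3.
  have yw : `|y| + `|w n| <= `|y| + C by rewrite lerD2l.
  apply: mod; [exact: normr_ge0|exact: normr_ge0|exact: le_trans (ler_normD _ _) yw| |].
    by apply: le_trans yw; rewrite (le_trans (ler_normD _ _))// lerD.
  rewrite (le_trans (ler_dist_dist _ _))//.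
  have -> : y + w n - (h N y + t N (w n)) = t N y + h N (w n).
    by rewrite !tE opprD addrACA opprB [w n + _]addrC subrK.
  by rewrite (le_trans (ler_normD _ _))// [leRHS]splitr lerD.
have m2 : `| `|w n| `^ p - `|t N (w n)| `^ p| <= d / 3.
  apply: mod => //; first by rewrite (le_trans wn)// lerDr.
    by rewrite (le_trans (t_le _ _))// (le_trans wn)// lerDr.
  rewrite (le_trans (ler_dist_dist _ _))// tE opprB addrCA subrr addr0.
  exact: le_trans hc cc.
exact: arith m1 m2 (y_norm N y) (ht_norm N y (w n)) (powR_ge0 _ _) Nd.
Qed.

End gliding_hump.

Lemma lp_weak_null (R : realType) (p : R) (p1 : 1 <= p) (E : nat -> normedModType R)
    (y : lp_sum p1 E) (w : nat -> lp_sum p1 E) (C : R) : (forall n, `|w n| <= C) ->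
  (forall k, w n k @[n --> \oo] --> (0 : E k)) ->
  `|y + w n| `^ p - `|w n| `^ p @[n --> \oo] --> `|y| `^ p.
Proof.
move=> wC w0; have p0 : 0 < p := lt_le_trans ltr01 p1.
apply: (@gliding_hump _ _ p0 _ (@head _ _ p1 E) (@tail _ _ p1 E) y w C) => //.
- by move=> N z; rewrite /tail addrCA subrr addr0.
- exact: head_tail_norm.
- exact: tail_cvg.
- by move=> N; exact: head_cvg.
Qed.

Section converse.
Context {R : realType} (p : R) (p1 : 1 < p) (E : nat -> completeNormedModType R)
  (X : completeNormedModType R).
Hypothesis E_fin : forall n, finite_dim (E n).

Let p0 : 0 < p. Proof. exact: lt_trans p1. Qed.

Lemma embedding_asymptotics (T : {linear X -> C_ p1 E}) (K : R) (x : X) (u : nat -> X) (C : R) :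
  0 < K -> (forall x, `|T x| <= K * `|x|) -> (forall n, `|u n| <= C) -> weak0 u ->
  `|T x + T (u n)| `^ p - `|T (u n)| `^ p @[n --> \oo] --> `|T x| `^ p.
Proof.
move=> K0 TK uC wu; apply: (@lp_weak_null _ _ _ _ _ _ (K * C)) => [n|k].
  by rewrite (le_trans (TK _))// ler_pM2l.
apply: finite_dim_weak0 => // f df.
have dg : dball K (fun x => f (T x k)).
  split=> [a v w|v]; first by rewrite linearP df.1.
  rewrite (le_trans (df.2 _))// mul1r (le_trans (lp_coord_le (T v) k))//.
have -> : (fun n => f (T (u n) k)) = (fun n => K * (K^-1 * f (T (u n) k))).
  by apply/funext => n; rewrite mulrA mulfV ?mul1r// gt_eqF.
rewrite -[0](mulr0 K); apply: cvgMl_tmp; exact: (wu _ (dball_inv K0 dg)).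
Qed.

Lemma embedding_mprop : (forall e : R, 0 < e ->
    exists X0 : submodClosed (C_ p1 E), (bm_dist X (subnormed X0) < (1 + e)%:E)%E) ->
  mprop X p.
Proof.
have arith (q k a b c a' b' c' d : R) : 1 <= q -> (q - 1) * (a + k + 1) <= d / 3 -> b <= k ->
    a <= a' -> a' <= q * a -> b <= b' -> b' <= q * b -> c <= c' -> c' <= q * c ->
    0 <= b -> `|a' - (c' - b')| <= d / 3 -> `|a - (c - b)| <= d.
  move=> q1 qL bk aa a'a bb b'b cc c'c b0; rewrite !ler_norml => /andP[lo hi].
  have qab : (q - 1) * (a + b) <= d / 3.
    by apply: le_trans qL; rewrite ler_wpM2l ?subr_ge0//; lra.
  have cab : c <= a + b + 2 * (d / 3) by lra.
  apply/andP; split; first lra.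
  have [abc|cab'] := leP (a + b) c; first lra.
  have : (q - 1) * c <= (q - 1) * (a + b) by rewrite ler_wpM2l ?subr_ge0// ltW.
  by lra.
move=> emb x u C uC wu; apply/cvgrPdist_le => d d0.
have C0 : 0 <= C := le_trans (normr_ge0 _) (uC 0%N).
pose L := `|x| `^ p + C `^ p + 1.
have L0 : 0 < L by rewrite ltr_wpDl// addr_ge0// powR_ge0.
have dL : 0 < d / 3 / L by rewrite !divr_gt0.
have [e e0 /(_ 1 ler01 (lexx _))] := powR_modulus 1 p0 dL.
rewrite powR1; set q := (1 + e) `^ p => qd.
have [X0 /ereal_inf_lt[_ [T [S [[Tc Sc TS ST] ->]]]]] := emb e e0.
have [A [A0 -> TA]] := op_norm_ex Tc; have [B [B0 -> SB]] := op_norm_ex Sc.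
rewrite -EFinM lte_fin => ABe.
have Pl : linear (fun v => B *: \val (T v) : C_ p1 E).
  by move=> a v w; rewrite linearP /= scalerDr !scalerA mulrC.
pose P : {linear X -> C_ p1 E} := HB.pack (fun v => B *: \val (T v) : C_ p1 E)
  (GRing.isLinear.Build _ _ _ _ _ Pl).
have PE v : `|P v| = B * `|T v| by rewrite /= normrZ ger0_norm.
have P1 v : `|v| <= `|P v| by rewrite PE -{1}(TS v).
have P2 v : `|P v| <= (1 + e) * `|v|.
  rewrite PE (le_trans (ler_wpM2l B0 (TA v)))// mulrA ler_wpM2r// mulrC; exact: ltW.
have e1 : 0 < 1 + e by rewrite addr_gt0.
have P1p v : `|v| `^ p <= `|P v| `^ p by rewrite powR_le// ltW.
have P2p v : `|P v| `^ p <= q * `|v| `^ p.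
  by rewrite -powRM ?(ltW e1)// powR_le// ltW.
have d3 : 0 < d / 3 by rewrite divr_gt0.
have /cvgrPdist_le/(_ _ d3)[n0 _ n0P] := @embedding_asymptotics P (1 + e) x u C e1 P2 uC wu.
exists n0 => // n nn.
have main : `| `|P x| `^ p - (`|P (x + u n)| `^ p - `|P (u n)| `^ p)| <= d / 3.
  by have := n0P n nn; rewrite -linearD.
have e1' : 1 <= 1 + e by rewrite lerDl ltW.
have q1 : 1 <= q by exact: le_trans e1' (le1r_powR e1' (ltW p1)).
have qL : (q - 1) * L <= d / 3 by rewrite -ler_pdivlMr// lerBlDl.
have un : `|u n| `^ p <= C `^ p by rewrite powR_le// ltW.
have h := arith q _ _ _ _ _ _ _ d q1 qL un (P1p x) (P2p x) (P1p (u n)) (P2p (u n)) (P1p (x + u n))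
  (P2p (x + u n)) (powR_ge0 _ _).
exact: h main.
Qed.

End converse.

Theorem theorem4p3 (R : realType) (E : nat -> completeNormedModType R)
    (E_fin : forall n, finite_dim (E n)) (E_dense : bm_dense E)
    (p : R) (p1 : 1 < p) (X : completeNormedModType R) :
  separable_space X -> ~ contains_l1 X ->
  (property_m X p <->
   forall e : R, 0 < e ->
     exists X0 : submodClosed (C_ p1 E),
       closed [set x | x \in X0] /\
       (bm_dist X (subnormed X0) < (1 + e)%:E)%E).
Proof.
move=> Xsep nl1; have p0 : 0 < p by exact: lt_trans p1.
split=> [Xm e e0|emb].
  by apply: mprop_embedding => //; exact: property_m_mprop.
apply: (mprop_property_m p0); refine (@embedding_mprop _ _ p1 E X E_fin _) => e /emb[X0 [_ ?]].
by exists X0.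
Qed.
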